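(* Let $n\ge 1$ be an integer, let $\alpha$ be an irrational real number, and let $k\in\{n-3,\,-(n-3)\}$. Let $\mathcal H_{n,k,\alpha}=\operatorname{Hom}(V_{n\alpha+k},V_\alpha^{\otimes n})$ be the representation of the braid group $\mathrm{Br}_n$ equipped with its non-degenerate Hermitian form (possibly of mixed signature). Then the image of $\mathrm{Br}_n$ in $\mathrm{PSU}(\mathcal H_{n,k,\alpha})$ is dense.
   Context: Put $q=e^{\pi i/2}$, $q^x=e^{\pi i x/2}$, $\{x\}=q^x-q^{-x}$, $[x]=\{x\}/\{1\}=\sin(\pi x/2)$. Modules. The unrolled quantum group is the Hopf algebra over $\mathbb C$ generated by $E,F,K^{\pm1},H$ with relations $KEK^{-1}=q^2E$, $KFK^{-1}=q^{-2}F$, $[E,F]=\frac{K-K^{-1}}{q-q^{-1}}$, $HK=KH$, $[H,E]=2E$, $[H,F]=-2F$, $E^2=F^2=0$, and coproduct $\Delta(E)=1\otimes E+E\otimes K$, $\Delta(F)=K^{-1}\otimes F+F\otimes 1$, $\Delta(K)=K\otimes K$, $\Delta(H)=H\otimes1+1\otimes H$. One works in the category of finite-dimensional modules on which $H$ is diagonalizable and $K=q^H$. For $\beta\in\mathbb C$, $V_\beta$ has basis $v_0,v_1$ with $Hv_i=(\beta+1-2i)v_i$, $Ev_0=0$, $Ev_1=[1-\beta]v_0$, $Fv_0=v_1$, $Fv_1=0$. The braiding is $c_{V,W}=\tau\circ R:V\otimes W\to W\otimes V$, where $R=q^{H\otimes H/2}(1+\{1\}E\otimes F)$, $q^{H\otimes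 H/2}$ multiplies a tensor of weight vectors of weights $\lambda,\lambda'$ by $q^{\lambda\lambda'/2}$, and $\tau$ is the flip. The generator $\sigma_i$ of the braid group $\mathrm{Br}_n$ on $n$ strands acts on $\mathcal H_{n,k,\alpha}:=\operatorname{Hom}(V_{n\alpha+k},V_\alpha^{\otimes n})$ by post-composition with $c_{V_\alpha,V_\alpha}$ in tensor positions $i,i+1$. Explicit description. $\mathcal H_{n,k,\alpha}$ has a basis (iterated fusion trees with suitably normalized trivalent vertices) indexed by direction sequences $\mathbf s=(s_1,\dots,s_{n-1})\in\{L,R\}^{n-1}$ with (number of $R$'s) $-$ (number of $L$'s) $=k$; equivalently by paths $\mathbf p=(x_0=\alpha,x_1,\dots,x_{n-1}=n\alpha+k)$ with $x_j=x_{j-1}+\alpha+1$ if $s_j=R$ and $x_j=x_{j-1}+\alpha-1$ if $s_j=L$. In this basis: $\sigma_1$ multiplies $\mathbf s$ by $q^{(\alpha-1)^2/2}$ if $s_1=L$ and by $q^{(\alpha+1)^2/2}$ if $s_1=R$. For $i\ge2$, $\sigma_i$ multiplies $\mathbf s$ by $q^{(\alpha-1)^2/2}$ if $(s_{i-1},s_i)=(L,L)$ and by $q^{(\alpha+1)^2/2}$ if $(s_{i-1},s_i)=(R,R)$; and on the span of two sequences agreeing outside positions $i-1,i$, where the first has $(L,R)$ and the second $(R,L)$ there, it acts (on column vectors in this ordered basis) by $A^{-1}\begin{pmatrix}q^{(\alpha-1)^2/2}&0\\0&q^{(\alpha+1)^2/2}\end{pmatrix}A$ with $A=\begin{pmatrix}[\alpha+1]&[\alpha+1]\\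 [(i+1)\alpha+\gamma-1]&[(i-1)\alpha+\gamma-1]\end{pmatrix}$, where $\gamma$ is the number of $R$'s minus the number of $L$'s among $s_1,\dots,s_{i-2}$. Hermitian form. The non-degenerate Hermitian form on $\mathcal H_{n,k,\alpha}$ is the one for which this basis is orthogonal, with $\langle\mathbf p|\mathbf p\rangle=-\frac1{[n\alpha+k+1]}\prod_{j=0}^{n-2}w_j$, where $w_j=[x_j+\alpha]^2$ if $x_{j+1}=x_j+\alpha+1$ and $w_j=\frac{[x_j+\alpha]}{[x_j+1][\alpha+1]}$ if $x_{j+1}=x_j+\alpha-1$. It is preserved by $\mathrm{Br}_n$. For a non-degenerate (possibly indefinite) Hermitian space $\mathcal H$, $\mathrm U(\mathcal H)$ is the group of linear automorphisms preserving the form and $\mathrm{PSU}(\mathcal H)$ is $\mathrm{SU}(\mathcal H)$ modulo its center, identified with $\mathrm U(\mathcal H)$ modulo unit scalars; density is with respect to the standard (Lie group) topology. A zero space gives the trivial group. *)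

(* Defs.v *)
From HB Require Import structures.
From mathcomp Require Import all_boot all_order all_algebra.
From mathcomp Require Import ring complex.
From mathcomp Require Import all_classical all_reals all_analysis.

Set Implicit Arguments.
Unset Strict Implicit.
Unset Printing Implicit Defensive.

Import Order.TTheory GRing.Theory Num.Theory.
Import numFieldNormedType.Exports.
Local Open Scope classical_set_scope.
Local Open Scope ring_scope.
Local Open Scope quotient_scope.

(* q^x = e^{pi i x / 2} *)
Definition qpow (R : realType) (x : R) : R[i] :=
  Complex (cos (pi * x / 2)) (sin (pi * x / 2)).

Definition qbrace (R : realType) (x : R) : R[i] := qpow x - qpow (- x).

(* [x] = {x} / {1} *)
Definition qnum (R : realType) (x : R) : R := sin (pi * x / 2).

Lemma qnumE (R : realType) (x : R) : (qnum x)%:C%C = qbrace x / qbrace 1.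
Proof.
have two0 : (2 : R) != 0 by rewrite pnatr_eq0.
have pi2 : pi * 1 / 2 = pi / 2 :> R by rewrite mulr1.
have E (y : R) : qbrace y = (qnum y)%:C%C * Complex 0 2.
  rewrite /qbrace /qpow /qnum /real_complex_def mulrN mulNr cosN sinN.
  by apply/eqP; rewrite eq_complex /=; apply/andP; split; apply/eqP; ring.
rewrite !E; have -> : qnum (1 : R) = 1 by rewrite /qnum pi2 sin_pihalf.
have -> : (1 : R)%:C%C = 1 by [].
by rewrite mul1r mulfK// eq_complex /= negb_and two0 orbT.
Qed.

(* The vector space with basis I. The codomain is the regular module, so that
   this is a vectType over R[i]. *)
Definition fspace (R : realType) (I : finType) : vectType R[i] :=
  {ffun I -> (R[i])^o}.

Definition evec (R : realType) (I : finType) (i : I) : fspace R I :=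
  [ffun j => (j == i)%:R].

Definition diag_fun (R : realType) (I : finType) (d : I -> R[i])
  (u : fspace R I) : fspace R I := [ffun i => d i * u i].

Fact diag_fun_linear (R : realType) (I : finType) (d : I -> R[i]) :
  linear (@diag_fun R I d).
Proof. by move=> a u v; apply/ffunP => i; rewrite !ffunE /= mulrDr mulrCA. Qed.

HB.instance Definition _ (R : realType) (I : finType) (d : I -> R[i]) :=
  GRing.isLinear.Build R[i] (fspace R I) (fspace R I) *:%R (@diag_fun R I d)
    (@diag_fun_linear R I d).

Definition diag_op (R : realType) (I : finType) (d : I -> R[i]) :
  'End(fspace R I) := linfun (diag_fun d).

Definition tens_fun (R : realType) (I J I' J' : finType)
  (f : 'Hom(fspace R I, fspace R I')) (g : 'Hom(fspace R J, fspace R J'))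
  (u : fspace R (I * J)%type) : fspace R (I' * J')%type :=
  [ffun p => \sum_(i : I) \sum_(j : J)
               u (i, j) * (f (evec R i) p.1 * g (evec R j) p.2)].

Fact tens_fun_linear (R : realType) (I J I' J' : finType)
  (f : 'Hom(fspace R I, fspace R I')) (g : 'Hom(fspace R J, fspace R J')) :
  linear (tens_fun f g).
Proof.
move=> a u v; apply/ffunP => p; rewrite !ffunE /=.
rewrite scaler_sumr -big_split /=; apply: eq_bigr => i _.
rewrite scaler_sumr -big_split /=; apply: eq_bigr => j _.
by rewrite !ffunE /= mulrDl scalerAl.
Qed.

HB.instance Definition _ (R : realType) (I J I' J' : finType)
  (f : 'Hom(fspace R I, fspace R I')) (g : 'Hom(fspace R J, fspace R J')) :=
  GRing.isLinear.Build R[i] (fspace R (I * J)%type) (fspace R (I' * J')%type)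
    *:%R (tens_fun f g) (tens_fun_linear f g).

Definition tens (R : realType) (I J I' J' : finType)
  (f : 'Hom(fspace R I, fspace R I')) (g : 'Hom(fspace R J, fspace R J')) :
  'Hom(fspace R (I * J)%type, fspace R (I' * J')%type) := linfun (tens_fun f g).

(* Used for the flip, the associators and the left unit constraint. *)
Definition reindex_fun (R : realType) (I J : finType) (h : J -> I)
  (u : fspace R I) : fspace R J := [ffun j => u (h j)].

Fact reindex_fun_linear (R : realType) (I J : finType) (h : J -> I) :
  linear (@reindex_fun R I J h).
Proof. by move=> a u v; apply/ffunP => i; rewrite !ffunE. Qed.

HB.instance Definition _ (R : realType) (I J : finType) (h : J -> I) :=
  GRing.isLinear.Build R[i] (fspace R I) (fspace R J) *:%R
    (@reindex_fun R I J h)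
    (@reindex_fun_linear R I J h).

Definition reindex_op (R : realType) (I J : finType) (h : J -> I) :
  'Hom(fspace R I, fspace R J) := linfun (@reindex_fun R I J h).

Definition flip (R : realType) (I J : finType) :
  'Hom(fspace R (I * J)%type, fspace R (J * I)%type) :=
  reindex_op R (fun p => (p.2, p.1)).

Definition assocr (R : realType) (I J L : finType) :
  'Hom(fspace R ((I * J) * L)%type, fspace R (I * (J * L))%type) :=
  reindex_op R (fun p => ((p.1, p.2.1), p.2.2)).

Definition assocl (R : realType) (I J L : finType) :
  'Hom(fspace R (I * (J * L))%type, fspace R ((I * J) * L)%type) :=
  reindex_op R (fun p => (p.1.1, (p.1.2, p.2))).

(* A finite-dimensional module with a chosen basis of H-eigenvectors: H is
   diagonal with entries wt, and K = q^H. Only real weights are allowed, which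
   covers all the modules needed when alpha is real. The defining relations are
   not fields of the record; they hold for Vmod and are inherited by tensor. *)
Record wmodule (R : realType) := WModule {
  wbasis : finType ;
  wt : wbasis -> R ;
  opE : 'End(fspace R wbasis) ;
  opF : 'End(fspace R wbasis) }.

Definition opH (R : realType) (M : wmodule R) : 'End(fspace R (wbasis M)) :=
  diag_op (fun b => (wt b)%:C%C).

Definition opK (R : realType) (M : wmodule R) : 'End(fspace R (wbasis M)) :=
  diag_op (fun b => qpow (wt b)).

Definition opKV (R : realType) (M : wmodule R) : 'End(fspace R (wbasis M)) :=
  diag_op (fun b => qpow (- wt b)).

Definition tensor (R : realType) (M N : wmodule R) : wmodule R :=
  @WModule R (wbasis M * wbasis N)%type
    (fun b => wt b.1 + wt b.2)
    (tens \1%VF (opE N) + tens (opE M) (opK N))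
    (tens (opKV M) (opF N) + tens (opF M) \1%VF).

Definition unit_module (R : realType) : wmodule R :=
  @WModule R unit (fun=> 0) 0 0.

(* In Vmod beta, v_0 and v_1 are indexed by false and true. *)
Definition V_E_fun (R : realType) (beta : R) (u : fspace R bool) :
  fspace R bool :=
  [ffun b : bool => if b then 0 else (qnum (1 - beta))%:C%C * u true].

Fact V_E_fun_linear (R : realType) (beta : R) : linear (V_E_fun beta).
Proof.
move=> a u v; apply/ffunP => -[]; rewrite !ffunE /=.
  by rewrite scaler0 addr0.
by rewrite mulrDr mulrCA.
Qed.

HB.instance Definition _ (R : realType) (beta : R) :=
  GRing.isLinear.Build R[i] (fspace R bool) (fspace R bool) *:%R (V_E_fun beta)
    (V_E_fun_linear beta).

Definition V_F_fun (R : realType) (u : fspace R bool) : fspace R bool :=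
  [ffun b : bool => if b then u false else 0].

Fact V_F_fun_linear (R : realType) : linear (@V_F_fun R).
Proof.
by move=> a u v; apply/ffunP => -[]; rewrite !ffunE //= scaler0 addr0.
Qed.

HB.instance Definition _ (R : realType) :=
  GRing.isLinear.Build R[i] (fspace R bool) (fspace R bool) *:%R (@V_F_fun R)
    (@V_F_fun_linear R).

Definition Vmod (R : realType) (beta : R) : wmodule R :=
  @WModule R bool (fun b => beta + 1 - 2 * (nat_of_bool b)%:R)
    (linfun (V_E_fun beta)) (linfun (@V_F_fun R)).

(* The n-th tensor power of Vmod alpha, bracketed to the left and starting from
   the unit module. *)
Fixpoint tpow (R : realType) (alpha : R) (n : nat) : wmodule R :=
  if n is m.+1 then tensor (tpow alpha m) (Vmod alpha) else unit_module R.

Definition Rmatrix (R : realType) (M N : wmodule R) :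
  'End(fspace R (wbasis M * wbasis N)%type) :=
  (diag_op (fun b => qpow (wt b.1 * wt b.2 / 2))
   \o (\1 + qbrace (1 : R) *: tens (opE M) (opF N)))%VF.

Definition braiding (R : realType) (M N : wmodule R) :
  'Hom(fspace R (wbasis M * wbasis N)%type,
       fspace R (wbasis N * wbasis M)%type) :=
  (flip R (wbasis M) (wbasis N) \o Rmatrix M N)%VF.

Definition braid_last (R : realType) (alpha : R) (W : finType) :
  'End(fspace R ((W * bool) * bool)%type) :=
  (assocl R W bool bool
   \o (tens (\1%VF : 'End(fspace R W)) (braiding (Vmod alpha) (Vmod alpha))
       \o assocr R W bool bool))%VF.

(* For 1 <= i < n, sigma alpha n i is the braiding in the tensor positions i
   and i + 1 of the n-th tensor power; other values of i are not used. *)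
Fixpoint sigma (R : realType) (alpha : R) (n i : nat) :
  'End(fspace R (wbasis (tpow alpha n))) :=
  match n return 'End(fspace R (wbasis (tpow alpha n))) with
  | 0 => \1%VF
  | m.+1 =>
      if (i < m)%N then tens (sigma alpha m i) \1%VF
      else match m return 'End(fspace R (wbasis (tpow alpha m.+1))) with
           | 0 => \1%VF
           | l.+1 => braid_last alpha (wbasis (tpow alpha l))
           end
  end.

(* Elements of Br_n, presented as words: (i, false) stands for the generator
   sigma_{i+1} and (i, true) for its inverse. *)
Definition braid_word (n : nat) := seq ('I_n.-1 * bool).

Definition braid_act (R : realType) (alpha : R) (n : nat) (w : braid_word n) :
  'End(fspace R (wbasis (tpow alpha n))) :=
  foldr (fun (l : 'I_n.-1 * bool) g =>
           ((if l.2 then (sigma alpha n l.1.+1)^-1 else sigma alpha n l.1.+1)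
            \o g)%VF) \1%VF w.

Definition comm_fun (R : realType) (I J : finType) (A : 'End(fspace R J))
  (B : 'End(fspace R I)) (f : 'Hom(fspace R I, fspace R J)) :
  'Hom(fspace R I, fspace R J) := (A \o f)%VF - (f \o B)%VF.

Fact comm_fun_linear (R : realType) (I J : finType) (A : 'End(fspace R J))
  (B : 'End(fspace R I)) : linear (comm_fun A B).
Proof.
move=> a f g; rewrite /comm_fun comp_lfunDl comp_lfunDr -comp_lfunZl.
by rewrite -comp_lfunZr scalerBr opprD addrACA.
Qed.

HB.instance Definition _ (R : realType) (I J : finType) (A : 'End(fspace R J))
  (B : 'End(fspace R I)) :=
  GRing.isLinear.Build R[i] 'Hom(fspace R I, fspace R J)
    'Hom(fspace R I, fspace R J) *:%R (comm_fun A B) (comm_fun_linear A B).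

Definition intertwiners (R : realType) (I J : finType) (A : 'End(fspace R J))
  (B : 'End(fspace R I)) : {vspace 'Hom(fspace R I, fspace R J)} :=
  lker (linfun (comm_fun A B)).

Definition homspace (R : realType) (M N : wmodule R) :
  {vspace 'Hom(fspace R (wbasis M), fspace R (wbasis N))} :=
  (intertwiners (opE N) (opE M) :&: intertwiners (opF N) (opF M)
   :&: intertwiners (opK N) (opK M) :&: intertwiners (opH N) (opH M))%VS.

Definition out_color (R : realType) (n : nat) (k : int) (alpha : R) : R :=
  n%:R * alpha + k%:~R.

Definition Hspace (R : realType) (n : nat) (k : int) (alpha : R) :
  vectType R[i] :=
  subvs_of (homspace (Vmod (out_color n k alpha)) (tpow alpha n)).

(* Directions R and L are true and false, and s j is the direction s_{j+1}. *)
Definition xpath (R : realType) (alpha : R) (s : nat -> bool) (j : nat) : R :=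
  alpha + \sum_(l < j) (alpha + (if s l then 1 else -1)).

(* The trivalent vertices
     Vmod (x + alpha + 1) -> Vmod x (x) Vmod alpha   (direction R),
     Vmod (x + alpha - 1) -> Vmod x (x) Vmod alpha   (direction L)
   send v_0 to the vector below and v_1 to F applied to it. The scaling of these
   highest weight vectors is the one for which sigma_i acts on the fusion trees
   with (L,R) and (R,L) in positions i-1, i by
   A^-1 diag(q^((alpha-1)^2/2), q^((alpha+1)^2/2)) A, where A has rows
   ([alpha+1], [alpha+1]) and ([(i+1)alpha+gamma-1], [(i-1)alpha+gamma-1]). *)
Definition vertex_hw (R : realType) (alpha : R) (d : bool) (x : R) :
  fspace R (bool * bool)%type :=
  if d then (qnum (x + alpha))%:C%C *: evec R (false, false)
  else (qnum (alpha + 1) / qnum (x + 1))%:C%C *: evec R (true, false)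
       - qpow (alpha + 1) *: evec R (false, true).

Definition vertex_fun (R : realType) (alpha : R) (d : bool) (x : R)
  (u : fspace R bool) : fspace R (bool * bool)%type :=
  u false *: vertex_hw alpha d x
  + u true *: opF (tensor (Vmod x) (Vmod alpha)) (vertex_hw alpha d x).

Fact vertex_fun_linear (R : realType) (alpha : R) (d : bool) (x : R) :
  linear (vertex_fun alpha d x).
Proof.
move=> a u v; rewrite /vertex_fun !ffunE /= !scalerDl scalerDr !scalerA.
by rewrite addrACA.
Qed.

HB.instance Definition _ (R : realType) (alpha : R) (d : bool) (x : R) :=
  GRing.isLinear.Build R[i] (fspace R bool) (fspace R (bool * bool)%type) *:%R
    (vertex_fun alpha d x) (vertex_fun_linear alpha d x).

Definition vertex (R : realType) (alpha : R) (d : bool) (x : R) :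
  'Hom(fspace R bool, fspace R (bool * bool)%type) :=
  linfun (vertex_fun alpha d x).

(* The iterated fusion tree Vmod x_{n-1} -> V_alpha^n of s_1, ..., s_{n-1}, for
   n >= 1. For n = 1 it is the canonical map to unit_module (x) Vmod alpha. *)
Fixpoint tree (R : realType) (alpha : R) (s : nat -> bool) (n : nat) :
  'Hom(fspace R bool, fspace R (wbasis (tpow alpha n))) :=
  match n return 'Hom(fspace R bool, fspace R (wbasis (tpow alpha n))) with
  | 0 => 0
  | m.+1 =>
      match m return
        'Hom(fspace R bool, fspace R (wbasis (tpow alpha m))) ->
        'Hom(fspace R bool, fspace R (wbasis (tpow alpha m.+1))) with
      | 0 => fun=> reindex_op R (fun p : unit * bool => p.2)
      | j.+1 => fun t => (tens t (\1%VF : 'End(fspace R bool))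
                          \o vertex alpha (s j) (xpath alpha s j))%VF
      end (tree alpha s m)
  end.

Definition dirseq (n : nat) (k : int) : finType :=
  {s : n.-1.-tuple bool | (count id s)%:Z - (count negb s)%:Z == k}.

Definition dir (n : nat) (k : int) (s : dirseq n k) : nat -> bool :=
  nth false (val s).

Definition fusion_basis (R : realType) (n : nat) (k : int) (alpha : R) :
  #|dirseq n k|.-tuple 'Hom(fspace R bool, fspace R (wbasis (tpow alpha n))) :=
  [tuple tree alpha (dir (enum_val i)) n | i < #|dirseq n k|].

Definition tree_norm (R : realType) (n : nat) (k : int) (alpha : R)
  (s : dirseq n k) : R :=
  - (qnum (out_color n k alpha + 1))^-1 *
  \prod_(j < n.-1)
     (if dir s j then qnum (xpath alpha (dir s) j + alpha) ^+ 2
      else qnum (xpath alpha (dir s) j + alpha) /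
           (qnum (xpath alpha (dir s) j + 1) * qnum (alpha + 1))).

(* The Hermitian form for which fusion_basis is orthogonal and the tree s has
   square norm tree_norm s; antilinear in the first variable. *)
Definition herm (R : realType) (n : nat) (k : int) (alpha : R)
  (u v : Hspace n k alpha) : R[i] :=
  \sum_(i < #|dirseq n k|)
     (tree_norm alpha (enum_val i))%:C%C *
     ((coord (fusion_basis n k alpha) i (vsval u))^*%C *
      coord (fusion_basis n k alpha) i (vsval v)).

Definition isometry (R : realType) (n : nat) (k : int) (alpha : R)
  (g : 'End(Hspace n k alpha)) : Prop :=
  bijective g /\ forall u v, herm (g u) (g v) = herm u v.

Definition unitary (R : realType) (n : nat) (k : int) (alpha : R) : Type :=
  {g : 'End(Hspace n k alpha) | `[< isometry g >]}.

HB.instance Definition _ (R : realType) (n : nat) (k : int) (alpha : R) :=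
  Choice.copy (unitary n k alpha)
    {g : 'End(Hspace n k alpha) | `[< isometry g >]}.

Definition unitary_mx (R : realType) (n : nat) (k : int) (alpha : R)
  (g : unitary n k alpha) :
  'M[(R[i])^o]_(\dim {: Hspace n k alpha}, \dim {: Hspace n k alpha}) :=
  passmx.mxof (vbasis {: Hspace n k alpha}) (vbasis {: Hspace n k alpha})
    (val g).

(* U(H), with the topology induced by the matrix entries in some basis. *)
Definition unitary_group (R : realType) (n : nat) (k : int) (alpha : R) :
  topologicalType :=
  initial_topology (@unitary_mx R n k alpha).

Definition uval (R : realType) (n : nat) (k : int) (alpha : R)
  (g : unitary_group n k alpha) : 'End(Hspace n k alpha) := sval g.

Definition phase_eq (R : realType) (n : nat) (k : int) (alpha : R)
  (g h : unitary_group n k alpha) : bool :=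
  `[< exists2 z : R[i], `|z| = 1 & uval g = z *: uval h >].

Fact phase_eq_refl (R : realType) (n : nat) (k : int) (alpha : R) :
  reflexive (@phase_eq R n k alpha).
Proof. by move=> g; apply/asboolP; exists 1; rewrite ?normr1 ?scale1r. Qed.

Fact phase_eq_sym (R : realType) (n : nat) (k : int) (alpha : R) :
  symmetric (@phase_eq R n k alpha).
Proof.
have H g h : @phase_eq R n k alpha g h -> phase_eq h g.
  move=> /asboolP[z z1 E]; apply/asboolP; exists z^-1.
    by rewrite normfV z1 invr1.
  by rewrite E scalerA mulVf ?scale1r// -normr_eq0 z1 oner_eq0.
by move=> g h; apply/idP/idP; apply: H.
Qed.

Fact phase_eq_trans (R : realType) (n : nat) (k : int) (alpha : R) :
  transitive (@phase_eq R n k alpha).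
Proof.
move=> g f h /asboolP[z z1 E] /asboolP[w w1 F]; apply/asboolP.
by exists (z * w); rewrite ?normrM ?z1 ?w1 ?mulr1// E F scalerA.
Qed.

Canonical phase_equiv (R : realType) (n : nat) (k : int) (alpha : R) :=
  EquivRel (@phase_eq R n k alpha) (@phase_eq_refl R n k alpha)
    (@phase_eq_sym R n k alpha) (@phase_eq_trans R n k alpha).

(* PSU(H), as U(H) modulo unit scalars with the quotient topology. *)
Definition PSU (R : realType) (n : nat) (k : int) (alpha : R) :
  topologicalType :=
  quotient_topology {eq_quot (@phase_equiv R n k alpha)}.

Definition to_PSU (R : realType) (n : nat) (k : int) (alpha : R)
  (g : unitary_group n k alpha) : PSU n k alpha :=
  \pi_{eq_quot (@phase_equiv R n k alpha)} g.

(* Post-composition with braid_act alpha w, as an element of U(H). *)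
Definition braid_acts_by (R : realType) (n : nat) (k : int) (alpha : R)
  (w : braid_word n) (g : unitary_group n k alpha) : Prop :=
  forall f : Hspace n k alpha,
    vsval (uval g f) = (braid_act alpha w \o vsval f)%VF.

Definition braid_image (R : realType) (n : nat) (k : int) (alpha : R) :
  set (PSU n k alpha) :=
  [set to_PSU g | g in [set g : unitary_group n k alpha |
                          exists w : braid_word n, braid_acts_by w g]].

(* Main.v *)
(** A homomorphism from V_(n alpha + k) is determined by the image of one weight
vector, which lies in the span of the n tensors having a single exceptional
factor.  In these coordinates the generators act by the reduced Burau
representation: up to a phase, the i-th generator is a complex reflection of
infinite order along a vector e_i, where e_i and e_(i+1) are never orthogonal
and no e_i is isotropic, because alpha is irrational.

Let G be the group generated by the image and the phases.  Its tangent directions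
at 1 form a real Lie algebra.  The powers of an irrational rotation are dense in
the circle, so i times the orthogonal projection on e_i is tangent.  Brackets
along the chain e_1, e_2, ... then produce every infinitesimal isometry of rank
two, in particular i times every orthogonal projection of rank one, so that G
approximates all complex reflections.  These generate the unitary group of any
non-degenerate Hermitian form having an orthogonal basis. *)
From HB Require Import structures.
Require Import Defs.
From mathcomp Require Import all_boot all_order all_algebra.
From mathcomp Require Import complex ring lra zify.
From mathcomp Require Import all_classical all_reals all_analysis.
Set Implicit Arguments.
Unset Strict Implicit.
Unset Printing Implicit Defensive.
Import Order.TTheory GRing.Theory Num.Theory.
Import numFieldNormedType.Exports.
Local Open Scope ring_scope.

(** * The circle *)

Section Circle.
Variable R : realType.
Local Notation C := R[i].

(** The form may be indefinite, so its isometry group need not be compact and errors could blow up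
    in long products. Only the one-parameter groups [1 + (e^(ix) - 1) P] with [P] idempotent are
    ever exponentiated; they stay bounded, which controls the errors. Indefiniteness also brings
    isotropic vectors, along which no reflection exists; this is the obstacle when an isometry is
    factored at the end.

    The action comes from the braiding on tensor powers, the form from norms of fusion trees, so
    invariance of the form has to be proved. The link is that the functional [phi p] in the Burau
    formula is, up to a constant, the pairing with its own direction vector [eig p]. To see this the
    trees are rescaled: after division by [tree_factor], their coordinates have one shape for both
    signs of [k], and the form is a constant times the diagonal form with entries
    [[(j+2)A]/[(j+1)A]]. The same coordinates show that the trees are a basis. *)

Definition cabs (z : C) : R := complex.Re `|z|.

Lemma cabsE (z : C) : `|z| = (cabs z)%:C%C.
Proof. by rewrite /cabs RRe_real// normr_real. Qed.

Lemma cabs_ge0 z : 0 <= cabs z.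
Proof. by rewrite -ler0c -cabsE normr_ge0. Qed.

Lemma cabsM y z : cabs (y * z) = cabs y * cabs z.
Proof. by apply: complexI; rewrite rmorphM -!cabsE normrM. Qed.

Lemma cabsD y z : cabs (y + z) <= cabs y + cabs z.
Proof. by rewrite -lecR rmorphD -!cabsE ler_normD. Qed.

Lemma cabsN z : cabs (- z) = cabs z.
Proof. by rewrite /cabs normrN. Qed.

Lemma cabs0 : cabs 0 = 0.
Proof. by rewrite /cabs normr0. Qed.

Lemma cabs1 : cabs 1 = 1.
Proof. by rewrite /cabs normr1. Qed.

Lemma cabsR (x : R) : cabs x%:C%C = `|x|.
Proof. by apply: complexI; rewrite -cabsE normc_def /= expr0n addr0 sqrtr_sqr. Qed.

Lemma cabs_ReIm (z : C) : cabs z <= `|complex.Re z| + `|complex.Im z|.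
Proof.
rewrite {1}(complexE z) (le_trans (cabsD _ _))// cabsM !cabsR lerD2l.
suff -> : cabs 'i%C = 1 by rewrite mul1r.
by rewrite /cabs normc_def /= expr0n expr1n add0r sqrtr1.
Qed.

Definition expi (x : R) : C := Complex (cos x) (sin x).

Lemma expiD x y : expi (x + y) = expi x * expi y.
Proof.
rewrite /expi cosD sinD; apply/eqP; rewrite eq_complex /=.
by apply/andP; split; apply/eqP; ring.
Qed.

Lemma expi0 : expi 0 = 1.
Proof. by rewrite /expi cos0 sin0. Qed.

Lemma cabs_expi x : cabs (expi x) = 1.
Proof. by rewrite /cabs normc_def /= cos2Dsin2 sqrtr1. Qed.

Lemma expiX x k : expi x ^+ k = expi (k%:R * x).
Proof.
elim: k => [|k IH]; first by rewrite mul0r expi0.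
by rewrite exprS IH -expiD -add1n natrD mulrDl mul1r.
Qed.

Lemma expi_2pi (x : R) (l : int) : expi (x + l%:~R * (pi *+ 2)) = expi x.
Proof.
have nat (n : nat) y : expi (y + n%:R * (pi *+ 2)) = expi y.
  elim: n => [|n IH]; first by rewrite mul0r addr0.
  rewrite -natr1 mulrDl mul1r addrA expiD IH /expi cos2pi sin2pi.
  by apply/eqP; rewrite eq_complex /= !mulr0 !mulr1 subr0 add0r !eqxx.
case: l => n; first exact: nat.
by rewrite NegzE mulrNz mulNr -(nat n.+1 (x - _)) subrK.
Qed.

(** A nonnegative argument is requested because [tangent_exp] reaches [expi x] by forward steps from
    0. *)
Lemma expi_surj (z : C) : cabs z = 1 -> exists2 x, 0 <= x & z = expi x.
Proof.
move=> z1; case: z z1 => a b z1.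
have ab : a ^+ 2 + b ^+ 2 = 1.
  by have := add_Re2_Im2 (Complex a b); rewrite cabsE z1 /= expr1n => -[].
have a1 : -1 <= a <= 1.
  rewrite -ler_norml -(@expr_le1 _ 2)// real_normK ?num_real//.
  by rewrite -ab lerDl sqr_ge0.
have sa : sin (acos a) = `|b| by rewrite sin_acos// -ab addrC addKr sqrtr_sqr.
have ca : cos (acos a) = a by rewrite acosK// in_itv.
have [b0|b0] := leP 0 b.
  by exists (acos a); [exact: acos_ge0|rewrite /expi ca sa ger0_norm].
exists (- acos a + pi *+ 2).
  by rewrite addrC subr_ge0 (le_trans (acos_lepi a1))// mulr2n lerDl pi_ge0.
rewrite -[pi *+ 2]mul1r (expi_2pi _ 1) /expi cosN sinN ca sa ltr0_norm//.
by rewrite opprK.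
Qed.

Lemma expi_taylor (eps : R) : 0 < eps ->
  exists2 delta, 0 < delta &
    forall s, 0 < s -> s < delta -> cabs (expi s - 1 - s%:C%C * 'i%C) <= eps * s.
Proof.
move=> e0; have e20 : 0 < eps / 2 by rewrite divr_gt0.
have H (f : R -> R) (l : R) : is_derive (0 : R) (1 : R) f l ->
    exists2 delta, 0 < delta & forall s, 0 < s -> s < delta ->
      `|f s - f 0 - s * l| <= eps / 2 * s.
  move=> [df fl].
  have := df; rewrite /derivable => /cvg_ex[/= l' Hl].
  have ll' : l' = l by rewrite -fl; apply/esym/cvg_lim.
  subst l'; move/cvgrPdist_le : (Hl) => /(_ _ e20).
  rewrite near_withinE => /nbhs_ballP[d /= d0 Hd].
  exists d => // s s0 sd.
  have := Hd s; rewrite /ball /= sub0r normrN gtr0_norm// => /(_ sd).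
  rewrite gt_eqF// => /(_ isT); rewrite addr0 /GRing.scale /= mulr1.
  move=> Hs; rewrite -(ler_pM2l (_ : 0 < s^-1)) ?invr_gt0//.
  rewrite [leRHS]mulrCA mulVf ?gt_eqF// mulr1.
  rewrite -[X in X * `|_|]gtr0_norm ?invr_gt0// -normrM.
  by rewrite mulrBr mulKf ?gt_eqF// distrC.
have [d1 d10 H1] := H cos _ (is_derive_cos (0 : R)).
have [d2 d20 H2] := H sin _ (is_derive_sin (0 : R)).
exists (Num.min d1 d2); first by rewrite lt_min d10.
move=> s s0; rewrite lt_min => /andP[s1 s2].
have := H1 _ s0 s1; have := H2 _ s0 s2.
rewrite sin0 cos0 oppr0 mulr0 mulr1 !subr0 => Hs Hc.
have -> : expi s - 1 - s%:C%C * 'i%C = Complex (cos s - 1) (sin s - s).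
  apply/eqP; rewrite eq_complex /=; apply/andP; split; apply/eqP; ring.
apply: le_trans (cabs_ReIm _) _ => /=; move: Hs; rewrite addr0; lra.
Qed.

(** Dirichlet's pigeonhole: [N + 1] fractional parts fall into [N] cells of length [1/N < eps].
    Irrationality keeps the resulting difference from vanishing. *)
Lemma irrational_approx (b : R) (eps : R) : irrational b -> 0 < eps ->
  exists k : nat, exists2 p : int, 0 < `|k%:R * b - p%:~R| & `|k%:R * b - p%:~R| < eps.
Proof.
move=> irr e0.
pose N := (Num.trunc eps^-1).+1.
have N0 : 0 < N%:R :> R by rewrite ltr0n.
have Ne : N%:R^-1 < eps.
  by rewrite invf_plt// ; exact: truncnS_gt.
pose fr (k : nat) : R := k%:R * b - (Num.floor (k%:R * b))%:~R.
have fr0 k : 0 <= fr k by rewrite subr_ge0 floor_le_tmp.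
have fr1 k : fr k < 1.
  by rewrite ltrBlDl -intrD1 floorD1_gt.
have cellP k : (Num.trunc (N%:R * fr k) < N)%N.
  rewrite truncn_lt_nat; last by rewrite mulr_ge0 ?(ltW N0) ?fr0.
  by rewrite -[ltRHS]mulr1 ltr_pM2l.
pose cell (k : 'I_N.+1) : 'I_N := Ordinal (cellP k).
have /injectiveP : ~~ injectiveb cell.
  apply/negP => /injectiveP /leq_card; rewrite !card_ord ltnn//.
move/existsNP => [k /existsNP[l /not_implyP[ckl kl]]].
wlog lt_kl : k l ckl kl / (k < l)%N.
  move=> W; have [|lk|e] := ltngtP k l; first exact: W.
    by apply: (W l k) => //; exact/nesym.
  by case: kl; apply: val_inj.
exists (l - k)%N; exists (Num.floor (l%:R * b) - Num.floor (k%:R * b)).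
  rewrite normr_gt0; apply/eqP => E; apply: irr.
  have lk0 : (l - k)%:R != 0 :> R by rewrite pnatr_eq0 subn_eq0 -ltnNge.
  exists ((Num.floor (l%:R * b) - Num.floor (k%:R * b))%:~R / (l - k)%:R) => //.
  rewrite fmorph_div /= ratr_int ratr_nat.
  by move/eqP: E; rewrite subr_eq0 => /eqP <-; rewrite mulrC mulKf.
apply: lt_trans Ne.
have -> : (l - k)%:R * b - (Num.floor (l%:R * b) - Num.floor (k%:R * b))%:~R
   = fr l - fr k :> R.
  by rewrite natrB ?(ltnW lt_kl)// /fr intrB; ring.
have /(congr1 (@nat_of_ord _)) /= := ckl => {}ckl.
have tr k' := truncn_itv (mulr_ge0 (ltW N0) (fr0 k')).
have := tr k; have := tr l; rewrite ckl => /andP[l1 l2] /andP[k1 k2].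
rewrite -(ltr_pM2l N0) divff ?gt_eqF// -[X in X * _]gtr0_norm// -normrM.
by move: l1 l2 k1 k2; rewrite -natr1 => *; rewrite ltr_norml; lra.
Qed.

Lemma irrational_dense (b x eps : R) : irrational b -> 0 < eps ->
  exists k : nat, exists l : int, `|k%:R * b - l%:~R - x| <= eps.
Proof.
move=> irr e0.
have [k [p]] := irrational_approx irr e0.
set d := _ - _; rewrite normr_gt0 => d0 de.
(* The sign of [d] is unknown: an integer translate of [x] is chosen on the same side of 0 as [d],
   so that a natural number of steps suffices. *)
have [L L0] : exists L : int, 0 <= (x + L%:~R) / d.
  have xl : x - (Num.floor x)%:~R >= 0 by rewrite subr_ge0 floor_le_tmp.
  have xu : x - (Num.floor x + 1)%:~R <= 0.
    by rewrite subr_le0 ltW// floorD1_gt.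
  have [dp|dn] := ltP 0 d.
    by exists (- Num.floor x); rewrite mulrNz divr_ge0// ltW.
  exists (- (Num.floor x + 1)); rewrite mulrNz mulr_le0// invr_le0//.
have := truncn_itv L0; set j := Num.trunc _ => /andP[j1 j2].
exists (j * k)%N; exists (j%:Z * p + L).
have -> : (j * k)%:R * b - (j%:Z * p + L)%:~R - x = (j%:R - (x + L%:~R) / d) * d.
  by rewrite mulrBl divfK// natrM intrD intrM /d -[j%:~R]/(j%:R); ring.
rewrite normrM; apply: le_trans (ltW de); rewrite ler_piMl//.
by rewrite distrC ger0_norm ?subr_ge0// lerBlDl; move: j2; rewrite -natr1 => /ltW.
Qed.

Lemma expi_dense (b x eps : R) : irrational b -> 0 < eps ->
  exists k : nat, cabs (expi (pi * b) ^+ k - expi x) <= eps.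
Proof.
move=> irr e0; have e20 : 0 < eps / 2 by rewrite divr_gt0.
have pi0 : 0 < pi :> R := pi_gt0 R.
(* [expi (pi * b)] advances by the fraction [b / 2] of a full turn. *)
have irr2 : irrational (b / 2).
  move=> [q _ qb]; apply: irr; exists (q * 2) => //.
  by rewrite rmorphM /= qb ratr_nat divfK// pnatr_eq0.
have /cvgrPdist_le /(_ _ e20) /nbhs_ballP[d1 /= d10 H1] := @continuous_cos R x.
have /cvgrPdist_le /(_ _ e20) /nbhs_ballP[d2 /= d20 H2] := @continuous_sin R x.
pose d := Num.min d1 d2 / 2 / (pi * 2).
have d0 : 0 < d by rewrite !divr_gt0 ?mulr_gt0 ?lt_min ?d10.
have [k [l kl]] := irrational_dense (x / (pi * 2)) irr2 d0.
exists k; rewrite expiX.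
set y := k%:R * (pi * b) - l%:~R * (pi *+ 2).
have -> : expi (k%:R * (pi * b)) = expi y by rewrite -(expi_2pi y l) subrK.
have xy : `|x - y| < Num.min d1 d2.
  have -> : x - y = - ((k%:R * (b / 2) - l%:~R - x / (pi * 2)) * (pi * 2)).
    rewrite /y -mulr_natr; move: (pi : R) (lt0r_neq0 pi0) => p p0.
    by field.
  rewrite normrN normrM [`|pi * 2|]gtr0_norm ?mulr_gt0//.
  apply: (@le_lt_trans _ _ (Num.min d1 d2 / 2)).
    by rewrite -ler_pdivlMr ?mulr_gt0.
  by rewrite ltr_pdivrMr// ltr_pMr ?ltr1n// lt_min d10.
move: xy; rewrite lt_min => /andP[x1 x2].
have := H1 _ x1; have := H2 _ x2 => /= hs hc.
apply: le_trans (cabs_ReIm _) _ => /=.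
by rewrite ![`|_ y - _|]distrC; lra.
Qed.

End Circle.

(** * Tangent directions of a matrix group *)

Section Tangent.
Variables (R : realType) (d : nat).
Local Notation C := R[i].
Local Notation M := 'M[C]_d.

(** The entrywise sum is submultiplicative, but the identity has norm [d]; hence the factors
    [mxnorm 1%:M] below. *)
Definition mxnorm (A : M) : R := \sum_i \sum_j cabs (A i j).

Lemma mxnorm_ge0 A : 0 <= mxnorm A.
Proof. by apply: sumr_ge0 => i _; apply: sumr_ge0 => j _; exact: cabs_ge0. Qed.

Lemma mxnormD A B : mxnorm (A + B) <= mxnorm A + mxnorm B.
Proof.
rewrite -big_split /=; apply: ler_sum => i _; rewrite -big_split /=.
by apply: ler_sum => j _; rewrite mxE cabsD.
Qed.

Lemma mxnormZ c A : mxnorm (c *: A) = cabs c * mxnorm A.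
Proof.
rewrite mulr_sumr; apply: eq_bigr => i _; rewrite mulr_sumr.
by apply: eq_bigr => j _; rewrite mxE cabsM.
Qed.

Lemma mxnormN A : mxnorm (- A) = mxnorm A.
Proof. by rewrite -scaleN1r mxnormZ cabsN cabs1 mul1r. Qed.

Lemma mxnormB A B : mxnorm (A - B) <= mxnorm A + mxnorm B.
Proof. by rewrite -(mxnormN B) mxnormD. Qed.

Lemma mxnorm0 : mxnorm 0 = 0.
Proof. by rewrite -(scale0r 0) mxnormZ cabs0 mul0r. Qed.

Lemma mxnormM A B : mxnorm (A *m B) <= mxnorm A * mxnorm B.
Proof.
rewrite mulr_suml; apply: ler_sum => i _; rewrite mulr_suml.
have le j : cabs ((A *m B) i j) <= \sum_k cabs (A i k) * cabs (B k j).
  rewrite mxE; elim/big_ind2: _ => [|x1 x2 y1 y2 h1 h2|k _].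
  - by rewrite cabs0.
  - exact: le_trans (cabsD _ _) (lerD h1 h2).
  - by rewrite cabsM.
apply: (@le_trans _ _ (\sum_j \sum_k cabs (A i k) * cabs (B k j))).
  by apply: ler_sum => j _; exact: le.
rewrite exchange_big /=; apply: ler_sum => k _; rewrite -mulr_sumr.
rewrite ler_wpM2l ?cabs_ge0// /mxnorm [leRHS](bigD1 k)//= lerDl.
by apply: sumr_ge0 => l _; apply: sumr_ge0 => j _; exact: cabs_ge0.
Qed.

Lemma cabs_le_mxnorm (A : M) i j : cabs (A i j) <= mxnorm A.
Proof.
rewrite /mxnorm (bigD1 i)//= (bigD1 j)//= -addrA lerDl addr_ge0//.
  by apply: sumr_ge0 => ? _; exact: cabs_ge0.
by apply: sumr_ge0 => ? _; apply: sumr_ge0 => ? _; exact: cabs_ge0.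
Qed.

Variable G : M -> Prop.

Definition approximable (A : M) :=
  forall eps, 0 < eps -> exists2 g, G g & mxnorm (g - A) <= eps.

(* The tangent directions at 1: no exponential map is needed to define them, and
   the accuracy eps * s makes it harmless that G is not closed. *)
Definition tangent (X : M) := forall eps, 0 < eps -> exists2 delta, 0 < delta &
  forall s : R, 0 < s -> s < delta ->
    exists2 g, G g & mxnorm (g - 1%:M - s%:C%C *: X) <= eps * s.

Hypothesis G1 : G 1%:M.
Hypothesis GM : forall g h, G g -> G h -> G (g *m h).
Hypothesis GV : forall g, G g -> exists2 h, G h & g *m h = 1%:M.

Lemma approximableM A B :
  approximable A -> approximable B -> approximable (A *m B).
Proof.
move=> hA hB eps e0.
have NA := mxnorm_ge0 A; have NB := mxnorm_ge0 B.
pose K := mxnorm A + mxnorm B + 1.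
have K0 : 0 < K by rewrite /K; lra.
pose e := Num.min 1 (eps / K).
have e'0 : 0 < e by rewrite lt_min ltr01 divr_gt0.
have e1 : e <= 1 by rewrite ge_min lexx.
have eK : e * K <= eps by rewrite -ler_pdivlMr// ge_min lexx orbT.
have [g Gg hg] := hA _ e'0; have [h Gh herm_row] := hB _ e'0.
exists (g *m h); first exact: GM.
have -> : g *m h - A *m B = (g - A) *m (h - B) + (g - A) *m B + A *m (h - B).
  rewrite -mulmxDr subrK mulmxBl mulmxBr; apply/eqP.
  by rewrite -subr_eq0; apply/eqP/matrixP => i j; rewrite !mxE; ring.
apply: le_trans (mxnormD _ _) _; apply: (@le_trans _ _ (e * e + e * mxnorm B + mxnorm A * e)).
  apply: lerD; last by apply: le_trans (mxnormM _ _) _; rewrite ler_wpM2l.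
  apply: le_trans (mxnormD _ _) _; apply: lerD.
    by apply: le_trans (mxnormM _ _) _; rewrite ler_pM ?mxnorm_ge0.
  by apply: le_trans (mxnormM _ _) _; rewrite ler_wpM2r.
apply: le_trans eK; rewrite /K.
have : e * e <= e by rewrite ler_piMr// ltW.
lra.
Qed.

Lemma approximable_mem A : G A -> approximable A.
Proof.
by move=> GA eps e0; exists A => //; rewrite subrr mxnorm0 ltW.
Qed.

(** The estimates below lose a constant factor; it is absorbed once and for all by shrinking [eps],
    which may also be taken below 1. *)
Lemma tangent_weaken (K : R) X :
  (forall eps, 0 < eps -> eps < 1 -> exists2 delta, 0 < delta &
     forall s : R, 0 < s -> s < delta ->
     exists2 g, G g & mxnorm (g - 1%:M - s%:C%C *: X) <= K * (eps * s)) ->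
  tangent X.
Proof.
move=> H eps e0; pose L := `|K| + 1.
have L0 : 0 < L by rewrite /L ltr_wpDl.
pose e := Num.min (1 / 2) (eps / L).
have e'0 : 0 < e by rewrite lt_min !divr_gt0.
have e1 : e < 1 by rewrite gt_min; apply/orP; left; lra.
have [dl d0 Hd] := H e e'0 e1.
exists dl => // s s0 sd; have [g Gg hg] := Hd _ s0 sd; exists g => //.
apply: le_trans hg _.
have eL : e * L <= eps by rewrite -ler_pdivlMr// ge_min lexx orbT.
have : e * s * K <= e * s * L.
  rewrite ler_wpM2l ?mulr_ge0 ?(ltW s0) ?(ltW e'0)// /L.
  by rewrite (le_trans (ler_norm _))// lerDl.
have : e * L * s <= eps * s by rewrite ler_wpM2r// ltW.
lra.
Qed.

(** With [s < eps], terms quadratic in [s] count as [O(eps * s)]. The bound [e2] forces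
    [mxnorm (g - 1) <= 1/2], and then [h = 1 - h (g - 1)] bounds the inverse. *)
Lemma tangent_near X eps : tangent X -> 0 < eps -> eps < 1 ->
  exists2 delta, 0 < delta & forall s, 0 < s -> s < delta ->
  [/\ s < eps & exists g h, [/\ G g, G h, g *m h = 1%:M, h *m g = 1%:M &
   [/\ mxnorm (g - 1%:M - s%:C%C *: X) <= eps * s,
       mxnorm (g - 1%:M) <= s * (mxnorm X + 1) &
       mxnorm h <= 2 * mxnorm 1%:M] ] ].
Proof.
move=> tX e0 e1; have [dl d0 Hd] := tX _ e0.
have NX := mxnorm_ge0 X.
pose e2 := (2 * (mxnorm X + 1))^-1.
have e20 : 0 < e2 by rewrite invr_gt0; lra.
exists (Num.min dl (Num.min eps e2)); first by rewrite !lt_min d0 e0.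
move=> s s0; rewrite !lt_min => /and3P[s1 s2 s3]; split=> //.
have [g Gg hg] := Hd _ s0 s1; have [h Gh gh] := GV Gg.
exists g, h; split=> //; first exact: mulmx1C.
have n1 : mxnorm (g - 1%:M) <= s * (mxnorm X + 1).
  have -> : g - 1%:M = (g - 1%:M - s%:C%C *: X) + s%:C%C *: X by rewrite subrK.
  apply: le_trans (mxnormD _ _) _.
  rewrite mxnormZ cabsR (gtr0_norm s0) mulrDr mulr1 addrC lerD2l.
  by apply: le_trans hg _; rewrite ger_pMl// ltW.
split=> //.
have : mxnorm h <= mxnorm 1%:M + mxnorm h * mxnorm (g - 1%:M).
  have {1}-> : h = 1%:M - h *m (g - 1%:M) by rewrite mulmxBr mulmx1 (mulmx1C gh) opprB addrC subrK.
  by apply: le_trans (mxnormB _ _) _; rewrite lerD2l mxnormM.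
have : mxnorm (g - 1%:M) <= 1 / 2.
  apply: le_trans n1 _.
  have : s * (2 * (mxnorm X + 1)) <= 1 by rewrite -ler_pdivlMr ?mul1r ?ltW//; lra.
  lra.
have := mxnorm_ge0 h; nra.
Qed.

(** Multiplying [1 + sX] by [1 + sY] adds the directions to first order: the cross term
    [s (g - 1) Y] is quadratic in [s]. *)
Lemma tangentD X Y : tangent X -> tangent Y -> tangent (X + Y).
Proof.
move=> tX tY; pose NX := mxnorm X; pose NY := mxnorm Y.
have NX0 : 0 <= NX := mxnorm_ge0 X; have NY0 : 0 <= NY := mxnorm_ge0 Y.
apply: (@tangent_weaken (mxnorm 1%:M + NX + 2 + (NX + 1) * NY)) => eps e0 e1.
have [d1 d10 H1] := tangent_near tX e0 e1.
have [d2 d20 H2] := tangent_near tY e0 e1.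
exists (Num.min d1 d2); first by rewrite lt_min d10.
move=> s s0; rewrite lt_min => /andP[s1 s2].
have [se [g [_ [Gg _ _ _ [hg ng _]]]]] := H1 _ s0 s1.
have [_ [h [_ [Gh _ _ _ [herm_row _ _]]]]] := H2 _ s0 s2.
exists (g *m h); first exact: GM.
have -> : g *m h - 1%:M - s%:C%C *: (X + Y) = g *m (h - 1%:M - s%:C%C *: Y)
  + (g - 1%:M - s%:C%C *: X) + s%:C%C *: ((g - 1%:M) *m Y).
  rewrite !mulmxBr mulmx1 mulmxBl mul1mx -scalemxAr.
  by apply/matrixP => i j; rewrite !mxE; ring.
have n1 : mxnorm g <= mxnorm 1%:M + (NX + 1).
  have {1}-> : g = 1%:M + (g - 1%:M) by rewrite addrC subrK.
  apply: le_trans (mxnormD _ _) _; rewrite lerD2l.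
  apply: le_trans ng _; rewrite -/NX ler_piMl; lra.
apply: le_trans (mxnormD _ _) _.
apply: (@le_trans _ _ ((mxnorm 1%:M + (NX + 1)) * (eps * s) + eps * s
   + s * (s * (NX + 1) * NY))).
  apply: lerD.
    apply: le_trans (mxnormD _ _) _; apply: lerD => //.
    by apply: le_trans (mxnormM _ _) _; rewrite ler_pM ?mxnorm_ge0.
  rewrite mxnormZ cabsR (gtr0_norm s0) ler_wpM2l ?(ltW s0)//.
  by apply: le_trans (mxnormM _ _) _; rewrite ler_wpM2r.
have : s * (s * ((NX + 1) * NY)) <= eps * (s * ((NX + 1) * NY)).
  by rewrite ler_wpM2r ?(ltW se)// mulr_ge0 ?(ltW s0)// mulr_ge0 ?addr_ge0.
lra.
Qed.

Lemma tangent0 : tangent 0.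
Proof.
move=> eps e0; exists 1 => // s s0 _; exists 1%:M => //.
by rewrite scaler0 subr0 subrr mxnorm0 mulr_ge0 ?ltW.
Qed.

Lemma tangentN X : tangent X -> tangent (- X).
Proof.
move=> tX; pose NX := mxnorm X; pose N1 := mxnorm 1%:M.
have NX0 : 0 <= NX := mxnorm_ge0 X; have N10 : 0 <= N1 := mxnorm_ge0 _.
apply: (@tangent_weaken (2 * N1 * (1 + (NX + 1) * NX))) => eps e0 e1.
have [d1 d10 H1] := tangent_near tX e0 e1.
exists d1 => // s s0 s1.
have [se [g [h [Gg Gh gh hg [eg ng nh]]]]] := H1 _ s0 s1.
exists h => //.
have -> : h - 1%:M - s%:C%C *: (- X) = h *m (s%:C%C *: ((g - 1%:M) *m X)
   - (g - 1%:M - s%:C%C *: X)).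
  rewrite mulmxBr -scalemxAr mulmxA !(mulmxBr h) !mulmx1 hg mulmxBl mul1mx -scalemxAr.
  by apply/matrixP => i j; rewrite !mxE; ring.
apply: le_trans (mxnormM _ _) _.
have : mxnorm (s%:C%C *: ((g - 1%:M) *m X) - (g - 1%:M - s%:C%C *: X)) <=
   s * (s * (NX + 1) * NX) + eps * s.
  apply: le_trans (mxnormB _ _) _; apply: lerD => //.
  rewrite mxnormZ cabsR (gtr0_norm s0) ler_wpM2l ?(ltW s0)//.
  by apply: le_trans (mxnormM _ _) _; rewrite ler_wpM2r.
move=> herm_row; apply: (@le_trans _ _ (2 * N1 * (s * (s * (NX + 1) * NX) + eps * s))).
  by rewrite ler_pM ?mxnorm_ge0.
rewrite -[leRHS]mulrA ler_wpM2l ?mulr_ge0//.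
have : s * (s * ((NX + 1) * NX)) <= eps * (s * ((NX + 1) * NX)).
  by rewrite ler_wpM2r ?(ltW se)// mulr_ge0 ?(ltW s0)// mulr_ge0 ?addr_ge0.
lra.
Qed.

Lemma tangentZ (c : R) X : tangent X -> tangent (c%:C%C *: X).
Proof.
have pos (b : R) Y : 0 < b -> tangent Y -> tangent (b%:C%C *: Y).
  move=> b0 tY eps e0; have [dl d0 H] := tY (eps / b) (divr_gt0 e0 b0).
  exists (dl / b) => [|s s0 sd]; first exact: divr_gt0.
  have [] := H (s * b); [exact: mulr_gt0|by rewrite -ltr_pdivlMr|].
  move=> g Gg hg; exists g => //.
  rewrite scalerA -rmorphM; apply: le_trans hg _.
  by rewrite mulrA mulrAC divfK ?gt_eqF.
move=> tX; have [c0|c0|<-] := ltgtP 0 c; first exact: pos.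
  have -> : c%:C%C *: X = - ((- c)%:C%C *: X) by rewrite rmorphN scaleNr opprK.
  by apply: tangentN; apply: pos; rewrite ?oppr_gt0.
by rewrite scale0r; exact: tangent0.
Qed.

Lemma tangent_conj g h X : G g -> G h -> g *m h = 1%:M -> tangent X ->
  tangent (g *m X *m h).
Proof.
move=> Gg Gh gh tX.
apply: (@tangent_weaken (mxnorm g * mxnorm h)) => eps e0 e1.
have [dl d0 H] := tX _ e0; exists dl => // s s0 sd.
have [k Gk hk] := H _ s0 sd; exists (g *m k *m h); first by do 2?apply: GM.
have -> : g *m k *m h - 1%:M - s%:C%C *: (g *m X *m h)
  = g *m (k - 1%:M - s%:C%C *: X) *m h.
  by rewrite !mulmxBr !mulmxBl mulmx1 gh -scalemxAr -scalemxAl.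
apply: le_trans (mxnormM _ _) _; rewrite mulrAC ler_wpM2r ?mxnorm_ge0//.
by apply: le_trans (mxnormM _ _) _; rewrite ler_wpM2l ?mxnorm_ge0.
Qed.

(** An error [Y - X] in the direction costs [s] times its size, which is within the allowed
    accuracy. This lets the bracket be obtained as a limit. *)
Lemma tangent_closed (K : R) X :
  (forall eps, 0 < eps -> eps < 1 -> exists2 Y, tangent Y & mxnorm (Y - X) <= K * eps) ->
  tangent X.
Proof.
move=> H; apply: (@tangent_weaken (1 + K)) => eps e0 e1.
have [Y tY hY] := H _ e0 e1; have [dl d0 Hd] := tY _ e0.
exists dl => // s s0 sd; have [g Gg hg] := Hd _ s0 sd; exists g => //.
have -> : g - 1%:M - s%:C%C *: X = (g - 1%:M - s%:C%C *: Y) + s%:C%C *: (Y - X).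
  by rewrite scalerBr addrA subrK.
apply: le_trans (mxnormD _ _) _; rewrite mulrDl mul1r; apply: lerD => //.
rewrite mxnormZ cabsR (gtr0_norm s0).
by rewrite [leRHS]mulrA [leRHS]mulrC ler_wpM2l// ltW.
Qed.

(** For [g] close to [1 + sX], the conjugate [g Y g^-1] is tangent, and [(g Y g^-1 - Y) / s] tends
    to [[X, Y]] as [s] tends to 0. *)
Lemma tangent_bracket X Y :
  tangent X -> tangent Y -> tangent (X *m Y - Y *m X).
Proof.
move=> tX tY; pose NX := mxnorm X; pose N1 := mxnorm 1%:M.
set Z := X *m Y - _; pose NZ := mxnorm Z; pose NY := mxnorm Y.
have NX0 : 0 <= NX := mxnorm_ge0 X; have N10 : 0 <= N1 := mxnorm_ge0 _.
have NY0 : 0 <= NY := mxnorm_ge0 Y; have NZ0 : 0 <= NZ := mxnorm_ge0 _.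
apply: (@tangent_closed (NZ * (2 * N1 * (NX + 1)) + 2 * NY * (2 * N1))) => eps e0 e1.
have [dl d0 H] := tangent_near tX e0 e1.
pose s := dl / 2; have s0 : 0 < s by rewrite divr_gt0.
have sd : s < dl by rewrite /s; lra.
have [se [g [h [Gg Gh gh hg [eg ng nh]]]]] := H _ s0 sd.
exists ((s^-1)%:C%C *: (g *m Y *m h - Y)).
  by apply: tangentZ; apply: tangentD; [exact: tangent_conj|exact: tangentN].
(* [E] is the first-order remainder of [g]; the identity below comes from
   [g Y h - Y = (g Y - Y g) h] and [h - 1 = h (1 - g)]. *)
pose E := g - 1%:M - s%:C%C *: X.
have sC : (s^-1)%:C%C * s%:C%C = 1 :> C by rewrite -rmorphM mulVf ?gt_eqF.
have -> : (s^-1)%:C%C *: (g *m Y *m h - Y) - Z =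
   Z *m (h *m (1%:M - g)) + (s^-1)%:C%C *: ((E *m Y - Y *m E) *m h).
  have -> : g *m Y *m h - Y = s%:C%C *: (Z *m h) + (E *m Y - Y *m E) *m h.
    rewrite -[X in _ - X]mulmx1 -gh mulmxA -mulmxBl scalemxAl -mulmxDl.
    congr (_ *m _); rewrite /E /Z !mulmxBl !mulmxBr !mul1mx !mulmx1.
    rewrite -!scalemxAl -!scalemxAr.
    by apply/matrixP => i j; rewrite !mxE; ring.
  rewrite scalerDr scalerA sC scale1r (mulmxBr h) mulmx1 hg (mulmxBr Z) mulmx1.
  by rewrite addrAC.
apply: le_trans (mxnormD _ _) _; rewrite mulrDl; apply: lerD.
  apply: le_trans (mxnormM _ _) _; rewrite -mulrA ler_wpM2l//.
  apply: le_trans (mxnormM _ _) _.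
  apply: (@le_trans _ _ (2 * N1 * (s * (NX + 1)))).
    by rewrite ler_pM ?mxnorm_ge0// -mxnormN opprB.
  rewrite -[leRHS]mulrA ler_wpM2l ?mulr_ge0// mulrC ler_wpM2l ?addr_ge0//.
  exact: ltW.
rewrite mxnormZ cabsR gtr0_norm ?invr_gt0//.
have nE : mxnorm (E *m Y - Y *m E) <= 2 * NY * (eps * s).
  apply: le_trans (mxnormB _ _) _.
  have a1 : mxnorm (E *m Y) <= eps * s * NY.
    by apply: le_trans (mxnormM _ _) _; rewrite ler_wpM2r.
  have a2 : mxnorm (Y *m E) <= NY * (eps * s).
    by apply: le_trans (mxnormM _ _) _; rewrite ler_wpM2l.
  lra.
rewrite mulrC ler_pdivrMr//; apply: le_trans (mxnormM _ _) _.
apply: (@le_trans _ _ (2 * NY * (eps * s) * (2 * N1))).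
  by rewrite ler_pM ?mxnorm_ge0.
by rewrite le_eqVlt; apply/orP; left; apply/eqP; ring.
Qed.

(** Idempotency makes [U y = 1 + (e^(iy) - 1) P] a one-parameter group, bounded by [B] for all [y].
    It is followed by powers of one group element [h] close to [U (x / k)]. *)
Lemma tangent_exp (P : M) (x : R) : P *m P = P -> tangent ('i%C *: P) -> 0 <= x ->
  approximable (1%:M + (expi x - 1) *: P).
Proof.
move=> PP tP; rewrite le_eqVlt => /orP[/eqP <-|x0].
  by rewrite expi0 subrr scale0r addr0; apply: approximable_mem.
move=> eps e0.
pose NP := mxnorm P; have NP0 : 0 <= NP := mxnorm_ge0 P.
pose B := mxnorm 1%:M + 2 * NP + 1.
have B1 : 1 <= B by rewrite /B -lerBlDr subrr addr_ge0 ?mulr_ge0 ?mxnorm_ge0.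
pose U (y : R) := 1%:M + (expi y - 1) *: P.
have UD y z : U y *m U z = U (y + z).
  rewrite /U expiD mulmxDr mulmx1 mulmxDl mul1mx -scalemxAl -scalemxAr PP.
  by apply/matrixP => i j; rewrite !mxE; ring.
have NU y : mxnorm (U y) <= B.
  apply: le_trans (mxnormD _ _) _; rewrite mxnormZ /B -addrA lerD2l.
  have := cabsD (expi y) (- 1); rewrite cabsN cabs_expi cabs1 => h.
  apply: (@le_trans _ _ (2 * NP)); last by rewrite lerDl.
  by rewrite ler_wpM2r//; lra.
(* This accuracy makes the total [k * zeta] of the step errors equal to [Num.min 1 eps]; the bound 1
   keeps the powers [H j] below [B + 1]. *)
pose e := Num.min 1 eps / (B * (B + 1)) / (x * (NP + 1)).
have BB0 : 0 < B * (B + 1) by apply: mulr_gt0; lra.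
have xN0 : 0 < x * (NP + 1) by apply: mulr_gt0; lra.
have e'0 : 0 < e by rewrite !divr_gt0// lt_min ltr01.
have [d1 d10 H1] := tP _ e'0; have [d2 d20 H2] := expi_taylor e'0.
pose k := (Num.trunc (x / Num.min d1 d2)).+1.
have d0 : 0 < Num.min d1 d2 by rewrite lt_min d10.
pose s := x / k%:R; have k0 : 0 < k%:R :> R by rewrite ltr0n.
have s0 : 0 < s by rewrite divr_gt0.
have : s < Num.min d1 d2.
  by rewrite ltr_pdivrMr// mulrC -ltr_pdivrMr//; exact: truncnS_gt.
rewrite lt_min => /andP[s1 s2].
have [h Gh herm_row] := H1 _ s0 s1.
have hU : mxnorm (h - U s) <= e * s * (NP + 1).
  have -> : h - U s = (h - 1%:M - s%:C%C *: ('i%C *: P)) -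
     (expi s - 1 - s%:C%C * 'i%C) *: P.
    by rewrite /U; apply/matrixP => i j; rewrite !mxE; ring.
  apply: le_trans (mxnormB _ _) _; rewrite mulrDr mulr1 addrC.
  apply: lerD => //; rewrite mxnormZ ler_wpM2r//.
  exact: H2.
pose eta := e * s * (NP + 1); pose zeta := B * eta * (B + 1).
have kz : k%:R * zeta = Num.min 1 eps.
  have sk : s * k%:R = x by rewrite /s divfK ?gt_eqF.
  have -> : k%:R * zeta = e * (s * k%:R * (NP + 1)) * (B * (B + 1)).
    by rewrite /zeta /eta; ring.
  by rewrite sk /e divfK ?gt_eqF// divfK ?gt_eqF.
have eta0 : 0 <= eta by rewrite /eta mulr_ge0 ?addr_ge0// mulr_ge0 ?ltW.
have zeta0 : 0 <= zeta by apply: mulr_ge0; [apply: mulr_ge0 => //|]; lra.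
pose H j := iter j (mulmx h) 1%:M.
have GH j : G (H j) by elim: j => //= j IH; exact: GM.
have U0 : U 0 = 1%:M by rewrite /U expi0 subrr scale0r addr0.
(* The claim is uniform over a left factor [U y]: in the next step the old error reappears behind
   [U (y + s)], so it is not amplified and only one [zeta] is added. *)
have key j : (j <= k)%N -> forall y,
    mxnorm (U y *m (H j - U (j%:R * s))) <= j%:R * zeta.
  elim: j => [_ y|j IH jk y].
    by rewrite mul0r U0 subrr mulmx0 mxnorm0 mul0r.
  have IHj := IH (ltnW jk).
  have Dj : mxnorm (H j - U (j%:R * s)) <= 1.
    rewrite -[X in mxnorm X]mul1mx -U0; apply: le_trans (IHj 0) _.
    apply: (@le_trans _ _ (k%:R * zeta)); last by rewrite kz ge_min lexx.
    by rewrite ler_wpM2r// ler_nat ltnW.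
  have nH : mxnorm (H j) <= B + 1.
    have -> : H j = U (j%:R * s) + (H j - U (j%:R * s)) by rewrite addrC subrK.
    by apply: le_trans (mxnormD _ _) _; exact: lerD.
  have -> : U y *m (H j.+1 - U (j.+1%:R * s)) =
      U y *m ((h - U s) *m H j) + U (y + s) *m (H j - U (j%:R * s)).
    have -> : j.+1%:R * s = s + j%:R * s by rewrite -natr1 mulrDl mul1r addrC.
    rewrite -(UD s) -(UD y) -mulmxA -mulmxDr; congr (_ *m _).
    by rewrite /H /= mulmxBl mulmxBr addrA subrK.
  apply: le_trans (mxnormD _ _) _; rewrite -natr1 mulrDl mul1r addrC.
  apply: lerD; first exact: IHj.
  apply: le_trans (mxnormM _ _) _; rewrite /zeta -mulrA ler_pM ?mxnorm_ge0//.
  by apply: le_trans (mxnormM _ _) _; rewrite ler_pM ?mxnorm_ge0.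
exists (H k) => //.
have := key k (leqnn k) 0; rewrite U0 mul1mx kz /s mulrCA divff ?gt_eqF// mulr1.
by move=> hk; apply: le_trans hk _; rewrite ge_min lexx orbT.
Qed.

End Tangent.

(** * Groups of isometries of a Hermitian form *)

Local Opaque tangent approximable.

Section Hermitian.
Variables (R : realType) (d : nat).
Local Notation C := R[i].
Local Notation M := 'M[C]_d.
Local Notation V := 'rV[C]_d.
Variable h : V -> V -> C.
Hypothesis h_linear : forall w a u v, h w (a *: u + v) = a * h w u + h w v.
Hypothesis h_sym : forall u v, h v u = ((h u v)^*)%C.

Lemma formZr w a u : h w (a *: u) = a * h w u.
Proof.
have h0 : h w 0 = 0.
  have := h_linear w 1 0 0; rewrite scaler0 addr0 mul1r => /eqP.
  by rewrite -subr_eq subrr eq_sym => /eqP.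
by rewrite -[a *: u]addr0 h_linear h0 addr0.
Qed.

Lemma formDr w u v : h w (u + v) = h w u + h w v.
Proof. by rewrite -[u]scale1r h_linear mul1r scale1r. Qed.

Lemma formNr w u : h w (- u) = - h w u.
Proof. by rewrite -scaleN1r formZr mulN1r. Qed.

Lemma formBr w u v : h w (u - v) = h w u - h w v.
Proof. by rewrite formDr formNr. Qed.

Lemma form0r w : h w 0 = 0.
Proof. by rewrite -(scale0r 0) formZr mul0r. Qed.

Lemma formDl u v w : h (u + v) w = h u w + h v w.
Proof. by rewrite h_sym formDr rmorphD /= -!h_sym. Qed.

Lemma formZl a u w : h (a *: u) w = (a^*)%C * h u w.
Proof. by rewrite h_sym formZr rmorphM /= -h_sym. Qed.

Lemma formNl u w : h (- u) w = - h u w.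
Proof. by rewrite h_sym formNr rmorphN /= -h_sym. Qed.

Lemma formBl u v w : h (u - v) w = h u w - h v w.
Proof. by rewrite formDl formNl. Qed.

Lemma form_sumr (I : Type) (r : seq I) w (F : I -> V) :
  h w (\sum_(i <- r) F i) = \sum_(i <- r) h w (F i).
Proof. by elim/big_rec2: _ => [|i x y _ <-]; rewrite ?form0r// formDr. Qed.

Lemma form_real u : (complex.Re (h u u))%:C%C = h u u.
Proof.
have := h_sym u u; case: (h u u) => a b [] /eqP; rewrite -addr_eq0 => b0.
apply/eqP; rewrite eq_complex /= eqxx /= eq_sym.
by rewrite -mulr2n mulrn_eq0 /= in b0.
Qed.

(** * Rank-one operators, infinitesimal isometries and complex reflections *)

Definition rank1 (v w : V) : M :=
  \matrix_(i, j) (h w (delta_mx 0 i) * v 0 j).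

Lemma mul_rank1 u v w : u *m rank1 v w = h w u *: v.
Proof.
apply/rowP => j; rewrite !mxE {2}[u]row_sum_delta form_sumr mulr_suml.
by apply: eq_bigr => i _; rewrite mxE formZr mulrA.
Qed.

Lemma mx_row_ext (A B : M) : (forall u : V, u *m A = u *m B) -> A = B.
Proof. by move=> AB; apply/row_matrixP => i; rewrite !rowE AB. Qed.

(** The infinitesimal isometry attached to a pair of vectors, of rank at most two. It is
    antisymmetric and only real bilinear: a scalar crosses to the other vector with a
    conjugation. *)
Definition skew (v w : V) : M := rank1 v w - rank1 w v.

Lemma mul_skew u v w : u *m skew v w = h w u *: v - h v u *: w.
Proof. by rewrite mulmxBr !mul_rank1. Qed.

Lemma skewC v w : skew w v = - skew v w.
Proof. by rewrite /skew opprB. Qed.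

Local Opaque skew rank1.

Lemma skewDl u v w : skew (u + v) w = skew u w + skew v w.
Proof.
apply: mx_row_ext => x; rewrite mul_skew [RHS]mulmxDr !mul_skew formDl.
by apply/rowP => i; rewrite !mxE; ring.
Qed.

Lemma skewZl a v w : skew (a *: v) w = skew v ((a^*)%C *: w).
Proof.
apply: mx_row_ext => x; rewrite !mul_skew !formZl conjcK !scalerA.
by congr (_ *: _ - _ *: _); exact: mulrC.
Qed.

Lemma skewZl_real (r : R) v w : skew (r%:C%C *: v) w = r%:C%C *: skew v w.
Proof.
apply: mx_row_ext => x; rewrite -scalemxAr !mul_skew formZl conjc_real.
by rewrite scalerBr !scalerA mulrC.
Qed.

(** An infinitesimal isometry acts on pairs as a derivation, because [h (u B) w = - h u (w B)] for
    [B = skew v' w']. *)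
Lemma bracket_skew v w v' w' :
  skew v w *m skew v' w' - skew v' w' *m skew v w =
  skew (v *m skew v' w') w + skew v (w *m skew v' w').
Proof.
apply: mx_row_ext => u.
rewrite [LHS]mulmxBr !mulmxA [RHS]mulmxDr !mul_skew.
rewrite !(formBr, formZr, formBl, formZl) -!h_sym.
by apply/rowP => i; rewrite !mxE; ring.
Qed.

Lemma skew_self z v :
  skew (z *: v) v = (2 * complex.Im z)%:C%C *: ('i%C *: rank1 v v).
Proof.
apply: mx_row_ext => x; rewrite mul_skew -!scalemxAr mul_rank1 formZl !scalerA -scalerBl.
congr (_ *: _); have -> : h v x * z - (z^*)%C * h v x = (z - (z^*)%C) * h v x by ring.
congr (_ * _); case: z => a b; apply/eqP; rewrite eq_complex /=.
by apply/andP; split; apply/eqP; ring.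
Qed.

Definition line_proj v : M := (h v v)^-1 *: rank1 v v.

Lemma mul_line_proj u v : u *m line_proj v = (h v u / h v v) *: v.
Proof. by rewrite -scalemxAr mul_rank1 scalerA mulrC. Qed.

Lemma line_proj_idem v : h v v != 0 -> line_proj v *m line_proj v = line_proj v.
Proof.
move=> v0; apply: mx_row_ext => u; by rewrite mulmxA !mul_line_proj formZr mulfK.
Qed.

(** For non-isotropic [v], the complex reflection that multiplies [v] by [z] and fixes its
    orthogonal complement. *)
Definition refl_mx v z : M := 1%:M + (z - 1) *: line_proj v.

Lemma mul_refl_mx u v z : u *m refl_mx v z = u + ((z - 1) * (h v u / h v v)) *: v.
Proof. by rewrite mulmxDr mulmx1 -scalemxAr mul_line_proj scalerA. Qed.

Lemma refl_mxM v y z : h v v != 0 -> refl_mx v y *m refl_mx v z = refl_mx v (y * z).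
Proof.
move=> v0; rewrite /refl_mx mulmxDr mulmx1 mulmxDl mul1mx -scalemxAl -scalemxAr.
rewrite line_proj_idem//; move: (line_proj v) => P.
by apply/matrixP => i j; rewrite !mxE; ring.
Qed.

Lemma refl_mx1 v : refl_mx v 1 = 1%:M.
Proof. by rewrite /refl_mx subrr scale0r addr0. Qed.

Definition preserves (g : M) := forall u v, h (u *m g) (v *m g) = h u v.

Lemma preservesM g g' : preserves g -> preserves g' -> preserves (g *m g').
Proof. by move=> hg hg' u v; rewrite !mulmxA hg' hg. Qed.

Lemma preserves_refl_mx v z : h v v != 0 -> z * (z^*)%C = 1 ->
  preserves (refl_mx v z).
Proof.
move=> v0 z1 x y; rewrite !mul_refl_mx !(formDr, formDl, formZr, formZl).
have vv : ((h v v)^*)%C = h v v by rewrite -h_sym.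
rewrite !rmorphM rmorphB rmorph1 /= conjc_inv vv -(h_sym v x).
have z0 : z != 0 by apply: contra_eqN z1 => /eqP ->; rewrite mul0r eq_sym oner_eq0.
have -> : (z^*)%C = z^-1 by apply: (mulfI z0); rewrite z1 divff.
by field; rewrite v0 z0.
Qed.

Variable G : M -> Prop.
Hypothesis G1 : G 1%:M.
Hypothesis GM : forall g g', G g -> G g' -> G (g *m g').
Hypothesis GV : forall g, G g -> exists2 g', G g' & g *m g' = 1%:M.

Local Notation T := (tangent G).
Let TD := @tangentD R d G GM GV.
Let TN := @tangentN R d G GV.
Let TZ := @tangentZ R d G G1 GV.
Let Tbracket := @tangent_bracket R d G G1 GM GV.

(** Tangent directions form only a real space and [skew] is not complex linear, so every complex
    multiple is demanded separately. *)
Definition linked v w := forall z : C, T (skew (z *: v) w).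

Lemma linked_refl v : T ('i%C *: rank1 v v) -> linked v v.
Proof. by move=> tv z; rewrite skew_self; exact: TZ. Qed.

Lemma linked_sym v w : linked v w -> linked w v.
Proof. by move=> vw z; rewrite skewZl skewC; apply: TN; exact: vw. Qed.

Lemma linked_scale v w y z : linked v w -> T (skew (y *: v) (z *: w)).
Proof.
by move=> vw; have := vw ((z^*)%C * y); rewrite -scalerA skewZl conjcK.
Qed.

Lemma linkedDl u v w : linked u w -> linked v w -> linked (u + v) w.
Proof. by move=> uw vw z; rewrite scalerDr skewDl; apply: TD; [exact: uw|exact: vw]. Qed.

Lemma linkedZl a v w : linked v w -> linked (a *: v) w.
Proof. by move=> vw z; rewrite scalerA. Qed.

Lemma mul_irank1 u v : u *m ('i%C *: rank1 v v) = ('i%C * h v u) *: v.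
Proof. by rewrite -scalemxAr mul_rank1 scalerA. Qed.

(** With [c = h v w], the bracket of the two rank-one directions is [skew (c v) w] up to sign. A
    further bracket with [i rank1 v v] produces [skew (i c h(v,v) v) w], up to a term in [v] alone.
    As [h v v] is real and non-zero and [c] is non-zero, [c] and [i c] span all complex scalars over
    the reals. *)
Lemma linked_step v w :
  T ('i%C *: rank1 v v) -> T ('i%C *: rank1 w w) ->
  h v v != 0 -> h v w != 0 -> linked v w.
Proof.
move=> tv tw v0 vw0.
have lv := linked_refl tv; pose c := h v w.
have ic : ('i%C^*)%C = - 'i%C :> C by apply/eqP; rewrite eq_complex /= oppr0 !eqxx.
have ii : 'i%C * 'i%C = -1 :> C by rewrite -expr2 sqr_i.
have T1 : T (skew (c *: v) w).
  have -> : skew (c *: v) w = - (('i%C *: rank1 w w) *m ('i%C *: rank1 v v) -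
      ('i%C *: rank1 v v) *m ('i%C *: rank1 w w)).
    apply: mx_row_ext => u; rewrite mul_skew mulmxN mulmxBr !mulmxA.
    rewrite !mul_irank1 !(formZr, formZl) -h_sym -/c.
    have -> : 'i%C * ('i%C * h w u * c) = - (h w u * c) by rewrite !mulrA ii; ring.
    have -> : 'i%C * ('i%C * h v u * h w v) = - (h w v * h v u).
      by rewrite !mulrA ii; ring.
    by rewrite scalerA !scaleNr opprB opprK addrC.
  by apply: TN; apply: Tbracket.
have T2 : T (skew (('i%C * c * h v v) *: v) w).
  have -> : skew (('i%C * c * h v v) *: v) w =
      (skew (c *: v) w *m ('i%C *: rank1 v v) -
       ('i%C *: rank1 v v) *m skew (c *: v) w) - skew (c *: v) (('i%C * c) *: v).
    apply: mx_row_ext => u; rewrite [LHS]mul_skew mulmxBr mulmxBr !mulmxA.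
    have cM (x y : C) : ((x * y)^*)%C = (x^*)%C * (y^*)%C by rewrite rmorphM.
    rewrite !(mul_skew, mul_irank1) !(formBr, formZr, formZl) !cM ic -/c.
    have -> : ((h v v)^*)%C = h v v by rewrite -h_sym.
    have cc : h w v = (c^*)%C by rewrite h_sym.
    rewrite cc.
    by apply/rowP => i; rewrite !mxE; ring.
  by apply: TD; [apply: Tbracket|apply: TN; exact: linked_scale].
have T3 : T (skew (('i%C * c) *: v) w).
  have [r hr] : exists r : R, h v v = r%:C%C by exists (complex.Re (h v v)); rewrite form_real.
  have r0 : r != 0 by apply: contraNneq v0 => r0; rewrite hr r0.
  move: T2; rewrite hr [_ * r%:C%C]mulrC -[_ *: v]scalerA skewZl_real => T2.
  have := TZ r^-1 T2.
  by rewrite scalerA -rmorphM (mulVf r0) scale1r.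
move=> z; pose y := z / c.
have -> : z *: v = (complex.Re y)%:C%C *: (c *: v)
    + (complex.Im y)%:C%C *: (('i%C * c) *: v).
  rewrite !scalerA -scalerDl; congr (_ *: _).
  by rewrite mulrA -mulrDl [_ * 'i%C]mulrC -complexE /y (divfK vw0).
by rewrite skewDl !skewZl_real; apply: TD; exact: TZ.
Qed.

(** The bracket of [skew v w] and [skew (z u) v] is [skew (h(v,v) z u) w] plus terms in the linked
    pairs [(v, w)], [(u, v)] and [(v, v)]. The ends [u] and [w] may be orthogonal, as distant
    members of the Burau chain are. *)
Lemma linked_trans u v w : linked v v -> h v v != 0 ->
  linked u v -> linked v w -> linked u w.
Proof.
move=> lv v0 uv vw.
have vu := linked_sym uv.
suff H z : T (skew ((h v v * z) *: u) w).
  by move=> z; have := H (z / h v v); rewrite mulrC (divfK v0).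
have := Tbracket (vw 1) (uv z); rewrite bracket_skew !scale1r !mul_skew.
rewrite skewDl -scaleNr scalerA -addrA => Tz.
have T1 : T (skew ((- h (z *: u) v) *: v) w) := vw _.
have T2 : T (skew v (h v w *: (z *: u) - h (z *: u) w *: v)).
  rewrite skewC; apply: TN; rewrite skewDl -scaleNr scalerA; apply: TD.
    exact: uv.
  exact: lv.
by have := TD Tz (TN (TD T1 T2)); rewrite addrK.
Qed.

Variables (m : nat) (e : nat -> V).
Hypothesis e_span : forall u, exists c : nat -> C, u = \sum_(i < m) c i *: e i.
Hypothesis e_nz : forall i, (i < m)%N -> h (e i) (e i) != 0.
Hypothesis e_chain : forall i, (i.+1 < m)%N -> h (e i) (e i.+1) != 0.
Hypothesis e_proj : forall i, (i < m)%N -> T ('i%C *: line_proj (e i)).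

Lemma tangent_rank1 v : T ('i%C *: rank1 v v).
Proof.
have er i : (i < m)%N -> T ('i%C *: rank1 (e i) (e i)).
  move=> im; have := TZ (complex.Re (h (e i) (e i))) (e_proj im).
  by rewrite form_real /line_proj !scalerA mulrAC (divff (e_nz im)) mul1r.
have ll i : (i < m)%N -> linked (e i) (e i) by move=> im; apply: linked_refl; exact: er.
have le i j : (i + j < m)%N -> linked (e i) (e (i + j)).
  elim: j => [|j IH]; first by rewrite addn0; exact: ll.
  rewrite addnS => ij; have ij' := ltnW ij.
  apply: (linked_trans (ll _ ij')) => //; first exact: e_nz.
    exact: IH.
  apply: linked_step; [exact: er|exact: er|exact: e_nz|exact: e_chain].
have lij i j : (i < m)%N -> (j < m)%N -> linked (e i) (e j).
  move=> im jm; have [ij|/ltnW ji] := leqP i j.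
    by rewrite -(subnKC ij); apply: le; rewrite subnKC.
  by apply: linked_sym; rewrite -(subnKC ji); apply: le; rewrite subnKC.
have lsum (c : nat -> C) w : (forall i, (i < m)%N -> linked (e i) w) ->
    linked (\sum_(i < m) c i *: e i) w.
  move=> H; elim/big_ind: _ => [z|x y hx hy|i _].
  - by rewrite scaler0 -(scale0r 0) skewZl_real scale0r; exact: tangent0.
  - exact: linkedDl.
  - by apply: linkedZl; exact: H.
have [c ->] := e_span v.
have lv : linked (\sum_(i < m) c i *: e i) (\sum_(i < m) c i *: e i).
  apply: (lsum) => i im; apply: linked_sym; apply: (lsum) => j jm.
  exact: lij.
(* The scalar [i / 2] makes the coefficient [2 Im] in [skew_self] equal to 1. *)
have := lv ((2^-1)%:C%C * 'i%C); rewrite skew_self.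
suff -> : (2 * complex.Im ((2^-1)%:C%C * 'i%C : C))%:C%C = 1 :> C by rewrite scale1r.
by rewrite /= mul0r mulr1 addr0 mulfV.
Qed.

Lemma approximable_refl_mx v z : h v v != 0 -> z * (z^*)%C = 1 ->
  approximable G (refl_mx v z).
Proof.
move=> v0 z1; have /expi_surj[x x0 ->] : cabs z = 1.
  apply: complexI; rewrite -cabsE; apply/eqP.
  by rewrite -(@eqrXn2 _ 2)// expr1n sqr_normc z1.
apply: tangent_exp => //; first exact: line_proj_idem.
rewrite /line_proj scalerA mulrC -scalerA -form_real -fmorphV.
by apply: TZ; exact: tangent_rank1.
Qed.

Variables (N : nat) (b : nat -> V).
Hypothesis b_span : forall u, exists c : nat -> C, u = \sum_(i < N) c i *: b i.
Hypothesis b_nz : forall i, (i < N)%N -> h (b i) (b i) != 0.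
Hypothesis b_orth : forall i j, (i < N)%N -> (j < N)%N -> i != j -> h (b i) (b j) = 0.

(** A reflection along [u = w - b r] carries [w] back to [b r]. It fixes the earlier [b i]: they are
    orthogonal to [b r], and to [w] because [g] fixes them. The corrected isometry thus fixes one
    more vector. *)
Lemma approximable_step r g : (r < N)%N ->
  (forall g', preserves g' ->
     (forall i, (i <= r)%N -> b i *m g' = b i) -> approximable G g') ->
  preserves g -> (forall i, (i < r)%N -> b i *m g = b i) ->
  h (b r *m g - b r) (b r *m g - b r) != 0 -> approximable G g.
Proof.
move=> rN IH pg fg; set w := b r *m g; set u := w - b r => u0.
have ww : h w w = h (b r) (b r) by exact: pg.
have bb : ((h (b r) (b r))^*)%C = h (b r) (b r) by rewrite -h_sym.
have E1 : h u (b r) = h w (b r) - h (b r) (b r) by rewrite formBl.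
have E2 : h u w = h (b r) (b r) - h (b r) w by rewrite formBl ww.
have E3 : ((h u (b r))^*)%C = - h u w.
  by rewrite E1 E2 rmorphB /= bb -h_sym opprB.
have E3' : ((h u w)^*)%C = - h u (b r) by rewrite -[h u (b r)]conjcK E3 rmorphN opprK.
have E4 : h u u = h u w - h u (b r) by rewrite -formBr.
have uw0 : h u w != 0.
  apply: contraNneq u0 => uw0; rewrite E4 uw0.
  by have := E3; rewrite uw0 oppr0 => /eqP; rewrite conjc_eq0 => /eqP ->; rewrite subr0.
have ub0 : h u (b r) != 0.
  apply: contraNneq uw0 => ub0; have := E3'; rewrite ub0 oppr0 => /eqP.
  by rewrite conjc_eq0.
(* From [h u u = h u w - h u (b r)], this [z] satisfies [(z - 1) h u w = - h u u], so [w] is sent to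
   [w - u]. It has modulus 1 since [h u (b r)] and [- h u w] are conjugate. *)
pose z := h u (b r) / h u w.
have z0 : z != 0 by rewrite mulf_neq0 ?invr_eq0.
have zc : (z^*)%C = z^-1.
  by rewrite /z rmorphM /= conjc_inv E3 E3' invf_div invrN mulrNN.
have z1 : z * (z^*)%C = 1 by rewrite zc divff.
have -> : g = g *m refl_mx u z *m refl_mx u z^-1.
  by rewrite -mulmxA refl_mxM// divff// refl_mx1 mulmx1.
apply: approximableM => //; last first.
  by apply: approximable_refl_mx => //; rewrite -zc conjcK mulrC.
apply: IH => [|i]; first by apply: preservesM => //; exact: preserves_refl_mx.
rewrite mulmxA mul_refl_mx leq_eqVlt => /orP[/eqP->|ir].
  have -> : (z - 1) * (h u w / h u u) = -1.
    move: u0 uw0; rewrite /z E4; move: (h u w) (h u (b r)) => x y xy0 x0.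
    by field; rewrite xy0 x0.
  by rewrite scaleN1r /u opprB addrC subrK.
have iN := ltn_trans ir rN.
have e1 : h w (b i) = 0.
  by rewrite -(fg i ir) pg b_orth// gtn_eqF.
rewrite (fg i ir); have -> : h u (b i) = 0.
  by rewrite formBl e1 b_orth ?subr0// gtn_eqF.
by rewrite mul0r mulr0 scale0r addr0.
Qed.

(* Cartan-Dieudonne: a product of reflections moves the images of the orthogonal
   vectors back one after the other; when w - b is isotropic, first change the
   sign of the b-component of w. *)
Lemma approximable_preserves g : preserves g -> approximable G g.
Proof.
suff H r : (r <= N)%N -> forall g, preserves g ->
    (forall i, (i < N - r)%N -> b i *m g = b i) -> approximable G g.
  by move=> pg; apply: (H N) => // i; rewrite subnn.
elim: r => [_ {}g _ fg|r IH rN {}g pg fg].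
  suff -> : g = 1%:M by apply: approximable_mem.
  apply: mx_row_ext => u; have [c ->] := b_span u.
  rewrite !mulmx_suml; apply: eq_bigr => i _.
  by rewrite -!scalemxAl fg ?subn0// mulmx1.
have sN : (N - r.+1 < N)%N by rewrite ltn_subrL /= (leq_trans _ rN).
have IH' g' : preserves g' -> (forall i, (i <= N - r.+1)%N -> b i *m g' = b i) ->
    approximable G g'.
  move=> pg' fg'; apply: IH => // [|i ir]; first exact: ltnW.
  by apply: fg'; rewrite -ltnS subnSK.
set k := (N - r.+1)%N in fg sN IH'.
set n := h (b k) (b k); have n0 : n != 0 by exact: b_nz.
have [u0|] := eqVneq (h (b k *m g - b k) (b k *m g - b k)) 0; last first.
  exact: approximable_step.
have m1 : -1 * ((-1)^*)%C = 1 :> C by rewrite rmorphN rmorph1 mulrNN mulr1.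
have -> : g = g *m refl_mx (b k) (-1) *m refl_mx (b k) (-1).
  by rewrite -mulmxA refl_mxM// mulrNN mulr1 refl_mx1 mulmx1.
apply: approximableM => //; last exact: approximable_refl_mx.
apply: (approximable_step sN IH') => [|i ik|].
- by apply: preservesM => //; exact: preserves_refl_mx.
- rewrite mulmxA fg// mul_refl_mx b_orth ?mul0r ?mulr0 ?scale0r ?addr0//.
    exact: ltn_trans ik sN.
  by rewrite gtn_eqF.
rewrite mulmxA mul_refl_mx; set w := b k *m g in u0 *.
have ww : h w w = n by exact: pg.
have vw : h (b k) w + h w (b k) = 2 * n.
  move: u0; rewrite !(formBl, formBr) ww -/n opprB => u0.
  have -> : h (b k) w + h w (b k) = 2 * n - (n - h w (b k) + (n - h (b k) w)) by ring.
  by rewrite u0 subr0.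
rewrite !(formBl, formBr, formDl, formDr, formZl, formZr) ww -/n.
have nc : (n^*)%C = n by rewrite /n -h_sym.
rewrite rmorphM rmorphB rmorphN rmorph1 rmorphM /= conjc_inv nc -h_sym.
have -> : h w (b k) = 2 * n - h (b k) w by rewrite -vw addrC addKr.
set t := h (b k) w.
(* Isotropy of [w - b k] says [h (b k) w + h w (b k) = 2 n]. The sign change negates this sum, so
   the new difference has square norm [2 n + 2 n = 4 n]. *)
apply: contraNneq (n0) => E.
have : 4 * n = 0 by rewrite -[RHS]E; field.
by move=> /eqP; rewrite mulf_eq0 => /orP[|//]; rewrite pnatr_eq0.
Qed.
End Hermitian.

(** * Linear maps between spaces of functions, quantum integers *)

Section Operators.
Variable R : realType.
Local Notation C := R[i].
Local Notation fsp := (fspace R).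

Lemma evec_sum (I : finType) (u : fsp I) : u = \sum_i u i *: evec R i.
Proof.
apply/ffunP => j; rewrite sum_ffunE (bigD1 j)//= big1.
  by rewrite !ffunE eqxx addr0 /GRing.scale /= mulr1.
by move=> i ij; rewrite !ffunE eq_sym (negPf ij) scaler0.
Qed.

Lemma lfun_evec (I J : finType) (f : 'Hom(fsp I, fsp J)) (u : fsp I) j :
  f u j = \sum_i u i * f (evec R i) j.
Proof.
rewrite [in LHS](evec_sum u) linear_sum sum_ffunE.
by apply: eq_bigr => i _; rewrite linearZ ffunE.
Qed.

Lemma eq_lfun_evec (I J : finType) (f g : 'Hom(fsp I, fsp J)) :
  (forall i, f (evec R i) = g (evec R i)) -> f = g.
Proof.
by move=> fg; apply/lfunP => u; apply/ffunP => j; rewrite !lfun_evec;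
  apply: eq_bigr => i _; rewrite fg.
Qed.

Definition outer (I J : finType) (u : fsp I) (v : fsp J) : fsp (I * J)%type :=
  [ffun p => u p.1 * v p.2].

Lemma evec_pair (I J : finType) (i : I) (j : J) :
  evec R (i, j) = outer (evec R i) (evec R j).
Proof.
apply/ffunP => -[a b]; rewrite !ffunE /= xpair_eqE.
by case: (a == i); case: (b == j); rewrite ?mulr0 ?mul0r ?mulr1.
Qed.

Lemma tensE (I J I' J' : finType) (f : 'Hom(fsp I, fsp I'))
    (g : 'Hom(fsp J, fsp J')) u p :
  tens f g u p = \sum_i \sum_j u (i, j) * (f (evec R i) p.1 * g (evec R j) p.2).
Proof. by rewrite lfunE ffunE. Qed.

Lemma tens_outer (I J I' J' : finType) (f : 'Hom(fsp I, fsp I'))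
    (g : 'Hom(fsp J, fsp J')) u v :
  tens f g (outer u v) = outer (f u) (g v).
Proof.
apply/ffunP => p; rewrite tensE ffunE (lfun_evec f) (lfun_evec g) mulr_suml.
apply: eq_bigr => i _; rewrite mulr_sumr; apply: eq_bigr => j _.
by rewrite !ffunE /=; ring.
Qed.

Lemma tens_comp (I J I' J' I'' J'' : finType)
    (f : 'Hom(fsp I', fsp I'')) (g : 'Hom(fsp J', fsp J''))
    (f' : 'Hom(fsp I, fsp I')) (g' : 'Hom(fsp J, fsp J')) :
  (tens f g \o tens f' g')%VF = tens (f \o f') (g \o g').
Proof.
apply: eq_lfun_evec => -[i j].
by rewrite comp_lfunE evec_pair !tens_outer !comp_lfunE.
Qed.

Lemma diag_opE (I : finType) (d : I -> C) (u : fsp I) i :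
  diag_op d u i = d i * u i.
Proof. by rewrite lfunE ffunE. Qed.

Lemma reindex_opE (I J : finType) (k : J -> I) (u : fsp I) j :
  reindex_op R k u j = u (k j).
Proof. by rewrite lfunE ffunE. Qed.

Lemma diag_op_comp (I : finType) (d d' : I -> C) :
  (diag_op d \o diag_op d')%VF = diag_op (fun i => d i * d' i).
Proof.
by apply/lfunP => u; apply/ffunP => i; rewrite comp_lfunE !diag_opE mulrA.
Qed.

Lemma diag_op_id (I : finType) (d : I -> C) : (forall i, d i = 1) ->
  diag_op d = \1%VF.
Proof.
move=> d1; apply/lfunP => u; apply/ffunP => i.
by rewrite diag_opE d1 mul1r id_lfunE.
Qed.

(** In every summand of the coproducts one factor is diagonal, so the other operator acts on slices
    with one index fixed. *)
Lemma tens_diagr (I J I' : finType) (f : 'Hom(fsp I, fsp I')) (d : J -> C)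
    (u : fsp (I * J)%type) a b :
  tens f (diag_op d) u (a, b) = d b * f [ffun i => u (i, b)] a.
Proof.
rewrite tensE /= lfun_evec mulr_sumr; apply: eq_bigr => i _.
rewrite (bigD1 b)//= big1 ?addr0; last first.
  by move=> j jb; rewrite diag_opE ffunE eq_sym (negPf jb) !mulr0.
by rewrite diag_opE !ffunE eqxx mulr1; ring.
Qed.

Lemma tens_diagl (I J J' : finType) (d : I -> C) (g : 'Hom(fsp J, fsp J'))
    (u : fsp (I * J)%type) a b :
  tens (diag_op d) g u (a, b) = d a * g [ffun j => u (a, j)] b.
Proof.
rewrite tensE /= lfun_evec mulr_sumr (bigD1 a)//= [X in _ + X]big1 ?addr0; last first.
  move=> i ia; rewrite big1// => j _.
  by rewrite diag_opE ffunE eq_sym (negPf ia) mulr0 mul0r mulr0.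
by apply: eq_bigr => j _; rewrite diag_opE !ffunE eqxx mulr1; ring.
Qed.

Lemma tens_1r (I J I' : finType) (f : 'Hom(fsp I, fsp I'))
    (u : fsp (I * J)%type) a b :
  tens f (\1%VF : 'End(fsp J)) u (a, b) = f [ffun i => u (i, b)] a.
Proof. by rewrite -(diag_op_id (fun=> erefl)) tens_diagr mul1r. Qed.

Lemma tens_1l (I J J' : finType) (g : 'Hom(fsp J, fsp J'))
    (u : fsp (I * J)%type) a b :
  tens (\1%VF : 'End(fsp I)) g u (a, b) = g [ffun j => u (a, j)] b.
Proof. by rewrite -(diag_op_id (fun=> erefl)) tens_diagl mul1r. Qed.

End Operators.

Section Qnumbers.
Variable R : realType.
Local Notation C := R[i].

Lemma qpowD (x y : R) : qpow (x + y) = qpow x * qpow y.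
Proof.
rewrite /qpow mulrDr mulrDl cosD sinD; apply/eqP; rewrite eq_complex /=.
by apply/andP; split; apply/eqP; ring.
Qed.

Lemma qpow0 : qpow (0 : R) = 1.
Proof. by rewrite /qpow mulr0 mul0r cos0 sin0. Qed.

Lemma qpowN (x : R) : qpow (- x) = (qpow x)^-1.
Proof.
have E : qpow x * qpow (- x) = 1 by rewrite -qpowD subrr qpow0.
have x0 : qpow x != 0.
  by apply: contra_eqN E => /eqP ->; rewrite mul0r eq_sym oner_eq0.
by apply: (mulfI x0); rewrite E divff.
Qed.

Lemma qpow_neq0 (x : R) : qpow x != 0.
Proof.
have E : qpow x * qpow (- x) = 1 by rewrite -qpowD subrr qpow0.
by apply: contra_eqN E => /eqP ->; rewrite mul0r eq_sym oner_eq0.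
Qed.

Lemma qpow1 : qpow (1 : R) = 'i%C.
Proof. by rewrite /qpow mulr1 cos_pihalf sin_pihalf. Qed.

Lemma qpow2 : qpow (2 : R) = -1.
Proof. by rewrite -[2]/(1 + 1) qpowD qpow1 -expr2 sqr_i. Qed.

Lemma qpow_nat (x : R) n : qpow (n%:R * x) = qpow x ^+ n.
Proof.
elim: n => [|n IH]; first by rewrite mul0r qpow0.
by rewrite -natr1 mulrDl mul1r qpowD IH exprSr.
Qed.

Lemma qnumN (x : R) : qnum (- x) = - qnum x.
Proof. by rewrite /qnum mulrN mulNr sinN. Qed.

Lemma qnumD2 (x : R) : qnum (x + 2) = - qnum x.
Proof.
by rewrite /qnum mulrDr mulrDl mulfK ?pnatr_eq0// sinDpi.
Qed.

Lemma qnum_qpow (x : R) : (qnum x)%:C%C = (qpow x - (qpow x)^-1) / (2 * 'i%C).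
Proof. by rewrite qnumE /qbrace !qpowN qpow1 invCi opprK mulr_natl mulr2n. Qed.

(** After subtracting a multiple of [pi] the angle lies in [[0, pi)], where the sine vanishes only
    at 0; then [x] would be an even integer. *)
Lemma qnum_neq0 (x : R) : irrational x -> qnum x != 0.
Proof.
move=> irr; apply/eqP; rewrite /qnum; set y := pi * x / 2 => s0.
have pi0 : 0 < pi :> R := pi_gt0 R.
pose l := Num.floor (y / pi); pose r := y - l%:~R * pi.
have r0 : 0 <= r by rewrite subr_ge0 -ler_pdivlMr// floor_le_tmp.
have r1 : r < pi.
  by rewrite /r ltrBlDl -{2}[pi]mul1r -mulrDl -ltr_pdivrMr// -intrD1 floorD1_gt.
have sr : sin r = 0.
  have pos (n : nat) (z : R) : sin z = 0 -> sin (z + n%:R * pi) = 0.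
    move=> z0; elim: n => [|n IH]; first by rewrite mul0r addr0.
    by rewrite -natr1 mulrDl mul1r addrA sinDpi IH oppr0.
  have neg (n : nat) (z : R) : sin z = 0 -> sin (z - n%:R * pi) = 0.
    move=> z0; rewrite -[_ - _]opprK opprB addrC sinN pos ?oppr0//.
    by rewrite sinN z0 oppr0.
  rewrite /r; case: (l) => n; first exact: neg.
  by rewrite NegzE mulrNz mulNr opprK; exact: pos.
have rr : r = 0.
  apply/eqP; rewrite eq_le r0 andbT leNgt; apply/negP => r00.
  by have := @sin_gt0_pi R r; rewrite r00 r1 sr ltxx => /(_ isT).
apply: irr; exists (l%:~R * 2) => //; rewrite rmorphM /= ratr_int ratr_nat.
have : y = l%:~R * pi by apply/eqP; rewrite -subr_eq0 -/r rr.
rewrite /y => E; apply: (mulfI (lt0r_neq0 pi0)).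
by rewrite mulrA [pi * _]mulrC -E divfK ?pnatr_eq0.
Qed.

Lemma irrational_affine (a : R) (j : nat) (z : int) : (0 < j)%N ->
  irrational a -> irrational (j%:R * a + z%:~R).
Proof.
move=> j0 irr [q _ qe]; apply: irr; exists ((q - z%:~R) / j%:R) => //.
rewrite fmorph_div rmorphB /= ratr_int ratr_nat qe addrK mulrC mulKf//.
by rewrite pnatr_eq0 -lt0n.
Qed.

End Qnumbers.

(** * Homomorphisms of weight modules *)

Local Opaque diag_op tens.

Section Modules.
Variable R : realType.
Local Notation C := R[i].
Local Notation fsp := (fspace R).

Lemma mem_intertwiners (I J : finType) (A : 'End(fsp J)) (B : 'End(fsp I)) f :
  (f \in intertwiners A B) = ((A \o f)%VF == (f \o B)%VF).
Proof. by rewrite memv_ker lfunE /= /comm_fun subr_eq0. Qed.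

Lemma intertwinersP (I J : finType) (A : 'End(fsp J)) (B : 'End(fsp I)) f :
  reflect ((A \o f)%VF = (f \o B)%VF) (f \in intertwiners A B).
Proof. by rewrite mem_intertwiners; exact: eqP. Qed.

Local Opaque intertwiners.

Lemma mem_homspace (M N : wmodule R) (f : 'Hom(fsp (wbasis M), fsp (wbasis N))) :
  (f \in homspace M N) =
  [&& f \in intertwiners (opE N) (opE M), f \in intertwiners (opF N) (opF M),
      f \in intertwiners (opK N) (opK M) & f \in intertwiners (opH N) (opH M)].
Proof. by rewrite /homspace memv_cap memv_cap memv_cap -!andbA. Qed.

Lemma mem_homspaceP (M N : wmodule R) (f : 'Hom(fsp (wbasis M), fsp (wbasis N))) :
  reflect [/\ (opE N \o f = f \o opE M)%VF, (opF N \o f = f \o opF M)%VF,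
              (opK N \o f = f \o opK M)%VF & (opH N \o f = f \o opH M)%VF]
    (f \in homspace M N).
Proof.
rewrite mem_homspace; apply: (iffP and4P).
  by move=> [/intertwinersP ? /intertwinersP ? /intertwinersP ? /intertwinersP ?].
by move=> [? ? ? ?]; split; apply/intertwinersP.
Qed.

Lemma homspace_comp (M N P : wmodule R) (f : 'Hom(fsp (wbasis N), fsp (wbasis P)))
    (g : 'Hom(fsp (wbasis M), fsp (wbasis N))) :
  f \in homspace N P -> g \in homspace M N -> (f \o g)%VF \in homspace M P.
Proof.
move=> /mem_homspaceP[fE fF fK fH] /mem_homspaceP[gE gF gK gH].
apply/mem_homspaceP; split; rewrite comp_lfunA.
- by rewrite fE -comp_lfunA gE comp_lfunA.
- by rewrite fF -comp_lfunA gF comp_lfunA.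
- by rewrite fK -comp_lfunA gK comp_lfunA.
- by rewrite fH -comp_lfunA gH comp_lfunA.
Qed.

Lemma opKVK (M : wmodule R) : (opKV M \o opK M)%VF = \1%VF.
Proof.
by rewrite diag_op_comp diag_op_id// => i; rewrite qpowN mulVf// qpow_neq0.
Qed.

Lemma opKKV (M : wmodule R) : (opK M \o opKV M)%VF = \1%VF.
Proof.
by rewrite diag_op_comp diag_op_id// => i; rewrite qpowN divff// qpow_neq0.
Qed.

(** The coproduct of [F] involves [K^-1], whereas [homspace] records commutation with [K]. *)
Lemma homspace_opKV (M N : wmodule R) f :
  f \in homspace M N -> (opKV N \o f = f \o opKV M)%VF.
Proof.
move=> /mem_homspaceP[_ _ fK _].
rewrite -[LHS]comp_lfun1r -(opKKV M) comp_lfunA -[((opKV N \o f) \o _)%VF]comp_lfunA.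
by rewrite -fK comp_lfunA opKVK comp_lfun1l.
Qed.

Lemma opK_tensor (M N : wmodule R) : opK (tensor M N) = tens (opK M) (opK N).
Proof.
apply/lfunP => u; apply/ffunP => -[a b].
by rewrite tens_diagl !diag_opE ffunE /= qpowD mulrA.
Qed.

Lemma opH_tensor (M N : wmodule R) :
  opH (tensor M N) = tens (opH M) \1%VF + tens \1%VF (opH N).
Proof.
apply/lfunP => u; apply/ffunP => -[a b].
by rewrite add_lfunE ffunE tens_1r tens_1l !diag_opE !ffunE /= rmorphD mulrDl.
Qed.

Lemma homspace_tens (M N P : wmodule R) f :
  f \in homspace M N ->
  tens f (\1%VF : 'End(fsp (wbasis P))) \in homspace (tensor M P) (tensor N P).
Proof.
move=> fh; have fKV := homspace_opKV fh; case/mem_homspaceP: fh => fE fF fK fH.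
apply/mem_homspaceP; rewrite !opK_tensor !opH_tensor /=.
split; rewrite ?comp_lfunDl ?comp_lfunDr !tens_comp !comp_lfun1l !comp_lfun1r.
- by rewrite fE.
- by rewrite fF fKV.
- by rewrite fK.
- by rewrite fH.
Qed.

Lemma V_opE (b : R) (u : fsp bool) x :
  opE (Vmod b) u x = if x then 0 else (qnum (1 - b))%:C%C * u true.
Proof. by rewrite lfunE ffunE. Qed.

Lemma V_opF (b : R) (u : fsp bool) x :
  opF (Vmod b) u x = if x then u false else 0.
Proof. by rewrite lfunE ffunE. Qed.

Lemma tensor_opE (M N : wmodule R) (u : fsp (wbasis M * wbasis N)%type) a b :
  opE (tensor M N) u (a, b) = opE N [ffun j => u (a, j)] b
    + qpow (wt b) * opE M [ffun i => u (i, b)] a.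
Proof. by rewrite add_lfunE ffunE tens_1l tens_diagr. Qed.

Lemma tensor_opF (M N : wmodule R) (u : fsp (wbasis M * wbasis N)%type) a b :
  opF (tensor M N) u (a, b) = qpow (- wt a) * opF N [ffun j => u (a, j)] b
    + opF M [ffun i => u (i, b)] a.
Proof. by rewrite add_lfunE ffunE tens_1r tens_diagl. Qed.

(** [E (x) F] has one non-zero entry, from [v_1 (x) v_0] to [v_0 (x) v_1], with coefficient
    [[1 - al]]; the flip moves its target to [(true, false)]. *)
Lemma braidingE (al : R) (v : fsp (bool * bool)%type) x y :
  braiding (Vmod al) (Vmod al) v (x, y) =
  qpow ((al + 1 - 2 * (y : nat)%:R) * (al + 1 - 2 * (x : nat)%:R) / 2) *
    (v (y, x) + if x && ~~ y then qbrace (1 - al) * v (true, false) else 0).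
Proof.
rewrite /braiding /flip /Rmatrix !comp_lfunE reindex_opE diag_opE /=.
congr (_ * _); rewrite add_lfunE !ffunE id_lfunE; congr (_ + _).
rewrite scale_lfunE ffunE tensE /= !big_bool /= !V_opE !V_opF !ffunE /=.
have -> : qbrace (1 - al) = qbrace 1 * (qnum (1 - al))%:C%C.
  rewrite qnumE mulrC divfK// /qbrace qpowN qpow1 invCi opprK -mulr2n -mulr_natl.
  by rewrite mulf_neq0 ?pnatr_eq0 ?neq0Ci.
case: x; case: y; rewrite /GRing.scale /= ?(mulr0, mul0r, addr0, add0r, mulr1)//.
by ring.
Qed.

Lemma braid_lastE (al : R) (W : finType) (u : fsp ((W * bool) * bool)%type) w x y :
  braid_last al W u ((w, x), y) =
  qpow ((al + 1 - 2 * (y : nat)%:R) * (al + 1 - 2 * (x : nat)%:R) / 2) *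
    (u ((w, y), x) +
     if x && ~~ y then qbrace (1 - al) * u ((w, true), false) else 0).
Proof.
rewrite /braid_last !comp_lfunE reindex_opE /= tens_1l braidingE !ffunE.
by rewrite !reindex_opE.
Qed.

Lemma braid_last_hom (al : R) (W : wmodule R) :
  braid_last al (wbasis W) \in
    homspace (tensor (tensor W (Vmod al)) (Vmod al))
             (tensor (tensor W (Vmod al)) (Vmod al)).
Proof.
set T := tensor _ _; set B := braid_last _ _.
(* All powers of [q] that occur are monomials in [q1] and [a = q^(al + 1)], up to a sign coming from
   [q^2 = -1]. Abstracting them leaves rational identities. *)
have [q1 [a [n [a0 q1E]]]] : exists Q a n : C, [/\ a != 0 &
  [/\ (qnum (1 - al))%:C%C = n, qbrace (1 - al) = a - a^-1,
   qpow (al + 1) = a & [/\ qpow (al - 1) = - a,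
   qpow ((al + 1) * (al + 1) / 2) = Q * a, qpow ((al + 1) * (al - 1) / 2) = Q,
   qpow ((al - 1) * (al + 1) / 2) = Q & qpow ((al - 1) * (al - 1) / 2) = - Q / a]]].
  exists (qpow ((al + 1) * (al - 1) / 2)), (qpow (al + 1)), (qnum (1 - al))%:C%C.
  have m1 : qpow (al - 1) = - qpow (al + 1).
    by rewrite (_ : al + 1 = al - 1 + 2); [rewrite [qpow (_ + 2)]qpowD qpow2 mulrN1 opprK|ring].
  have m2 : qpow (1 - al) = - (qpow (al + 1))^-1.
    by rewrite -opprB qpowN m1 invrN.
  split; first exact: qpow_neq0.
  split=> //; first by rewrite /qbrace opprB m1 m2 opprK addrC.
  split=> //.
  - by rewrite -qpowD; congr qpow; field.
  - by congr qpow; field.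
  - by rewrite mulNr -mulrN -m2 -qpowD; congr qpow; field.
case: q1E => nE bE aE [a'E q00 q01 q10 q11].
have wF : al + 1 - 2 * (false : nat)%:R = al + 1 by rewrite mulr0 subr0.
have wT : al + 1 - 2 * (true : nat)%:R = al - 1 by rewrite mulr1; ring.
have BE u w x y : B u ((w, x), y) = (if x then if y then - q1 / a else q1
    else if y then q1 else q1 * a) * (u ((w, y), x) +
       if x && ~~ y then (a - a^-1) * u ((w, true), false) else 0).
  rewrite braid_lastE bE; congr (_ * _).
  by case: x; case: y; rewrite ?(wF, wT).
clearbody B; apply/mem_homspaceP; split; apply/lfunP => u;
  apply/ffunP => -[[w x] y];
  rewrite !comp_lfunE BE.
- have TE (v : fsp (wbasis W * bool * bool)%type) x' y' : opE T v ((w, x'), y') =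
     (if y' then 0 else n * v ((w, x'), true)) +
     (if y' then - a else a) * ((if x' then 0 else n * v ((w, true), y')) +
     (if x' then - a else a) * opE W [ffun i => v ((i, x'), y')] w).
    rewrite tensor_opE V_opE tensor_opE V_opE nE !ffunE.
    have -> z : qpow (@wt R (Vmod al) z) = if z then - a else a.
      by case: z; rewrite /wt/= ?(wF, wT).
    have -> z : qpow (@wt R (Vmod al) z) = if z then - a else a.
      by case: z; rewrite /wt/= ?(wF, wT).
    by congr (_ + _ * (_ + _ * opE W _ _)); apply/ffunP => i; rewrite !ffunE.
  rewrite !TE !BE /=.
  have -> : [ffun i => B u ((i, x), y)] = (if x then if y then - q1 / a else q1
    else if y then q1 else q1 * a) *: ([ffun i => u ((i, y), x)] +
     (if x && ~~ y then a - a^-1 else 0) *: [ffun i => u ((i, true), false)]).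
    apply/ffunP => i; rewrite !ffunE BE; congr (_ * (_ + _)).
    by case: ifP; rewrite /GRing.scale //= mul0r.
  rewrite linearZ linearD linearZ !ffunE /GRing.scale /=.
  case: x; case: y => /=; field; exact: a0.
- have TF (v : fsp (wbasis W * bool * bool)%type) x' y' : opF T v ((w, x'), y') =
     (qpow (- wt w) / (if x' then - a else a)) * (if y' then v ((w, x'), false) else 0) +
     (qpow (- wt w) * (if x' then v ((w, false), y') else 0)
      + opF W [ffun i => v ((i, x'), y')] w).
    rewrite tensor_opF V_opF tensor_opF V_opF !ffunE.
    have -> : qpow (- @wt R (tensor W (Vmod al)) (w, x')) =
        qpow (- wt w) / (if x' then - a else a).
      by rewrite /= opprD qpowD; congr (_ * _); rewrite qpowN; case: x'; rewrite ?(wF, wT) ?aE ?a'E.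
    by congr (_ + (_ + opF W _ _)); apply/ffunP => i; rewrite !ffunE.
  rewrite !TF !BE /=.
  have -> : [ffun i => B u ((i, x), y)] = (if x then if y then - q1 / a else q1
    else if y then q1 else q1 * a) *: ([ffun i => u ((i, y), x)] +
     (if x && ~~ y then a - a^-1 else 0) *: [ffun i => u ((i, true), false)]).
    apply/ffunP => i; rewrite !ffunE BE; congr (_ * (_ + _)).
    by case: ifP; rewrite /GRing.scale //= mul0r.
  rewrite linearZ linearD linearZ !ffunE /GRing.scale /=.
  case: x; case: y => /=; field; exact: a0.
- rewrite !diag_opE !BE /=.
  have -> : wt w + (al + 1 - 2 * (y : nat)%:R) + (al + 1 - 2 * (x : nat)%:R) =
    wt w + (al + 1 - 2 * (x : nat)%:R) + (al + 1 - 2 * (y : nat)%:R) by ring.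
  by case: x; case: y => /=; ring.
- rewrite !diag_opE !BE /=.
  have -> : wt w + (al + 1 - 2 * (y : nat)%:R) + (al + 1 - 2 * (x : nat)%:R) =
    wt w + (al + 1 - 2 * (x : nat)%:R) + (al + 1 - 2 * (y : nat)%:R) by ring.
  by case: x; case: y => /=; ring.
Qed.

Lemma sigma_hom (al : R) n i : sigma al n i \in homspace (tpow al n) (tpow al n).
Proof.
have id1 (M : wmodule R) : \1%VF \in homspace M M.
  by apply/mem_homspaceP; split; rewrite comp_lfun1l comp_lfun1r.
elim: n => [|m IH] /=; first by apply: (id1 (unit_module R)).
case: ifP => _.
  exact: (@homspace_tens (tpow al m) (tpow al m) (Vmod al)).
by case: m {IH} => [|l]; [exact: (id1 (tpow al 1))|exact: (braid_last_hom al (tpow al l))].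
Qed.

End Modules.

(** * The weight space with one exceptional factor *)

Local Opaque intertwiners.

Section TensorPower.
Variables (R : realType) (al : R).
Local Notation C := R[i].
Local Notation fsp := (fspace R).

(** Basis tensors are named by infinite sequences, so that one [S] serves for every tensor power. *)
Fixpoint tidx (S : nat -> bool) (n : nat) : wbasis (tpow al n) :=
  match n return wbasis (tpow al n) with
  | 0 => tt
  | m.+1 => (tidx S m, S m)
  end.

Lemma tidx_ext S S' n : (forall j, (j < n)%N -> S j = S' j) -> tidx S n = tidx S' n.
Proof.
elim: n => //= n IH SS; rewrite SS// IH// => j jn.
by apply: SS; exact: ltnW.
Qed.

Lemma tidx_surj n (w : wbasis (tpow al n)) : exists S, w = tidx S n.
Proof.
elim: n w => [[]|n IH [w b]]; first by exists (fun=> false).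
have [S ->] := IH w; exists (fun j => if j == n then b else S j) => /=.
rewrite eqxx; congr (_, _); apply: tidx_ext => j jn.
by rewrite ltn_eqF.
Qed.

Lemma wt_tidx S n : wt (tidx S n) = \sum_(j < n) (al + 1 - 2 * (S j : nat)%:R).
Proof. by elim: n => [|n IH] /=; rewrite ?big_ord0// big_ord_recr /= IH. Qed.

Definition swap (p : nat) (S : nat -> bool) (j : nat) :=
  if j == p then S p.+1 else if j == p.+1 then S p else S j.

Lemma swapK p S j : swap p (swap p S) j = S j.
Proof.
rewrite /swap; have [->|jp] := eqVneq j p; first by rewrite gtn_eqF// eqxx.
by have [->|//] := eqVneq j p.+1; rewrite eqxx.
Qed.

Lemma sigmaE n p (u : fsp (wbasis (tpow al n))) S : (p.+1 < n)%N ->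
  sigma al n p.+1 u (tidx S n) =
  qpow ((al + 1 - 2 * (S p.+1 : nat)%:R) * (al + 1 - 2 * (S p : nat)%:R) / 2) *
  (u (tidx (swap p S) n) +
   if S p && ~~ S p.+1 then qbrace (1 - al) * u (tidx S n) else 0).
Proof.
elim: n u => // m IH u; rewrite ltnS leq_eqVlt => /orP[/eqP pm|pm].
  subst m => /=; rewrite ltnn braid_lastE.
  have -> : tidx (swap p S) p = tidx S p.
    by apply: tidx_ext => j jp; rewrite /swap !ltn_eqF// ltnW.
  rewrite /swap eqxx eqxx gtn_eqF//.
  by case Sp : (S p); case Sp1 : (S p.+1).
rewrite /= pm tens_1r IH// !ffunE.
by have -> : swap p S m = S m by rewrite /swap !gtn_eqF// ltnW.
Qed.

(** Injectivity makes the [^-1] in [braid_act] a true inverse. *)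
Lemma sigma_lker0 n p : (p.+1 < n)%N -> lker (sigma al n p.+1) == 0%VS.
Proof.
move=> pn; apply/lker0P => u v uv; apply/eqP; rewrite -subr_eq0; apply/eqP.
have {uv} : sigma al n p.+1 (u - v) = 0 by rewrite linearB /= uv subrr.
move: (u - v) => {u v}u u0.
(* A coordinate of a kernel vector is a multiple of the swapped one in only one of the two orders
   and is 0 in the other, so both vanish. *)
have H S : u (tidx S n) =
    - (if S p.+1 && ~~ S p then qbrace (1 - al) * u (tidx (swap p S) n) else 0).
  have := sigmaE u (swap p S) pn; rewrite u0 ffunE => /esym/eqP.
  rewrite mulf_eq0 (negPf (qpow_neq0 _)) /= addr_eq0.
  rewrite (_ : tidx (swap p (swap p S)) n = tidx S n); last first.
    by apply: tidx_ext => j _; exact: swapK.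
  have -> : swap p S p = S p.+1 by rewrite /swap eqxx.
  have -> : swap p S p.+1 = S p by rewrite /swap eqxx gtn_eqF.
  by move/eqP.
apply/ffunP => w; have [S ->] := tidx_surj w; rewrite ffunE H.
case: ifP => [/andP[S1 S0]|_]; last by rewrite oppr0.
rewrite (H (swap p S)).
have -> : swap p S p = S p.+1 by rewrite /swap eqxx.
have -> : swap p S p.+1 = S p by rewrite /swap eqxx gtn_eqF.
by rewrite (negPf S0) oppr0 mulr0 oppr0.
Qed.

Lemma hom_weight (M N : wmodule R) f i w :
  f \in homspace M N -> f (evec R i) w != 0 -> wt w = wt i.
Proof.
move=> /mem_homspaceP[_ _ _ /lfunP/(_ (evec R i))/ffunP/(_ w)].
rewrite !comp_lfunE diag_opE.
have -> : opH M (evec R i) = (wt i)%:C%C *: evec R i.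
  apply/ffunP => j; rewrite diag_opE !ffunE /GRing.scale /=.
  by case: eqP => [->|]; rewrite ?mulr0.
rewrite linearZ ffunE /GRing.scale /= => /eqP; rewrite -subr_eq0 -mulrBl mulf_eq0.
by case/orP => [|->//]; rewrite -rmorphB /= => /eqP[/eqP]; rewrite subr_eq0 => /eqP.
Qed.

Section Weight.
Variables (c : bool) (n : nat) (k : int).
Hypothesis irr : irrational al.
Hypothesis n0 : (0 < n)%N.
Hypothesis kc : k = if c then n%:Z - 3 else - (n%:Z - 3).

(** The increment of a path in its majority direction: here all steps but one go in direction
    [c]. *)
Definition path_step : R := al + (if c then 1 else -1).
Local Notation A := path_step.
Local Notation a := (qpow A).
Local Notation Q := (qpow ((al + 1) * (al - 1) / 2)).

(* For k = n - 3 (c = true) a homomorphism is determined by the image of the highest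
   weight vector v_0, supported on the tensors with exactly one factor v_1; for
   k = 3 - n (c = false), by the image of the lowest weight vector v_1, supported on
   the tensors with exactly one factor v_0.  Since q^(alpha + 1)
   = - q^(alpha - 1), the two cases obey the same formulas. *)
Definition single_at (p j : nat) := if j == p then c else ~~ c.

Definition wcoef m (f : 'Hom(fsp bool, fsp (wbasis (tpow al m)))) p : C :=
  f (evec R (~~ c)) (tidx (single_at p) m).

Lemma wcoefD m (f g : 'Hom(fsp bool, fsp (wbasis (tpow al m)))) p :
  wcoef (f + g) p = wcoef f p + wcoef g p.
Proof. by rewrite /wcoef add_lfunE ffunE. Qed.

Lemma wcoefZ m x (f : 'Hom(fsp bool, fsp (wbasis (tpow al m)))) p :
  wcoef (x *: f) p = x * wcoef f p.
Proof. by rewrite /wcoef scale_lfunE ffunE. Qed.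

Lemma qpow_al1 : qpow (al + 1) = if c then a else - a.
Proof.
rewrite /path_step; case: c => //.
by rewrite (_ : al + 1 = al - 1 + 2) ?[qpow (_ + 2)]qpowD ?qpow2 ?mulrN1//; ring.
Qed.

Lemma qpow_alN1 : qpow (al - 1) = if c then - a else a.
Proof.
rewrite /path_step; case: c => //.
by rewrite (_ : al + 1 = al - 1 + 2) ?[qpow (_ + 2)]qpowD ?qpow2 ?mulrN1 ?opprK//; ring.
Qed.

Lemma qbrace_1al : qbrace (1 - al) = if c then a - a^-1 else a^-1 - a.
Proof.
have -> : 1 - al = - (al - 1) by rewrite opprB.
rewrite /qbrace opprK qpowN qpow_alN1.
by case: c; rewrite ?invrN ?opprK; ring.
Qed.

Lemma irr_nat (j : nat) (z : int) : (0 < j)%N -> qnum (j%:R * al + z%:~R) != 0.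
Proof. by move=> j0; apply: qnum_neq0; exact: irrational_affine. Qed.

Lemma qnum_1al : qnum (1 - al) != 0.
Proof.
have := @irr_nat 1 (-1) isT; rewrite mul1r => h.
by rewrite -opprB qnumN oppr_eq0.
Qed.

Lemma qnum_A j : (0 < j)%N -> qnum (j%:R * A) != 0.
Proof.
move=> j0; rewrite /path_step mulrDr.
have := @irr_nat j (if c then j%:Z else - j%:Z) j0.
by case: c; rewrite ?mulr1 ?mulrN1 ?mulrNz.
Qed.

(** In the iterated coproduct, [E] at position [p] is followed by [K] on the [m - 1 - p] later
    factors, whence the powers of [q^(al + 1)]. *)
Lemma opE_const m (u : fsp (wbasis (tpow al m))) :
  opE (tpow al m) u (tidx (fun=> false) m) =
  qpow (al + 1) ^+ m / qpow (al + 1) * (qnum (1 - al))%:C%C *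
  \sum_(p < m) qpow (al + 1) ^- p * u (tidx (fun j => j == p) m).
Proof.
have q0 := qpow_neq0 (al + 1); set q := qpow (al + 1) in q0 *.
elim: m u => [|m IH] u; first by rewrite lfunE /= big_ord0 mulr0 ffunE.
rewrite [tidx _ _]/= [opE _]/= tensor_opE V_opE IH ffunE.
have -> : qpow (@wt R (Vmod al) false) = q by rewrite /= mulr0 subr0.
rewrite big_ord_recr /= eqxx.
have -> : tidx (fun=> false) m = tidx (fun j => j == m) m.
  by apply: tidx_ext => j jm; rewrite ltn_eqF.
rewrite mulrDr addrC; congr (_ + _); last by rewrite exprS; field; rewrite q0 expf_neq0.
rewrite !mulrA; congr (_ * _ * _ * _); first by rewrite exprS.
apply: eq_bigr => p _; congr (_ * _); rewrite ffunE.
by rewrite [in RHS]gtn_eqF.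
Qed.

Lemma opF_const m (u : fsp (wbasis (tpow al m))) :
  opF (tpow al m) u (tidx (fun=> true) m) =
  \sum_(p < m) qpow (al - 1) ^- p * u (tidx (fun j => j != p) m).
Proof.
elim: m u => [|m IH] u; first by rewrite lfunE /= big_ord0 ffunE.
rewrite [tidx _ _]/= [opF _]/= tensor_opF V_opF IH ffunE.
rewrite big_ord_recr /= eqxx [RHS]addrC; congr (_ + _); last first.
  apply: eq_bigr => p _; congr (_ * _); rewrite ffunE.
  by rewrite gtn_eqF.
have -> : tidx (fun=> true) m = tidx (fun j => j != m) m.
  by apply: tidx_ext => j jm; rewrite ltn_eqF.
rewrite qpowN -qpow_nat; congr ((qpow _)^-1 * _).
rewrite wt_tidx (eq_bigr (fun=> al - 1)) ?sumr_const ?card_ord ?mulr_natl// => j _.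
by rewrite ltn_eqF//= mulr1; ring.
Qed.

Local Notation H := (homspace (Vmod (out_color n k al)) (tpow al n)).

(** Comparing weights counts the factors [v_1]: one of them for [c], all but one otherwise. *)
Lemma hom_support f S : f \in H -> f (evec R (~~ c)) (tidx S n) != 0 ->
  exists2 p, (p < n)%N & tidx S n = tidx (single_at p) n.
Proof.
move=> fH fS; have := hom_weight fH fS.
rewrite wt_tidx sumrB sumr_const card_ord -mulr_sumr /= /out_color.
have -> : \sum_(i < n) (S i : nat)%:R = (\sum_(i < n) S i)%N%:R :> R by rewrite natr_sum.
move=> E.
have {}E : (\sum_(i < n) (S i == c) = 1)%N.
  have E2 : (\sum_(i < n) S i)%N%:Z = if c then 1 else n%:Z - 1.
    apply: (@intr_inj R); move: E; rewrite kc -[(_ : nat)%:Z%:~R]/(_%:R).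
    case: (c) => /=; rewrite ?rmorphN ?rmorphB ?rmorphD /= -mulr_natl; move=> E; lra.
  case: (c) E2 => E2.
    apply/eqP; rewrite -eqz_nat -[1%N%:Z]E2; apply/eqP; congr Posz.
    by apply: eq_bigr => i _; case: (S i).
  have : (\sum_(i < n) (S i == false) + \sum_(i < n) S i = n)%N.
    rewrite -big_split /= (eq_bigr (fun=> 1%N)) ?sum1_card ?card_ord// => i _.
    by case: (S i).
  lia.
have [p Sp|Sn] := pickP (fun p : 'I_n => S p == c); last first.
  by move: E; rewrite big1// => i _; rewrite Sn.
exists p => //; apply: tidx_ext => j jn; rewrite /single_at.
case: eqP => [->|/eqP jp]; first exact/eqP.
move: E; rewrite (bigD1 p)//= Sp (bigD1 (Ordinal jn))//=.
by case: (S j) => //=; case: (c).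
Qed.

(** The equation left by [E v_0 = 0] (for [c]) or [F v_1 = 0], read at the only tensor of the
    neighbouring weight. *)
Lemma hom_constraint f : f \in H -> \sum_(p < n) a ^- p * wcoef f p = 0.
Proof.
move=> /mem_homspaceP[fE fF _ _]; rewrite /wcoef /single_at.
have /lfunP/(_ (evec R (~~ c))) := fE; have /lfunP/(_ (evec R (~~ c))) := fF.
rewrite !comp_lfunE.
have eb : c -> opE (Vmod (out_color n k al)) (evec R (~~ c)) = 0.
  move=> cT; apply/ffunP => x; rewrite V_opE !ffunE cT; case: x => //.
  by rewrite mulr0.
have fb : ~~ c -> opF (Vmod (out_color n k al)) (evec R (~~ c)) = 0.
  move=> cF; apply/ffunP => x; rewrite V_opF !ffunE cF; case: x => //.
have q1 := qpow_al1; have q2 := qpow_alN1; move: eb fb q1 q2; case: (c) => /=.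
  move=> /(_ isT) -> _ q1 _ _; rewrite linear0 => /ffunP/(_ (tidx (fun=> false) n)).
  rewrite opE_const ffunE q1 => /eqP; rewrite mulf_eq0 => /orP[|/eqP E].
    rewrite !mulf_eq0 invr_eq0 expf_eq0 (negPf (qpow_neq0 _)) andbF /=.
    by move/eqP => -[/eqP]; rewrite (negPf qnum_1al).
  rewrite -[RHS]E; apply: eq_bigr => p _.
  rewrite (@tidx_ext (fun j => if j == p then true else ~~ true) (fun j => j == p))//.
  by move=> j _; case: eqP.
move=> _ /(_ isT) -> _ q2 + _; rewrite linear0 => /ffunP/(_ (tidx (fun=> true) n)).
rewrite opF_const ffunE q2 => E.
rewrite -[RHS]E; apply: eq_bigr => p _.
rewrite (@tidx_ext (fun j => if j == p then false else ~~ false) (fun j => j != p))//.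
Qed.

(** The other basis vector is [F v_0], or for [c = false] a multiple of [E v_1], where
    [[1 - out_color]] is non-zero by irrationality. *)
Lemma hom_wcoef_inj f : f \in H -> (forall p, (p < n)%N -> wcoef f p = 0) -> f = 0.
Proof.
move=> fH f0.
have fc : f (evec R (~~ c)) = 0.
  apply/ffunP => w; have [S ->] := tidx_surj w; rewrite [RHS]ffunE.
  have [//|/(hom_support fH)[p pn E]] := eqVneq (f (evec R (~~ c)) (tidx S n)) 0.
  by rewrite E; exact: f0.
have /mem_homspaceP[fE fF _ _] := fH.
have fc' : f (evec R c) = 0.
  have /lfunP/(_ (evec R (~~ c))) := fE; have /lfunP/(_ (evec R (~~ c))) := fF.
  rewrite !comp_lfunE fc !linear0; case: (c) => /=.
    move=> E _; rewrite [RHS]E; congr (f _); apply/ffunP => x.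
    by rewrite V_opF !ffunE; case: x.
  move=> _ E.
  have b0 : qnum (1 - out_color n k al) != 0.
    have := @irr_nat n (k - 1) n0; rewrite /out_color.
    have -> : 1 - (n%:R * al + k%:~R) = - (n%:R * al + (k - 1)%:~R).
      by rewrite rmorphB /=; ring.
    by rewrite qnumN oppr_eq0.
  have : f ((qnum (1 - out_color n k al))%:C%C *: evec R false) = 0.
    rewrite [RHS]E; congr (f _); apply/ffunP => x.
    by rewrite V_opE !ffunE; case: x; rewrite /GRing.scale /= ?mulr0 ?mulr1.
  rewrite linearZ /= => /eqP; rewrite scaler_eq0 => /orP[/eqP[/eqP]|/eqP//].
  by rewrite (negPf b0).
apply: eq_lfun_evec => i; rewrite zero_lfunE.
by move: fc fc'; case: (c); case: i.
Qed.

(** Equals [q^((al + 1)^2 / 2)] for [c] and [q^((al - 1)^2 / 2)] otherwise: the eigenvalue on two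
    consecutive steps in direction [c]. *)
Definition twist : C := if c then Q * a else Q / a.

(* The reduced Burau shape: sigma_(p+1) - twist has rank one. *)
Lemma wcoef_sigma (f : 'Hom(fsp bool, fsp (wbasis (tpow al n)))) p j : (p.+1 < n)%N ->
  wcoef (sigma al n p.+1 \o f)%VF j = twist * wcoef f j +
    Q * (wcoef f p.+1 - a^-1 * wcoef f p) * ((j == p)%:R - a * (j == p.+1)%:R).
Proof.
move=> pn; rewrite /wcoef comp_lfunE sigmaE//.
have a0 := qpow_neq0 A.
have wE (b : bool) : al + 1 - 2 * (b : nat)%:R = if b then al - 1 else al + 1.
  by case: b; rewrite /= ?mulr1 ?mulr0; ring.
have q11 : qpow ((al + 1) * (al + 1) / 2) = Q * qpow (al + 1).
  by rewrite -qpowD; congr qpow; field.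
have q00 : qpow ((al - 1) * (al - 1) / 2) = - (Q / qpow (al + 1)).
  by rewrite -qpowN -mulrN -[- qpow _]mulrN1 -qpow2 -!qpowD; congr qpow; field.
have q01 : qpow ((al - 1) * (al + 1) / 2) = Q.
  by rewrite [(al - 1) * _]mulrC.
rewrite !wE qbrace_1al.
set g := f _.
have pp1 : (p.+1 == p) = false by rewrite gtn_eqF.
have p1p : (p == p.+1) = false by rewrite ltn_eqF.
have S1 : j = p -> tidx (swap p (single_at j)) n = tidx (single_at p.+1) n.
  move=> ->; apply: tidx_ext => i _; rewrite /swap /single_at.
  have [->|ip] := eqVneq i p; first by rewrite pp1 p1p.
  by have [_|ip1] := eqVneq i p.+1; rewrite ?eqxx// ?(negPf ip).
have S2 : j = p.+1 -> tidx (swap p (single_at j)) n = tidx (single_at p) n.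
  move=> ->; apply: tidx_ext => i _; rewrite /swap /single_at.
  have [_|ip] := eqVneq i p; first by rewrite ?eqxx.
  by have [_|ip1] := eqVneq i p.+1; rewrite ?p1p// ?(negPf ip1).
have S3 : j <> p -> j <> p.+1 -> tidx (swap p (single_at j)) n = tidx (single_at j) n.
  move=> /eqP jp /eqP jp1; apply: tidx_ext => i _; rewrite /swap /single_at.
  have jp' : (p == j) = false by rewrite eq_sym; exact: negPf.
  have jp1' : (p.+1 == j) = false by rewrite eq_sym; exact: negPf.
  have [->|ip] := eqVneq i p; first by rewrite jp' jp1'.
  by have [->|//] := eqVneq i p.+1; rewrite jp' jp1'.
have [jp|jp] := eqVneq j p.
  rewrite S1// jp /single_at eqxx gtn_eqF// ltn_eqF// mulr0 subr0 mulr1 /twist.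
  move: a0 q11 q00 q01 qpow_al1; case: (c) => /= a0 q11 q00 q01 qa; rewrite ?q01; field.
    exact: a0.
  exact: a0.
have [jp1|jp1] := eqVneq j p.+1.
  rewrite S2// jp1 /single_at eqxx ltn_eqF// mulr1 sub0r /twist.
  move: a0 q11 q00 q01 qpow_al1; case: (c) => /= a0 q11 q00 q01 qa; rewrite ?q01; field.
    exact: a0.
  exact: a0.
rewrite S3; [|exact/eqP|exact/eqP].
have -> : single_at j p = ~~ c by rewrite /single_at eq_sym (negPf jp).
have -> : single_at j p.+1 = ~~ c by rewrite /single_at eq_sym (negPf jp1).
rewrite mulr0 subr0 mulr0 addr0 andbN addr0 /twist.
move: q11 q00 qpow_al1; case: (c) => /= q11 q00 qa; first by rewrite q11 qa.
by rewrite q00 qa invrN mulrN opprK.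
Qed.

End Weight.
End TensorPower.

(** * Fusion trees *)

Section Trees.
Variables (R : realType) (al : R).
Local Notation C := R[i].
Local Notation fsp := (fspace R).
Hypothesis irr : irrational al.

Lemma vertexR x (u : fsp bool) z y : vertex al true x u (z, y) =
  (qnum (x + al))%:C%C * (if z then if y then 0 else u true
    else if y then (qpow (x + 1))^-1 * u true else u false).
Proof.
rewrite lfunE /= /vertex_fun ffunE !ffunE tensor_opF !V_opF !ffunE /GRing.scale /=.
by case: z; case: y; rewrite /= ?(mulr0, subr0, mul0r, addr0, add0r, mulr1) ?qpowN //; ring.
Qed.

Lemma qpow_xal (x : R) : qpow (x + al) = - (qpow (x + 1) * qpow (al + 1)).
Proof.
have -> : x + al = x + 1 + (al + 1) - 2 by ring.
by rewrite [LHS]qpowD qpowN qpow2 [qpow (x + 1 + _)]qpowD invrN1 mulrN1.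
Qed.

(** The left side is the coefficient of [v_1 (x) v_1] in [F] applied to the highest weight vector of
    direction L. *)
Lemma vertexL_key (x : R) : qnum (x + 1) != 0 ->
  qpow (- (x + 1 - 2)) * (qnum (al + 1) / qnum (x + 1))%:C%C - qpow (al + 1) =
  (qnum (x + al) / qnum (x + 1))%:C%C.
Proof.
move=> x0.
have x0' : (qnum (x + 1))%:C%C != 0 :> C.
  by apply: contraNneq x0 => -[/eqP].
rewrite !rmorphM !fmorphV /=.
have -> : qpow (- (x + 1 - 2)) = - (qpow (x + 1))^-1.
  have -> : - (x + 1 - 2) = - (x + 1) + 2 by ring.
  by rewrite [LHS]qpowD qpow2 qpowN mulrN1.
move: x0'; rewrite !qnum_qpow qpow_xal.
have := qpow_neq0 (x + 1); have := qpow_neq0 (al + 1).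
move: (qpow (x + 1)) (qpow (al + 1)) => X Y Y0 X0 x0'.
have D0 : 2 * 'i%C != 0 :> C by rewrite mulf_neq0 ?pnatr_eq0 ?neq0Ci.
move: x0' D0; move: (2 * 'i%C) => D.
rewrite mulf_eq0 negb_or => /andP[XX _] D0.
have XX' : X ^+ 2 - 1 != 0.
  apply: contraNneq XX => E; have -> : X - X^-1 = (X ^+ 2 - 1) / X by field.
  by rewrite E mul0r.
by field; rewrite X0 Y0 D0 -expr2 XX'.
Qed.

Lemma vertexL x (u : fsp bool) z y : qnum (x + 1) != 0 ->
  vertex al false x u (z, y) =
  if z then if y then (qnum (x + al) / qnum (x + 1))%:C%C * u true
            else (qnum (al + 1) / qnum (x + 1))%:C%C * u false
  else if y then - qpow (al + 1) * u false else 0.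
Proof.
move=> x0.
rewrite lfunE /= /vertex_fun ffunE !ffunE tensor_opF !V_opF !ffunE /GRing.scale /=.
case: z; case: y; rewrite /= ?(mulr0, subr0, mul0r, addr0, add0r, mulr1, oppr0) //; last 2 first.
- by rewrite mulrC.
- by rewrite mulrC mulNr.
- by rewrite -(vertexL_key x0); ring.
Qed.

Lemma vertex_hom d x : qnum (x + 1) != 0 ->
  vertex al d x \in homspace (Vmod (x + (al + (if d then 1 else -1))))
                             (tensor (Vmod x) (Vmod al)).
Proof.
move=> x0; set b := x + _.
have flip2 (y : R) : qnum (1 - y) = qnum (y + 1).
  by have -> : 1 - y = - (y + 1) + 2; [ring|rewrite qnumD2 qnumN opprK].
have flip2' (y : R) : qnum (2 - y) = qnum y.
  by rewrite addrC qnumD2 qnumN opprK.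
have nb : qnum (1 - b) = if d then - qnum (x + al) else qnum (x + al).
  rewrite /b; case: (d).
    by have -> : 1 - (x + (al + 1)) = - (x + al); [ring|rewrite qnumN].
  by have -> : 1 - (x + (al - 1)) = 2 - (x + al); [ring|exact: flip2'].
have x0' : (qnum (x + 1))%:C%C != 0 :> C.
  by apply: contraNneq x0 => -[/eqP].
have wT z y : @wt R (tensor (Vmod x) (Vmod al)) (z, y) =
    if z then if y then x + al - 2 else x + al else if y then x + al else x + al + 2.
  by case: z; case: y; rewrite /= ?mulr1 ?mulr0; ring.
have wV t : @wt R (Vmod b) t = if d then if t then x + al else x + al + 2
    else if t then x + al - 2 else x + al.
  by rewrite /b; case: (d); case: t; rewrite /= ?mulr1 ?mulr0; ring.
have e1 : qpow (- (x + 1 - 2)) = - (qpow (x + 1))^-1.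
  have -> : - (x + 1 - 2) = - (x + 1) + 2 by ring.
  by rewrite [LHS]qpowD qpow2 qpowN mulrN1.
clearbody b; case: d nb wV => nb wV; apply/mem_homspaceP;
  split; apply/lfunP => u; apply/ffunP => -[z y].
- rewrite !comp_lfunE tensor_opE !V_opE !ffunE !flip2 /= !vertexR !V_opE nb.
  case: z; case: y; rewrite /= ?(mulr0, subr0, mul0r, addr0, add0r, mulr1)//.
  rewrite rmorphN /= !qnum_qpow qpow_xal.
  have := qpow_neq0 (x + 1); have := qpow_neq0 (al + 1).
  move: (qpow (x + 1)) (qpow (al + 1)) => X Y Y0 X0.
  have D0 : 2 * 'i%C != 0 :> C by rewrite mulf_neq0 ?pnatr_eq0 ?neq0Ci.
  move: D0; move: (2 * 'i%C) => D D0.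
  by field; rewrite X0 Y0 D0.
- rewrite !comp_lfunE tensor_opF !(@V_opF R 0) !ffunE /= !vertexR !(@V_opF R 0).
  case: z; case: y; rewrite /= ?(mulr0, subr0, mul0r, addr0, add0r, mulr1)//.
    by rewrite e1; ring.
  by rewrite qpowN; ring.
- by rewrite !comp_lfunE !diag_opE wT !vertexR !diag_opE !wV; case: z; case: y; ring.
- by rewrite !comp_lfunE !diag_opE wT !vertexR !diag_opE !wV; case: z; case: y; ring.
- rewrite !comp_lfunE tensor_opE !V_opE !ffunE !flip2 /= !vertexL// !V_opE nb.
  case: z; case: y; rewrite /= ?(mulr0, subr0, mul0r, addr0, add0r, mulr1, oppr0)//.
  + by rewrite rmorphM fmorphV /=; field.
  + rewrite rmorphM fmorphV /= [qpow (al + 1 - 2)]qpowD qpowN qpow2 invrN1 mulrN1.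
    by field.
  + by rewrite rmorphM fmorphV /=; field.
- rewrite !comp_lfunE tensor_opF !(@V_opF R 0) !ffunE /= !vertexL// !(@V_opF R 0).
  case: z; case: y; rewrite /= ?(mulr0, subr0, mul0r, addr0, add0r, mulr1, oppr0)//.
  by rewrite -(vertexL_key x0); ring.
- by rewrite !comp_lfunE !diag_opE wT !vertexL// !diag_opE !wV; case: z; case: y; ring.
- by rewrite !comp_lfunE !diag_opE wT !vertexL// !diag_opE !wV; case: z; case: y; ring.
Qed.

(** The multiple of [al] is positive, so irrationality applies to the quantum integers along a
    path. *)
Lemma xpath_int (s : nat -> bool) j :
  exists z : int, xpath al s j = j.+1%:R * al + z%:~R.
Proof.
elim: j => [|j [z E]]; first by exists 0; rewrite /xpath big_ord0 mul1r addr0.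
exists (z + (if s j then 1 else -1)).
rewrite /xpath big_ord_recr /= addrA -/(xpath al s j) E.
by rewrite -[j.+2%:R]natr1 rmorphD /=; case: (s j); rewrite ?rmorphN /=; ring.
Qed.

Lemma xpathS (s : nat -> bool) j :
  xpath al s j.+1 = xpath al s j + (al + (if s j then 1 else -1)).
Proof. by rewrite /xpath big_ord_recr /= addrA. Qed.

Lemma xpath_nz (s : nat -> bool) j : qnum (xpath al s j + 1) != 0.
Proof.
have [z ->] := xpath_int s j.
have := irr_nat irr (j := j.+1) (z + 1) isT.
by rewrite rmorphD /= addrA.
Qed.

Lemma xpath_nz' (s : nat -> bool) j : qnum (xpath al s j + al) != 0.
Proof.
have [z ->] := xpath_int s j.
have := irr_nat irr (j := j.+2) z isT.
by rewrite -[j.+2%:R]natr1 mulrDl mul1r addrAC.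
Qed.

Lemma tree_hom s m :
  tree al s m.+1 \in homspace (Vmod (xpath al s m)) (tpow al m.+1).
Proof.
elim: m => [|m IH].
  have -> : xpath al s 0 = al by rewrite /xpath big_ord0 addr0.
  apply/mem_homspaceP; split; apply/lfunP => u; apply/ffunP => -[[] y];
    rewrite !comp_lfunE.
  - rewrite [opE _]/= tensor_opE [opE (unit_module R)]/= zero_lfunE ffunE mulr0 addr0 reindex_opE.
    by rewrite !V_opE !ffunE reindex_opE.
  - rewrite [opF _]/= tensor_opF [opF (unit_module R)]/= zero_lfunE ffunE.
    rewrite addr0 oppr0 qpow0 mul1r reindex_opE.
    by rewrite !V_opF !ffunE reindex_opE.
  - by rewrite !reindex_opE !diag_opE reindex_opE /= add0r.
  - by rewrite !reindex_opE !diag_opE reindex_opE /= add0r.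
apply: (homspace_comp (N := tensor (Vmod (xpath al s m)) (Vmod al))).
  exact: (@homspace_tens _ _ _ (Vmod al) _ IH).
by rewrite xpathS; apply: vertex_hom; exact: xpath_nz.
Qed.

Lemma tree_rec s m u S : tree al s m.+2 u (tidx al S m.+2) =
  vertex al (s m) (xpath al s m) u (true, S m.+1) *
     tree al s m.+1 (evec R true) (tidx al S m.+1) +
  vertex al (s m) (xpath al s m) u (false, S m.+1) *
     tree al s m.+1 (evec R false) (tidx al S m.+1).
Proof.
rewrite [tidx _ _ m.+2]/= [tree _ _ m.+2]/= comp_lfunE tens_1r lfun_evec.
by rewrite big_bool !ffunE.
Qed.

Lemma tree1 s u S : tree al s 1 u (tidx al S 1) = u (S 0).
Proof. by rewrite reindex_opE. Qed.

Lemma tree_ext s s' n : (forall j, (j < n.-1)%N -> s j = s' j) ->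
  tree al s n = tree al s' n.
Proof.
elim: n => [|[|m] IH] ss; [by []|by []|rewrite [LHS]/= [RHS]/=].
have -> : xpath al s m = xpath al s' m.
  by congr (_ + _); apply: eq_bigr => l _; rewrite ss// ltnS ltnW.
rewrite ss//; congr (tens _ _ \o _)%VF.
by apply: IH => j jm; apply: ss; exact: ltnW.
Qed.

End Trees.

(** * Coordinates and norms of the fusion trees *)

Section TreeCoefficients.
Variables (R : realType) (al : R) (c : bool).
Local Notation C := R[i].
Hypothesis irr : irrational al.
Local Notation A := (path_step al c).
Local Notation a := (qpow A).
Local Notation eps := (if c then 1 else -1 : R).

(** A case distinction by equation leaves the [c] inside [turn_at] and [path_step] untouched. *)
Let cTF : {c = true} + {c = false}.
Proof. by case: (c); [left|right]. Qed.

Let ifcT (T : Type) (y z : T) : c = true -> (if c then y else z) = y.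
Proof. by move=> ->. Qed.

Let ifcF (T : Type) (y z : T) : c = false -> (if c then y else z) = z.
Proof. by move=> ->. Qed.

(** The coefficient of the vertex of direction [c] on the tensor of two extreme vectors,
    [v_0 (x) v_0] for [c] and [v_1 (x) v_1] otherwise. *)
Definition vertex_scale (x : R) : R :=
  if c then qnum (x + al) else qnum (x + al) / qnum (x + 1).

(** * One-vertex recursions for the coordinates of a tree *)

Section Steps.
Variables (s : nat -> bool) (m : nat) (S : nat -> bool).
Local Notation x := (xpath al s m).
Local Notation T k z := (tree al s k.+1 (evec R z) (tidx al S k.+1)).

Lemma step_keep_nc : s m = c -> S m.+1 = ~~ c ->
  T m.+1 (~~ c) = (vertex_scale x)%:C%C * T m (~~ c).
Proof.
move=> sm Sm; rewrite tree_rec sm Sm /vertex_scale; case: (c) => /=.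
  by rewrite !vertexR !ffunE /=; ring.
by rewrite !vertexL ?xpath_nz// !ffunE /=; ring.
Qed.

Lemma step_kill : s m = c -> S m.+1 = c -> T m.+1 (~~ c) = 0.
Proof.
move=> sm Sm; rewrite tree_rec sm Sm; case: (c) => /=.
  by rewrite !vertexR !ffunE /=; ring.
by rewrite !vertexL ?xpath_nz// !ffunE /=; ring.
Qed.

Lemma step_end_c : s m = c -> S m.+1 = c -> T m.+1 c =
  (if c then (vertex_scale x)%:C%C / qpow (x + 1)
   else (qnum (al + 1) / qnum (x + 1))%:C%C) * T m (~~ c).
Proof.
move=> sm Sm; rewrite tree_rec sm Sm /vertex_scale; case: (c) => /=.
  by rewrite !vertexR !ffunE /=; ring.
by rewrite !vertexL ?xpath_nz// !ffunE /=; ring.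
Qed.

Lemma step_keep_c : s m = c -> S m.+1 = ~~ c -> T m.+1 c =
  (if c then (vertex_scale x)%:C%C else - qpow (al + 1)) * T m c.
Proof.
move=> sm Sm; rewrite tree_rec sm Sm /vertex_scale; case: (c) => /=.
  by rewrite !vertexR !ffunE /=; ring.
by rewrite !vertexL ?xpath_nz// !ffunE /=; ring.
Qed.

Lemma step_turn_end : s m = ~~ c -> S m.+1 = c -> T m.+1 (~~ c) =
  (if c then - qpow (al + 1) else (qnum (x + al))%:C%C) * T m (~~ c).
Proof.
move=> sm Sm; rewrite tree_rec sm Sm; case: (c) => /=.
  by rewrite !vertexL ?xpath_nz// !ffunE /=; ring.
by rewrite !vertexR !ffunE /=; ring.
Qed.

Lemma step_turn_keep : s m = ~~ c -> S m.+1 = ~~ c -> T m.+1 (~~ c) =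
  (if c then (qnum (al + 1) / qnum (x + 1))%:C%C
   else (qnum (x + al))%:C%C / qpow (x + 1)) * T m c.
Proof.
move=> sm Sm; rewrite tree_rec sm Sm; case: (c) => /=.
  by rewrite !vertexL ?xpath_nz// !ffunE /=; ring.
by rewrite !vertexR !ffunE /=; ring.
Qed.

End Steps.

(** * Trees with a single turn *)

Variable j : nat.

Definition turn_at (l : nat) : bool := if l == j then ~~ c else c.
Local Notation x l := (xpath al turn_at l).
Local Notation g l := (vertex_scale (x l)).

(** The path starts at [al = A - eps]. The turn replaces one step [A] by [A - 2 eps], whence [3 eps]
    in the next lemma. *)
Lemma xpath_turn_le l : (l <= j)%N -> x l = l.+1%:R * A - eps.
Proof.
elim: l => [_|l IH lj].
  by rewrite /xpath big_ord0 /path_step; case: (c); ring.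
rewrite xpathS IH 1?ltnW// /turn_at ltn_eqF// -[in RHS]natr1 /path_step.
by case: (c); ring.
Qed.

Lemma xpath_turn_gt l : (j < l)%N -> x l = l.+1%:R * A - 3 * eps.
Proof.
elim: l => // l IH; rewrite ltnS leq_eqVlt => /orP[/eqP jl|jl].
  rewrite xpathS xpath_turn_le -?jl// /turn_at eqxx -[in RHS]natr1 /path_step.
  by case: (c); rewrite /=; ring.
rewrite xpathS IH// /turn_at gtn_eqF// -[in RHS]natr1 /path_step.
by case: (c); ring.
Qed.

Lemma qnumD4 (y : R) : qnum (y + 4) = qnum y.
Proof.
by have -> : y + 4 = y + 2 + 2; [ring|rewrite !qnumD2 opprK].
Qed.

(** Numerator and denominator are shifted equally, by 2 before the turn and by 4 after it, so the
    signs from [[x + 2] = - [x]] cancel. *)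
Lemma scale_telescope l : c = false -> l != j ->
  g l = qnum (l.+2%:R * A) / qnum (l.+1%:R * A).
Proof.
move=> cF lj; have -> : g l = qnum (x l + al) / qnum (x l + 1) by rewrite /vertex_scale cF.
have [jl|jl|/eqP] := ltngtP l j; last by rewrite (negPf lj).
  have -> : x l + al = l.+2%:R * A + 2.
    by rewrite xpath_turn_le 1?ltnW// cF -[in RHS]natr1 /path_step /=; ring.
  have -> : x l + 1 = l.+1%:R * A + 2.
    by rewrite xpath_turn_le 1?ltnW// cF; ring.
  by rewrite !qnumD2 invrN mulrNN.
have -> : x l + al = l.+2%:R * A + 4.
  by rewrite xpath_turn_gt// cF -[in RHS]natr1 /path_step /=; ring.
have -> : x l + 1 = l.+1%:R * A + 4.
  by rewrite xpath_turn_gt// cF; ring.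
by rewrite !qnumD4.
Qed.

Let nzA i : qnum (i.+1%:R * A) != 0.
Proof. exact: qnum_A. Qed.

Let nzA' i : (qnum (i.+1%:R * A))%:C%C != 0 :> C.
Proof. by apply: contraNneq (nzA i) => -[/eqP]. Qed.

Lemma prod_scale_lt m : c = false -> (m <= j)%N ->
  \prod_(l < m) g l = qnum (m.+1%:R * A) / qnum A.
Proof.
move=> cF; elim: m => [_|m IH mj].
  by rewrite big_ord0 mul1r divff//; have := nzA 0; rewrite mul1r.
rewrite big_ord_recr /= IH 1?ltnW// scale_telescope// ?ltn_eqF//.
by rewrite mulrC mulf_div [X in X / _]mulrC -mulf_div divff// mul1r.
Qed.

(** Leaving out the factor at the turn breaks the telescope into the pieces [[(j+1)A]/[A]] and
    [[(m+1)A]/[(j+2)A]]. *)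
Lemma prod_scale_neq m : c = false -> (j < m)%N ->
  \prod_(l < m | l != j :> nat) g l =
  qnum (j.+1%:R * A) / qnum (j.+2%:R * A) * (qnum (m.+1%:R * A) / qnum A).
Proof.
move=> cF; elim: m => // m IH; rewrite ltnS leq_eqVlt => /orP[/eqP jm|jm].
  rewrite big_mkcond big_ord_recr /= -jm eqxx mulr1 /= -big_mkcond /=.
  rewrite (eq_bigl xpredT) => [|l]; last by rewrite ltn_eqF.
  rewrite prod_scale_lt// mulrA divfK//.
rewrite big_mkcond big_ord_recr /= gtn_eqF//= -big_mkcond /= IH//.
rewrite scale_telescope// ?gtn_eqF// -[LHS]mulrA; congr (_ * _).
have A0 : qnum A != 0 by have := nzA 0; rewrite mul1r.
move: (nzA m) A0; move: (qnum (m.+1%:R * A)) (qnum A) (qnum _) => t p T t0 p0.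
by field; rewrite t0 p0.
Qed.

Lemma tree_const m S : (m <= j)%N -> (forall i, (i <= m)%N -> S i = ~~ c) ->
  tree al turn_at m.+1 (evec R (~~ c)) (tidx al S m.+1) = (\prod_(l < m) g l)%:C%C.
Proof.
elim: m => [_ SS|m IH mj SS].
  by rewrite tree1 ffunE SS// eqxx big_ord0.
rewrite step_keep_nc ?SS// ?IH//; first last.
- by rewrite /turn_at ltn_eqF.
- by move=> i im; apply: SS; exact: ltnW.
- exact: ltnW.
by rewrite big_ord_recr /= rmorphM mulrC.
Qed.

(** Before the turn, the image of the basis vector opposite to the extreme one is spread over all
    positions as a geometric progression in [a^-1]. *)
Lemma tree_single m p : (m <= j)%N -> (p <= m)%N ->
  tree al turn_at m.+1 (evec R c) (tidx al (single_at c p) m.+1) =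
  (if c then (\prod_(l < m) g l)%:C%C else a ^+ m) * a ^- p.
Proof.
elim: m => [_|m IH mj].
  rewrite leqn0 => /eqP ->; rewrite tree1 ffunE /single_at !eqxx big_ord0.
  by rewrite expr0 invr1 mulr1; case: ifP.
have sm : turn_at m = c by rewrite /turn_at ltn_eqF.
have a0 := qpow_neq0 A.
rewrite leq_eqVlt => /orP[/eqP ->|pm].
  rewrite step_end_c//; last by rewrite /single_at eqxx.
  rewrite (tree_const (ltnW mj)); last first.
    by move=> i im; rewrite /single_at ltn_eqF.
  have [cT|cF] := cTF.
    have -> : x m + 1 = m.+1%:R * A by rewrite xpath_turn_le 1?ltnW// ifcT// subrK.
    by rewrite !(ifcT _ _ cT) qpow_nat big_ord_recr /= rmorphM mulrAC;
      congr (_ * _); exact: mulrC.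
  have -> : x m + 1 = m.+1%:R * A + 2.
    by rewrite xpath_turn_le 1?ltnW// (ifcF _ _ cF); ring.
  have -> : al + 1 = A + 2 by rewrite /path_step (ifcF _ _ cF); ring.
  rewrite !(ifcF _ _ cF) !qnumD2 (prod_scale_lt cF (ltnW mj)).
  rewrite -rmorphM invrN mulrNN divff ?expf_neq0//.
  have A0 : qnum A != 0 by have := nzA 0; rewrite mul1r.
  by rewrite mulf_div [X in X / _]mulrC divff ?mulf_neq0.
rewrite step_keep_c//; last by rewrite /single_at gtn_eqF.
rewrite (IH (ltnW mj) pm).
have [cT|cF] := cTF.
  by rewrite !(ifcT _ _ cT) big_ord_recr /= rmorphM; ring.
by rewrite (qpow_al1 al c) !(ifcF _ _ cF) opprK exprS; ring.
Qed.

(* Dividing the coordinates of a fusion tree by tree_factor makes them agree for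
   both values of c. *)
Definition ntree_coef (p : nat) : C :=
  if (p <= j)%N then (qnum A / qnum (j.+1%:R * A))%:C%C * a ^- p
  else if p == j.+1 then - a else 0.

Definition tree_factor (m : nat) : C :=
  (if c then 1 else - (qnum (x j + al))%:C%C / a) *
  (\prod_(l < m | l != j :> nat) g l)%:C%C.

(** At the turn the exceptional factor is either the new one or an earlier one, treated by
    [tree_const] and [tree_single]. Every later vertex multiplies by [vertex_scale] and kills an
    exceptional last factor, hence the zeros beyond [j + 1]. *)
Lemma wcoef_tree m p : (j < m)%N -> (p <= m)%N ->
  wcoef c (tree al turn_at m.+1) p = tree_factor m * ntree_coef p.
Proof.
have a0 := qpow_neq0 A.
have A0 : qnum A != 0 by have := nzA 0; rewrite mul1r.
have A0' : (qnum A)%:C%C != 0 :> C by apply: contraNneq A0 => -[/eqP].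
rewrite /wcoef; elim: m => // m IH; rewrite ltnS leq_eqVlt => /orP[/eqP jm|jm] pm.
  have tm : turn_at m = ~~ c by rewrite /turn_at -jm eqxx.
  have PE : \prod_(l < m.+1 | l != j :> nat) g l = \prod_(l < m) g l.
    rewrite big_mkcond big_ord_recr /= -jm eqxx mulr1 /= -big_mkcond /=.
    by apply: eq_bigl => l; rewrite ltn_eqF.
  rewrite /tree_factor /ntree_coef PE.
  move: pm; rewrite leq_eqVlt => /orP[/eqP pm|pm].
    rewrite pm step_turn_end//; last by rewrite /single_at eqxx.
    rewrite tree_const ?jm//; last first.
      by move=> i im; rewrite /single_at ltn_eqF.
    rewrite ltnn eqxx (qpow_al1 al c) -jm.
    by have [cT|cF] := cTF; [rewrite !(ifcT _ _ cT); ring|rewrite !(ifcF _ _ cF); field].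
  have pj : (p <= j)%N by rewrite jm.
  rewrite step_turn_keep//; last by rewrite /single_at gtn_eqF.
  rewrite tree_single ?jm// -jm pj.
  have [cT|cF] := cTF.
    have -> : x j + 1 = j.+1%:R * A by rewrite xpath_turn_le// (ifcT _ _ cT) subrK.
    have -> : al + 1 = A by rewrite /path_step (ifcT _ _ cT).
    by rewrite !(ifcT _ _ cT); ring.
  rewrite prod_scale_lt//.
  have -> : x j + 1 = j.+1%:R * A + 2 by rewrite xpath_turn_le// (ifcF _ _ cF); ring.
  rewrite !(ifcF _ _ cF) [qpow (_ + 2)]qpowD qpow2 mulrN1 qpow_nat !rmorphM !fmorphV /=.
  have := nzA' j; move: (j.+1%:R * A) => B B0.
  by rewrite exprS; field; rewrite A0' B0 a0 !expf_neq0.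
have tm : turn_at m = c by rewrite /turn_at gtn_eqF.
move: pm; rewrite leq_eqVlt => /orP[/eqP ->|pm].
  rewrite step_kill//; last by rewrite /single_at eqxx.
  by rewrite /ntree_coef leqNgt ltnS (ltnW jm) /= eqSS gtn_eqF// mulr0.
rewrite step_keep_nc//; last by rewrite /single_at gtn_eqF.
rewrite IH// /tree_factor [in RHS]big_mkcond [in RHS]big_ord_recr /= gtn_eqF//=.
by rewrite -big_mkcond /= rmorphM; ring.
Qed.

Lemma conj_qpow (y : R) : ((qpow y)^*)%C = (qpow y)^-1.
Proof. by rewrite -qpowN /qpow mulrN mulNr cosN sinN. Qed.

Lemma tree_factor_neq0 m : tree_factor m != 0.
Proof.
rewrite /tree_factor mulf_neq0//.
  case: (c); rewrite ?oner_eq0// mulf_neq0 ?invr_eq0 ?qpow_neq0// oppr_eq0.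
  by apply: contraNneq (xpath_nz' irr turn_at j) => -[/eqP].
have : \prod_(l < m | l != j :> nat) g l != 0.
  apply/prodf_neq0 => l _; rewrite /vertex_scale.
  by case: (c); rewrite ?mulf_neq0 ?invr_eq0 ?xpath_nz ?xpath_nz'.
by apply: contraNneq => -[/eqP].
Qed.

Definition ntree_weight : R := qnum (j.+2%:R * A) / qnum (j.+1%:R * A).

(** The part of the square norms that does not depend on the position of the turn. *)
Definition kappa (n : nat) (k : int) : R :=
  if c then (qnum (out_color n k al + 1))^-1 / qnum A
  else - (qnum (out_color n k al + 1))^-1 * (qnum (al + 1)) ^- (n.-2)
       * (qnum A / qnum (n%:R * A)).

(** For [c = false] the norm contains the product [P] of scales once, but the square modulus of
    [tree_factor] contains [P ^+ 2]; evaluating the remaining [1 / P] by [prod_scale_neq] yields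
    both [ntree_weight] and the last factor of [kappa]. For [c] the squares match and the weight
    comes from the vertex at the turn. *)
Lemma tree_norm_turn n k (s : dirseq n k) : (j < n.-1)%N ->
  (forall l, (l < n.-1)%N -> dir s l = turn_at l) ->
  (tree_norm al s)%:C%C = (kappa n k)%:C%C * ntree_weight%:C%C *
    (((tree_factor n.-1)^*)%C * tree_factor n.-1).
Proof.
move=> jn st; have n_gt0 : (0 < n)%N by move: jn; clear; lia.
have xst l : (l <= n.-1)%N -> xpath al (dir s) l = x l.
  move=> ln; congr (_ + _); apply: eq_bigr => i _.
  by rewrite st// (leq_trans _ ln).
have A0 : qnum A != 0 by have := nzA 0; rewrite mul1r.
have xj : x j + 1 = j.+1%:R * A + (if c then 0 else 2).
  by rewrite xpath_turn_le//; case: (c); ring.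
set P := \prod_(l < n.-1 | l != j :> nat) g l.
have FE : ((tree_factor n.-1)^*)%C * tree_factor n.-1 =
    ((if c then 1 else qnum (x j + al) ^+ 2) * P ^+ 2)%:C%C.
  rewrite /tree_factor -/P; case: (c).
    by rewrite !mul1r conjc_real -rmorphM -expr2.
  have cM (u v : C) : ((u * v)^*)%C = (u^*)%C * (v^*)%C by rewrite rmorphM.
  have cN (u : C) : ((- u)^*)%C = - (u^*)%C by rewrite rmorphN.
  rewrite !cM cN !conjc_real conjc_inv conj_qpow invrK rmorphM !rmorphXn.
  by have := qpow_neq0 (path_step al false) => q0; field.
rewrite FE -!rmorphM; congr (_%:C)%C.
have tj : turn_at j = ~~ c by rewrite /turn_at eqxx.
rewrite /tree_norm (bigD1 (Ordinal jn))//= (st _ jn) tj (xst _ (ltnW jn)).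
have PN : \prod_(i < n.-1 | i != Ordinal jn)
    (if dir s i then qnum (xpath al (dir s) i + al) ^+ 2
     else qnum (xpath al (dir s) i + al) / (qnum (xpath al (dir s) i + 1) * qnum (al + 1))) =
    \prod_(l < n.-1 | l != j :> nat)
     (if c then g l ^+ 2 else g l / qnum (al + 1)).
  rewrite (eq_bigl (fun l : 'I_n.-1 => l != j :> nat))//.
  apply: eq_bigr => l lj; have tl : turn_at l = c by rewrite /turn_at (negPf lj).
  rewrite (st _ (ltn_ord l)) (xst _ (ltnW (ltn_ord l))) tl /vertex_scale.
  by case: (c) => //; rewrite invfM mulrA.
rewrite PN /kappa /ntree_weight.
have jA := nzA j; have jA' := nzA j.+1.
have [cT|cF] := cTF.
  rewrite (eq_bigr (fun l : 'I_n.-1 => g l ^+ 2)) => [|l _]; last exact: ifcT.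
  rewrite prodrXl -/P.
  have -> : x j + 1 = j.+1%:R * A by rewrite xj (ifcT _ _ cT) addr0.
  have -> : x j + al = j.+2%:R * A - 2.
    rewrite xpath_turn_le// (ifcT _ _ cT) -[in RHS]natr1 /path_step (ifcT _ _ cT).
    by ring.
  have -> : qnum (j.+2%:R * A - 2) = - qnum (j.+2%:R * A).
    by rewrite -[in RHS](subrK 2 (j.+2%:R * A)) qnumD2 opprK.
  have -> : al + 1 = A by rewrite /path_step (ifcT _ _ cT).
  rewrite !(ifcT _ _ cT) mul1r; move: (qnum (j.+2%:R * A)) jA'.
  move: (qnum (j.+1%:R * A)) (qnum A) jA A0 => p q p0 q0 r _.
  move: (_^-1) => o; rewrite cT /=.
  by field; rewrite p0 q0.
have -> : \prod_(l < n.-1 | l != j :> nat)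
    (if c then g l ^+ 2 else g l / qnum (al + 1)) = P * qnum (al + 1) ^- (n.-2).
  rewrite (eq_bigr (fun l : 'I_n.-1 => g l / qnum (al + 1))) => [|l _]; last exact: ifcF.
  rewrite big_split /= prodr_const; congr (_ * _).
  rewrite -exprVn; congr (_ ^+ _).
  have -> : #|[pred l : 'I_n.-1 | l != j :> nat]| = #|predC1 (Ordinal jn)|.
    by apply: eq_card => l; rewrite !inE.
  by rewrite cardC1 card_ord.
have -> : P = qnum (j.+1%:R * A) / qnum (j.+2%:R * A) * (qnum (n.-1.+1%:R * A) / qnum A).
  exact: prod_scale_neq.
have -> : n.-1.+1 = n by rewrite prednK.
have n0 : qnum (n%:R * A) != 0 by rewrite -(prednK n_gt0); exact: nzA.
rewrite !(ifcF _ _ cF); move: (qnum (j.+2%:R * A)) jA' n0.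
move: (qnum (j.+1%:R * A)) (qnum A) jA A0 (qnum (n%:R * A)) => p q p0 q0 r t t0 r0.
move: (qnum (al + 1) ^- n.-2) (qnum _)^-1 => u v; rewrite cF /=.
by field; rewrite p0 q0 t0 r0.
Qed.

End TreeCoefficients.

(** * The Burau representation on the space of homomorphisms *)

Local Opaque homspace.

Section PostComposition.
Variables (R : realType) (n : nat) (k : int) (al : R).
Local Notation X := (Vmod (out_color n k al)).
Local Notation Y := (tpow al n).
Local Notation H := (Hspace n k al).

(** The projection makes the definition total; it changes nothing when [g] is an intertwiner. *)
Definition post_fun (g : 'End(fspace R (wbasis Y))) (f : H) : H :=
  vsproj (homspace X Y) (g \o vsval f)%VF.

Lemma valP_lin (x : R[i]) (u v : H) : vsval (x *: u + v) = x *: vsval u + vsval v.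
Proof. exact: linearP. Qed.

Fact post_fun_linear g : linear (post_fun g).
Proof.
move=> x u v; rewrite /post_fun valP_lin comp_lfunDr -comp_lfunZr.
exact: linearP.
Qed.

HB.instance Definition _ g :=
  GRing.isLinear.Build R[i] H H *:%R (post_fun g) (post_fun_linear g).

Definition post g : 'End(H) := linfun (post_fun g).

Lemma val_post g f : g \in homspace Y Y -> vsval (post g f) = (g \o vsval f)%VF.
Proof.
move=> gh; rewrite lfunE /= vsprojK//.
apply: (@homspace_comp R X Y Y g (vsval f) gh); exact: subvsP.
Qed.

Lemma post_comp g h : g \in homspace Y Y -> h \in homspace Y Y ->
  post (g \o h)%VF = (post g \o post h)%VF.
Proof.
move=> gh herm_row; apply/lfunP => f; apply: subvs_inj.
by rewrite comp_lfunE !val_post// ?comp_lfunA//; exact: homspace_comp gh herm_row.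
Qed.

Lemma homspace_id (M : wmodule R) : \1%VF \in homspace M M.
Proof. by apply/mem_homspaceP; split; rewrite comp_lfun1l comp_lfun1r. Qed.

Lemma post_id : post \1%VF = \1%VF.
Proof.
apply/lfunP => f; apply: subvs_inj.
by rewrite val_post ?homspace_id// comp_lfun1l id_lfunE.
Qed.

Lemma lker0_compfV_endo (I : finType) (f : 'End(fspace R I)) :
  lker f == 0%VS -> (f \o f^-1)%VF = \1%VF.
Proof.
move=> f0; apply/lfunP => u; rewrite comp_lfunE id_lfunE.
by apply: limg_lfunVK; rewrite (eqP (_ : limg f == fullv)) ?memvf// -dimv_leqif_eq
  ?subvf// -(limg_ker_dim f fullv) (eqP f0) capv0 dimv0 add0n.
Qed.

Lemma homspace_inv (M : wmodule R) (f : 'End(fspace R (wbasis M))) :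
  lker f == 0%VS -> f \in homspace M M -> (f^-1)%VF \in homspace M M.
Proof.
move=> f0 fh; have fV := lker0_compfV_endo f0; have Vf := lker0_compVf f0.
have inv g : (g \o f = f \o g)%VF -> (g \o f^-1 = f^-1 \o g)%VF.
  move=> gf; rewrite -[LHS]comp_lfun1l -Vf -comp_lfunA; congr (_ \o _)%VF.
  by rewrite comp_lfunA -gf -comp_lfunA fV comp_lfun1r.
by case/mem_homspaceP: fh => *; apply/mem_homspaceP; split; exact: inv.
Qed.

Lemma braid_letter_hom (l : 'I_n.-1 * bool) :
  (if l.2 then (sigma al n l.1.+1)^-1 else sigma al n l.1.+1)%VF \in homspace Y Y.
Proof.
case: ifP => _; last exact: sigma_hom.
apply: homspace_inv; last exact: sigma_hom.
by apply: sigma_lker0; have := ltn_ord l.1; lia.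
Qed.

Lemma braid_act_hom (w : braid_word n) : braid_act al w \in homspace Y Y.
Proof.
elim: w => [|l w IH]; first exact: homspace_id.
by apply: homspace_comp IH; exact: braid_letter_hom.
Qed.

Lemma braid_act_cat (w w' : braid_word n) :
  braid_act al (w ++ w') = (braid_act al w \o braid_act al w')%VF.
Proof.
elim: w => [|l w IH]; first by rewrite comp_lfun1l.
by rewrite cat_cons [LHS]/= IH comp_lfunA.
Qed.

Lemma braid_act_inv (w : braid_word n) :
  exists w' : braid_word n, (braid_act al w \o braid_act al w')%VF = \1%VF.
Proof.
elim: w => [|[i b] w [w' IH]]; first by exists [::]; rewrite comp_lfun1l.
exists (w' ++ [:: (i, ~~ b)]); rewrite braid_act_cat [braid_act _ (_ :: w)]/=.
rewrite comp_lfunA -[((_ \o _) \o braid_act _ w')%VF]comp_lfunA IH comp_lfun1r.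
rewrite /= comp_lfun1r.
have s0 : lker (sigma al n i.+1) == 0%VS.
  by apply: sigma_lker0; have := ltn_ord i; lia.
by case: b => /=; [exact: lker0_compVf|exact: lker0_compfV_endo].
Qed.

End PostComposition.

Section Model.
Variables (R : realType) (n : nat) (k : int) (al : R) (c : bool).
Local Notation C := R[i].
Hypothesis irr : irrational al.
Hypothesis n0 : (0 < n)%N.
Hypothesis kc : k = if c then n%:Z - 3 else - (n%:Z - 3).
Local Notation A := (path_step al c).
Local Notation a := (qpow A).
Local Notation Q := (qpow ((al + 1) * (al - 1) / 2)).
Local Notation X := (Vmod (out_color n k al)).
Local Notation Y := (tpow al n).
Local Notation H := (Hspace n k al).
Local Notation m := n.-1.
Local Notation tr j := (tree al (turn_at c j) n).
Local Notation factor j := (tree_factor al c j m).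

Let nE : m.+1 = n := prednK n0.

Lemma count_dirseq (s : m.-tuple bool) :
  ((count id s)%:Z - (count negb s)%:Z == k) =
  (#|[pred i | tnth s i == ~~ c]| == 1%N).
Proof.
have E : count (fun b => b == ~~ c) s = #|[pred i | tnth s i == ~~ c]|.
  by rewrite -sum1_count big_tuple -sum1_card; apply: eq_bigl.
have S : (count id s + count negb s = n.-1)%N.
  by have := count_predC id s; rewrite size_tuple.
have E' : count (fun b => b == ~~ c) s = if c then count negb s else count id s.
  by case: (c); apply: eq_count; case.
rewrite -E E' kc; move: S; case: (c) => S; apply/eqP/eqP; lia.
Qed.

Lemma turn_dirseq_subproof (j : 'I_m) :
  (count id [tuple turn_at c j i | i < m])%:Z -
  (count negb [tuple turn_at c j i | i < m])%:Z == k.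
Proof.
rewrite count_dirseq -(card1 j); apply/eqP/eq_card => i.
rewrite !inE tnth_mktuple /turn_at -val_eqE /=.
by have [_|_] := eqVneq (i : nat) j; case: (c).
Qed.

Definition turn_dirseq (j : 'I_m) : dirseq n k :=
  exist (fun s : m.-tuple bool => (count id s)%:Z - (count negb s)%:Z == k)
    [tuple turn_at c j i | i < m] (turn_dirseq_subproof j).

Lemma dir_turn_dirseq (j : 'I_m) l : (l < m)%N -> dir (turn_dirseq j) l = turn_at c j l.
Proof.
move=> lm; have := tnth_nth false (val (turn_dirseq j)) (Ordinal lm).
by rewrite tnth_mktuple.
Qed.

Lemma turn_dirseq_inj : injective turn_dirseq.
Proof.
move=> i j ij; apply/eqP; have := dir_turn_dirseq i (ltn_ord i).
rewrite ij dir_turn_dirseq// /turn_at eqxx val_eqE eq_sym.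
by case: eqP => //; case: (c).
Qed.

Lemma turn_dirseq_surj (s : dirseq n k) : exists j, s = turn_dirseq j.
Proof.
have := valP s; rewrite count_dirseq => /eqP/mem_card1[j sj].
exists j; apply: val_inj; apply: eq_from_tnth => i.
rewrite tnth_mktuple /turn_at; have := sj i; rewrite !inE -val_eqE => <-.
by case: (tnth _ _); case: (c).
Qed.

Lemma turn_dirseq_bij : bijective turn_dirseq.
Proof.
pose g s := cid (turn_dirseq_surj s).
exists (fun s => sval (g s)) => [j|s]; last by rewrite -(svalP (g s)).
by apply: turn_dirseq_inj; rewrite -(svalP (g _)).
Qed.

Definition idx (j : 'I_m) : 'I_#|dirseq n k| := enum_rank (turn_dirseq j).

Lemma idx_bij : bijective idx.
Proof. exact: (bij_comp (@enum_rank_bij _) turn_dirseq_bij). Qed.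

Lemma fusion_basis_idx j : (fusion_basis n k al)`_(idx j) = tr j.
Proof.
rewrite -tnth_nth tnth_mktuple enum_rankK; apply: tree_ext => l lm.
by rewrite dir_turn_dirseq.
Qed.

Lemma wcoef_tr (j : 'I_m) p : (p < n)%N -> wcoef c (tr j) p = factor j * ntree_coef al c j p.
Proof.
move=> pn; have pm : (p <= m)%N by rewrite -ltnS nE.
by have := wcoef_tree c irr (ltn_ord j) pm; rewrite nE.
Qed.

Lemma tr_hom (j : 'I_m) : tr j \in homspace X Y.
Proof.
have -> : out_color n k al = xpath al (turn_at c j) m.
  rewrite xpath_turn_gt// nE /out_color kc /path_step.
  by case: (c); rewrite ?rmorphN rmorphB /=; ring.
by have := tree_hom irr (turn_at c j) m; rewrite nE.
Qed.

Lemma wcoef_sum (x : 'I_m -> C) (F : 'I_m -> 'Hom(fspace R bool, fspace R (wbasis Y))) p :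
  wcoef c (\sum_j x j *: F j) p = \sum_j x j * wcoef c (F j) p.
Proof.
elim/big_rec2: _ => [|j y f _ <-]; first by rewrite /wcoef zero_lfunE ffunE.
by rewrite wcoefD wcoefZ.
Qed.

(** Triangularity: the last non-zero coordinate of tree [j] is at [j + 1], so the coefficients
    vanish one after the other from the top. *)
Lemma tr_free (x : 'I_m -> C) : \sum_j x j *: tr j = 0 -> forall j, x j = 0.
Proof.
move=> x0; have cf0 p : (p < n)%N -> \sum_j x j * (factor j * ntree_coef al c j p) = 0.
  move=> pn; have := wcoef_sum x (fun j => tr j) p; rewrite x0.
  rewrite /wcoef zero_lfunE ffunE => E; rewrite [RHS]E.
  by apply: eq_bigr => j _; rewrite -wcoef_tr.
suff K r (j : 'I_m) : (m - r <= j)%N -> x j = 0.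
  by move=> j; apply: (K m); rewrite subnn.
elim: r j => [j|r IH j]; first by have := ltn_ord j; lia.
move=> rj; have jn : (j.+1 < n)%N by have := ltn_ord j; lia.
have fa0 : factor j * - a != 0.
  by rewrite mulf_neq0 ?tree_factor_neq0// oppr_eq0 qpow_neq0.
have := cf0 _ jn; rewrite (bigD1 j)//= big1 ?addr0; last first.
  move=> i ij; have [ji|ij'] := ltnP j i; first by rewrite IH ?mul0r//; lia.
  have {ij ij'}ij : (i < j)%N.
    by rewrite ltn_neqAle ij' andbT; move: ij; rewrite -val_eqE.
  rewrite /ntree_coef ifF ?ifF ?mulr0//; first by rewrite eqSS gtn_eqF.
  by apply/negbTE; rewrite -ltnNge ltnS ltnW.
rewrite /ntree_coef ltnn eqxx => /eqP.
by rewrite mulf_eq0 (negPf fa0) orbF => /eqP.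
Qed.

(** The same triangular shape removes coordinates from the top down. When only coordinate 0 is left,
    [hom_constraint] makes it vanish. *)
Lemma tr_span f : f \in homspace X Y -> exists x : 'I_m -> C, f = \sum_j x j *: tr j.
Proof.
suff K r g : g \in homspace X Y ->
    (forall p, (r < p)%N -> (p < n)%N -> wcoef c g p = 0) ->
    exists x : 'I_m -> C, g = \sum_j x j *: tr j.
  by move=> fh; apply: (K n) => // p pn pn'; have := ltn_trans pn pn'; rewrite ltnn.
elim: r g => [|r IH] g gh g0.
  exists (fun=> 0); rewrite big1 => [|i _]; last by rewrite scale0r.
  apply: (hom_wcoef_inj irr n0 kc gh) => -[_|p]; last exact: g0.
  have := hom_constraint c irr gh; rewrite (bigD1 (Ordinal n0))//= big1 => [|i i0].
    by rewrite addr0 expr0 invr1 mul1r.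
  by rewrite g0 ?mulr0// lt0n.
have [rm|rm] := leqP m r.
  apply: IH => // p rp pn; have : (p < p)%N; last by rewrite ltnn.
  by apply: leq_trans pn _; rewrite -nE; exact: leq_ltn_trans rp.
pose j := Ordinal rm.
pose t := wcoef c g r.+1 / (factor j * - a).
have fa0 : factor j * - a != 0.
  by rewrite mulf_neq0 ?tree_factor_neq0// oppr_eq0 qpow_neq0.
have [||x E] := IH (g - t *: tr j).
- by rewrite memvB// memvZ// tr_hom.
- move=> p rp pn; rewrite -scaleNr wcoefD wcoefZ wcoef_tr//.
  move: rp; rewrite leq_eqVlt => /orP[/eqP <-|rp].
    by rewrite /ntree_coef ltnn eqxx mulNr divfK// subrr.
  rewrite g0// /ntree_coef /= leqNgt (ltnW rp) /= gtn_eqF// mulr0 mulr0 addr0//.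
exists (fun i => x i + (if i == j then t else 0)).
rewrite (eq_bigr (fun i => x i *: tr i + (if i == j then t else 0) *: tr i)).
  rewrite big_split /= -E (bigD1 j)//= eqxx big1 ?addr0 ?subrK// => i /negPf ->.
  by rewrite scale0r.
by move=> i _; rewrite scalerDl.
Qed.

Lemma fusion_sum (x : 'I_#|dirseq n k| -> C) :
  \sum_i x i *: (fusion_basis n k al)`_i = \sum_j x (idx j) *: tr j.
Proof.
rewrite (reindex idx) /=; last exact: onW_bij idx_bij.
by apply: eq_bigr => j _; rewrite fusion_basis_idx.
Qed.

(** Freeness gives the function [coord] in [herm] its meaning as coordinates. *)
Lemma fusion_free : free (fusion_basis n k al).
Proof.
apply/freeP => x; rewrite fusion_sum => x0 i.
have [g _ gK] := idx_bij; rewrite -(gK i).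
exact: (tr_free x0 (g i)).
Qed.

Definition ncoord (j : 'I_m) (f : H) : C :=
  factor j * coord (fusion_basis n k al) (idx j) (vsval f).

Definition ntree (j : 'I_m) : H := vsproj (homspace X Y) ((factor j)^-1 *: tr j).

Lemma val_ntree j : vsval (ntree j) = (factor j)^-1 *: tr j.
Proof. by rewrite vsprojK// memvZ// tr_hom. Qed.

Lemma ncoord_linear j : linear (ncoord j : H -> C^o).
Proof.
move=> x u v; rewrite /ncoord valP_lin linearP /= mulrDr.
by rewrite /GRing.scale /= mulrCA.
Qed.

Lemma coord_sum (x : 'I_m -> C) j :
  coord (fusion_basis n k al) (idx j) (\sum_i x i *: tr i) = x j.
Proof.
have [g gK _] := idx_bij.
have -> : \sum_i x i *: tr i = \sum_i x (g i) *: (fusion_basis n k al)`_i.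
  by rewrite fusion_sum; apply: eq_bigr => i _; rewrite gK.
by rewrite (coord_sum_free (fun i => x (g i)) _ fusion_free) gK.
Qed.

Lemma val_lin_sum (x : 'I_m -> C) (F : 'I_m -> H) :
  vsval (\sum_j x j *: F j) = \sum_j x j *: vsval (F j).
Proof.
elim/big_rec2: _ => [|j y f _ <-]; first exact: linear0.
exact: valP_lin.
Qed.

Lemma ncoordK (f : H) : f = \sum_j ncoord j f *: ntree j.
Proof.
apply: subvs_inj; have [x E] := tr_span (subvsP f).
rewrite val_lin_sum E; apply: eq_bigr => j _.
rewrite val_ntree scalerA /ncoord E coord_sum mulrAC.
by rewrite divff ?mul1r// tree_factor_neq0.
Qed.

Lemma ncoord_ntree i j : ncoord i (ntree j) = (i == j)%:R.
Proof.
rewrite /ncoord val_ntree.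
have -> : (factor j)^-1 *: tr j = \sum_l (if l == j then (factor j)^-1 else 0) *: tr l.
  by rewrite (bigD1 j)//= eqxx big1 ?addr0// => l /negPf ->; rewrite scale0r.
rewrite coord_sum; case: eqP => [->|_]; last by rewrite mulr0.
by rewrite divff// tree_factor_neq0.
Qed.

Lemma herm_ncoord (u v : H) : herm u v = (kappa al c n k)%:C%C *
  \sum_(j < m) (ntree_weight al c j)%:C%C * (((ncoord j u)^*)%C * ncoord j v).
Proof.
rewrite /herm (reindex idx) /=; last exact: onW_bij idx_bij.
rewrite mulr_sumr; apply: eq_bigr => j _.
rewrite enum_rankK.
rewrite (@tree_norm_turn R al c irr j n k _ (ltn_ord j) (@dir_turn_dirseq j)).
have cM (x y : C) : ((x * y)^*)%C = (x^*)%C * (y^*)%C by rewrite rmorphM.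
by rewrite /ncoord; move: (factor j) => F; rewrite !cM; ring.
Qed.

Lemma wcoef_ntree (j : 'I_m) p : (p < n)%N -> wcoef c (vsval (ntree j)) p = ntree_coef al c j p.
Proof.
by move=> pn; rewrite val_ntree wcoefZ wcoef_tr// mulKf// tree_factor_neq0.
Qed.

Let nzA i : qnum (i.+1%:R * A) != 0.
Proof. exact: qnum_A. Qed.

Let nzA' i : (qnum (i.+1%:R * A))%:C%C != 0 :> C.
Proof. by apply: contraNneq (nzA i) => -[/eqP]. Qed.

Lemma ntree_weight_neq0 j : ntree_weight al c j != 0.
Proof. by rewrite /ntree_weight mulf_neq0 ?invr_eq0. Qed.

(** The addition formula [[x + y] = [x] q^-y + q^x [y]] at [x = A], [y = p A]. *)
Lemma qnum_rec p : (qnum A)%:C%C * a ^- p + a * (qnum (p%:R * A))%:C%C =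
  (qnum (p.+1%:R * A))%:C%C.
Proof.
move: A => B; have -> : p.+1%:R * B = p%:R * B + B by rewrite -natr1 mulrDl mul1r.
rewrite !qnum_qpow qpowD qpow_nat.
have a0 := qpow_neq0 B; have ap0 : qpow B ^+ p != 0 by rewrite expf_neq0.
have D0 : 2 * 'i%C != 0 :> C by rewrite mulf_neq0 ?pnatr_eq0 ?neq0Ci.
move: D0 (qpow B ^+ p) (qpow B) a0 ap0; move: (2 * 'i%C) => D D0 b x x0 b0.
by field; rewrite D0 x0 b0.
Qed.

(** Read off from the values of [phi p] on the normalized trees divided by their weights, so that
    [phi p] becomes the pairing with [eig p]. *)
Definition eigc (j p : nat) : R :=
  if j == p then 1 else if j.+1 == p then - (ntree_weight al c j)^-1 else 0.

Lemma phi_ntree_coef j p : ntree_coef al c j p.+1 - a^-1 * ntree_coef al c j p =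
  (- ntree_weight al c j * eigc j p)%:C%C.
Proof.
have a0 := qpow_neq0 A.
rewrite /ntree_coef /eigc; case: (ltngtP j p) => [jp|pj|->].
- rewrite eqSS gtn_eqF// [p == _]eq_sym; case: eqP => [_|_].
    by rewrite mulrNN mulfV ?ntree_weight_neq0// sub0r mulrN opprK mulVf.
  by rewrite !mulr0 subr0.
- rewrite (_ : j.+1 == p = false) ?mulr0; last by rewrite gtn_eqF// ltnW// ltnS ltnW.
  rewrite exprS invfM mulrCA; exact: subrr.
rewrite ?ltnn ?eqxx mulr1.
have -> : (- ntree_weight al c p)%:C%C =
    - ((qnum (p.+2%:R * A))%:C%C / (qnum (p.+1%:R * A))%:C%C) :> C.
  by rewrite /ntree_weight rmorphN rmorphM fmorphV.
rewrite -(qnum_rec p.+1).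
have -> : (qnum A / qnum (p.+1%:R * A))%:C%C =
    (qnum A)%:C%C / (qnum (p.+1%:R * A))%:C%C :> C by rewrite rmorphM fmorphV.
have := nzA' p; move: (p.+1%:R * A) => B B0.
rewrite exprS; have ap : a ^+ p != 0 by rewrite expf_neq0.
by move: (a ^+ p) ap => b b0; field; rewrite B0 a0 b0.
Qed.

Definition phi p (f : H) : C := wcoef c (vsval f) p.+1 - a^-1 * wcoef c (vsval f) p.

Definition eig p : H := \sum_(j < m) (eigc j p)%:C%C *: ntree j.

Lemma ncoord_sum (x : 'I_m -> C) j : ncoord j (\sum_i x i *: ntree i) = x j.
Proof.
have L := ncoord_linear j.
have -> : ncoord j (\sum_i x i *: ntree i) = \sum_i x i * ncoord j (ntree i).
  have n00 : ncoord j 0 = 0.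
    by have := L (-1) 0 0; rewrite scaler0 addr0 scaleN1r addNr.
  elim/big_rec2: _ => [//|i y f _ <-]; exact: L.
rewrite (bigD1 j)//= ncoord_ntree eqxx mulr1 big1 ?addr0// => i ij.
by rewrite ncoord_ntree eq_sym (negPf ij) mulr0.
Qed.

Lemma ncoord_eig j p : ncoord j (eig p) = (eigc j p)%:C%C.
Proof. exact: ncoord_sum. Qed.

Lemma wcoef_ncoord f p : (p < n)%N ->
  wcoef c (vsval f) p = \sum_(j < m) ncoord j f * ntree_coef al c j p.
Proof.
move=> pn; rewrite {1}(ncoordK f) val_lin_sum wcoef_sum.
by apply: eq_bigr => j _; rewrite wcoef_ntree.
Qed.

Lemma phi_ncoord f p : (p.+1 < n)%N ->
  phi p f = \sum_(j < m) ncoord j f * (- ntree_weight al c j * eigc j p)%:C%C.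
Proof.
move=> pn; rewrite /phi !wcoef_ncoord//; last exact: ltnW.
rewrite mulr_sumr -sumrB; apply: eq_bigr => j _; rewrite -phi_ntree_coef; ring.
Qed.

(** Functional and vector of the Burau formula correspond under the form; this is why the generators
    are phases times orthogonal reflections for it. *)
Lemma herm_eig p f : (p.+1 < n)%N ->
  herm (eig p) f = - (kappa al c n k)%:C%C * phi p f.
Proof.
move=> pn; rewrite herm_ncoord phi_ncoord// mulNr -mulrN; congr (_ * _).
rewrite -sumrN; apply: eq_bigr => j _.
have -> : (- ntree_weight al c j * eigc j p)%:C%C =
    - ((ntree_weight al c j)%:C%C * (eigc j p)%:C%C) :> C.
  by rewrite mulNr rmorphN rmorphM.
by rewrite ncoord_eig conjc_real; ring.
Qed.

(** Identifies [eig p], built from the form, with the direction vector of [wcoef_sigma]. The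
    geometric parts of trees [p - 1] and [p] cancel below [p], and [qnum_rec] gives 1 at [p]. *)
Lemma wcoef_eig p q : (p < m)%N -> (q < n)%N ->
  wcoef c (vsval (eig p)) q = (q == p)%:R - a * (q == p.+1)%:R.
Proof.
have a0 := qpow_neq0 A.
move=> pm qn; rewrite wcoef_ncoord//.
under eq_bigr => j _ do rewrite ncoord_eig.
rewrite (bigD1 (Ordinal pm))//= {1}/eigc eqxx mul1r.
have -> : \sum_(i < m | i != Ordinal pm) (eigc i p)%:C%C * ntree_coef al c i q =
   if p is p'.+1 then - ((ntree_weight al c p')^-1)%:C%C * ntree_coef al c p' q else 0.
  case: p pm => [|p'] pm.
    rewrite big1// => i; rewrite -val_eqE /= => /negPf i0.
    by rewrite /eigc i0 mul0r.
  rewrite (bigD1 (Ordinal (ltnW pm)))/=; last by rewrite -val_eqE /= ltn_eqF.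
  rewrite big1 ?addr0 => [|i].
    by rewrite /eigc ltn_eqF// eqxx rmorphN.
  rewrite -!val_eqE /= => /andP[/negPf i1 /negPf i2].
  by rewrite /eigc i1 eqSS i2 mul0r.
have P1 := nzA' p.
rewrite /ntree_coef; case: (ltngtP q p) => [qp|pq|->].
- rewrite (_ : (q == p.+1) = false) ?mulr0 ?subr0; last by rewrite ltn_eqF// ltnW.
  case: p pm qp P1 => // p' pm qp P1.
  rewrite ltnS in qp; rewrite qp /ntree_weight invfM invrK !rmorphM !fmorphV /=.
  have := nzA' p'; move: (p'.+1%:R * A) (p'.+2%:R * A) P1 => B B' B0' B0.
  by field; rewrite B0 B0' expf_neq0.
- rewrite -[(p < q)%N]/(p.+1 <= q)%N in pq.
  have -> : (if p is p'.+1 then - ((ntree_weight al c p')^-1)%:C%C *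
     (if (q <= p')%N then (qnum A / qnum (p'.+1%:R * A))%:C%C * a ^- q
      else if q == p'.+1 then - a else 0) else 0) = 0 :> C.
    case: p pm pq P1 => // p' pm pq P1.
    rewrite leqNgt (_ : (p' < q)%N) /=; last by apply: leq_trans pq; exact: leqW.
    by rewrite gtn_eqF ?mulr0.
  by case: eqP => _; rewrite ?addr0 ?mulr1 ?mulr0 ?sub0r ?oppr0.
rewrite ltn_eqF// mulr0 subr0.
have := qnum_rec p; case: p pm P1 => [|p'] pm P1 E.
  rewrite addr0 expr0 invr1 mulr1 mul1r divff//.
  by have := nzA 0; rewrite mul1r.
rewrite ltnn eqxx /ntree_weight invfM invrK !rmorphM !fmorphV /=.
rewrite (_ : _ + _ = ((qnum A)%:C%C * a ^- p'.+1 +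
   a * (qnum (p'.+1%:R * A))%:C%C) / (qnum (p'.+2%:R * A))%:C%C).
  by rewrite E divff.
have := nzA' p'; move: (p'.+1%:R * A) (p'.+2%:R * A) P1 {E} => B B' B0' B0.
have ap : a ^+ p'.+1 != 0 by rewrite expf_neq0.
by move: (a ^+ p'.+1) ap => b b0; field; rewrite ?B0 ?B0' ?b0.
Qed.

Lemma post_sigma p f : (p.+1 < n)%N -> post k (sigma al n p.+1) f =
  twist al c *: f + (Q * phi p f) *: eig p.
Proof.
move=> pn; have pm : (p < m)%N by rewrite -ltnS nE.
apply: subvs_inj; rewrite val_post; last exact: sigma_hom.
rewrite valP_lin; set u := vsval ((Q * phi p f) *: eig p).
have -> : u = (Q * phi p f) *: vsval (eig p).
  by rewrite /u -[X in vsval X]addr0 valP_lin linear0 addr0.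
apply/eqP; rewrite -subr_eq0; apply/eqP.
apply: (hom_wcoef_inj irr n0 kc).
  rewrite memvB ?memvD ?memvZ ?subvsP//.
  apply: (@homspace_comp R X Y Y _ (vsval f)); first exact: sigma_hom.
  exact: subvsP.
move=> q qn; rewrite -scaleN1r wcoefD wcoefZ wcoefD !wcoefZ wcoef_sigma// wcoef_eig//.
by rewrite /phi; ring.
Qed.

End Model.

(** * Density *)

Section Density.
Variables (R : realType) (n : nat) (k : int) (al : R) (c : bool).
Local Notation C := R[i].
Hypothesis irr : irrational al.
Hypothesis n0 : (0 < n)%N.
Hypothesis kc : k = if c then n%:Z - 3 else - (n%:Z - 3).
Local Notation A := (path_step al c).
Local Notation a := (qpow A).
Local Notation Q := (qpow ((al + 1) * (al - 1) / 2)).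
Local Notation H := (Hspace n k al).
Local Notation m := n.-1.
Local Notation d := (\dim {: H}).
Local Notation eb := (vbasis {: H}).
Local Notation ebP := (vbasisP {: H}).
Local Notation kap := (kappa al c n k).
Local Notation E p := (eig n k al c p).
Local Notation nt j := (ntree k al c j).
Local Notation nc j := (@ncoord R n k al c n0 kc j).

Let nE : m.+1 = n := prednK n0.
Let a0 : a != 0 := qpow_neq0 A.

Lemma kappa_neq0 : kap != 0.
Proof.
have A0 : qnum A != 0 by have := qnum_A c irr (j := 1) isT; rewrite mul1r.
have out0 : qnum (out_color n k al + 1) != 0.
  have := irr_nat irr (k + 1) n0.
  by rewrite rmorphD /= addrA.
have al0 : qnum (al + 1) != 0 by have := irr_nat irr 1 (ltn0Sn 0); rewrite mul1r.
have nA0 : qnum (n%:R * A) != 0 by exact: qnum_A.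
by rewrite /kappa; case: (c) A0 nA0 => A0 nA0;
  rewrite !mulf_neq0 ?oppr_eq0 ?invr_eq0 ?expf_neq0.
Qed.

Let kapC : kap%:C%C != 0 :> C.
Proof. by apply: contraNneq kappa_neq0 => -[/eqP]. Qed.

Lemma herm_linear (w : H) x u v : herm w (x *: u + v) = x * herm w u + herm w v.
Proof.
rewrite !(herm_ncoord irr n0 kc).
have -> : \sum_(j < m) (ntree_weight al c j)%:C%C * (((nc j w)^*)%C * nc j (x *: u + v)) =
    x * (\sum_(j < m) (ntree_weight al c j)%:C%C * (((nc j w)^*)%C * nc j u)) +
    \sum_(j < m) (ntree_weight al c j)%:C%C * (((nc j w)^*)%C * nc j v).
  rewrite mulr_sumr -big_split /=; apply: eq_bigr => j _.
  have -> : nc j (x *: u + v) = x * nc j u + nc j v by exact: ncoord_linear.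
  by ring.
by ring.
Qed.

Lemma herm_sym (u v : H) : herm v u = ((herm u v)^*)%C.
Proof.
have cM (x y : C) : ((x * y)^*)%C = (x^*)%C * (y^*)%C by rewrite rmorphM.
rewrite !(herm_ncoord irr n0 kc) cM conjc_real; congr (_ * _).
rewrite rmorph_sum; apply: eq_bigr => j _.
move: (nc j v) (nc j u) => x y.
have E : (((ntree_weight al c j)%:C%C * ((y^*)%C * x))^*)%C =
    (ntree_weight al c j)%:C%C * (y * (x^*)%C) :> C.
  by rewrite !cM conjc_real conjcK.
by apply: etrans (esym E); rewrite [y * _]mulrC.
Qed.

(** Up to a non-zero constant this is [[A + 1]], that is [[al + 2]] or [[al]]. Its non-vanishing
    makes the vectors [E p] non-isotropic. *)
Lemma a_sum_neq0 : a + a^-1 != 0.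
Proof.
have A1 : qnum (A + 1) != 0.
  have := irr_nat irr (if c then 2 else 0) (ltn0Sn 0); rewrite mul1r /path_step.
  by case: (c) => /=; rewrite -addrA ?addNr ?addr0.
have : (qnum (A + 1))%:C%C != 0 :> C by apply: contraNneq A1 => -[/eqP].
rewrite qnum_qpow qpowD qpow1 invfM; apply: contraNneq => E.
have -> : (a * 'i%C) - (a^-1 * ('i%C)^-1) = 'i%C * (a + a^-1).
  have -> : ('i%C)^-1 = - 'i%C :> C by exact: invCi.
  by ring.
by rewrite E mulr0 mul0r.
Qed.

Lemma phi_eig p : (p < m)%N -> phi c p (E p) = - (a + a^-1).
Proof.
move=> pm; have p1 : (p.+1 < n)%N by rewrite -nE ltnS.
rewrite /phi !wcoef_eig// ?(ltnW p1)// !eqxx gtn_eqF// ltn_eqF//.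
by rewrite mulr0 subr0 !mulr1 sub0r opprD.
Qed.

Lemma phi_eigS p : (p.+1 < m)%N -> phi c p (E p.+1) = 1.
Proof.
move=> pm; have p1 : (p.+1 < n)%N by rewrite -nE ltnS ltnW.
rewrite /phi !wcoef_eig// ?(ltnW p1)// !eqxx !ltn_eqF//.
by rewrite !mulr0 !subr0 mulr0 subr0.
Qed.

Definition mat_of (g : 'End(H)) : 'M[C]_d := passmx.mxof eb eb g.
Definition row_of (f : H) : 'rV[C]_d := passmx.rVof eb f.
Definition vec_of (u : 'rV[C]_d) : H := passmx.vecof eb u.
Definition herm_row (u v : 'rV[C]_d) : C := herm (vec_of u) (vec_of v).

Lemma rowK f : vec_of (row_of f) = f. Proof. exact: (passmx.rVofK ebP). Qed.
Lemma vecK u : row_of (vec_of u) = u. Proof. exact: (passmx.vecofK ebP). Qed.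
Lemma mul_mat u g : u *m mat_of g = row_of (g (vec_of u)).
Proof. exact: passmx.mul_mxof. Qed.
Lemma row_linear x u v : row_of (x *: u + v) = x *: row_of u + row_of v.
Proof. exact: passmx.rVof_linear. Qed.
Lemma row_of0 : row_of 0 = 0.
Proof. by have := row_linear (-1) 0 0; rewrite scaler0 addr0 scaleN1r addNr. Qed.
Lemma row_ofZ x u : row_of (x *: u) = x *: row_of u.
Proof. by have := row_linear x u 0; rewrite !addr0 row_of0 addr0. Qed.
Lemma vec_linear x u v : vec_of (x *: u + v) = x *: vec_of u + vec_of v.
Proof. exact: passmx.vecof_linear. Qed.
Lemma mat_comp g h : mat_of (g \o h)%VF = mat_of h *m mat_of g.
Proof. exact: (passmx.mxof_comp eb eb ebP). Qed.
Lemma mat1 : mat_of \1%VF = 1%:M.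
Proof. exact: (passmx.mxof1 (basis_free ebP)). Qed.

Lemma mat_ofZ x g : mat_of (x *: g) = x *: mat_of g.
Proof.
apply: (mx_row_ext (R := R)) => u.
by rewrite -scalemxAr !mul_mat scale_lfunE row_ofZ.
Qed.

Lemma herm_row_linear w x u v : herm_row w (x *: u + v) = x * herm_row w u + herm_row w v.
Proof. by rewrite /herm_row vec_linear herm_linear. Qed.

Lemma herm_row_sym u v : herm_row v u = ((herm_row u v)^*)%C.
Proof. exact: herm_sym. Qed.

(** The second eigenvalue of a braid generator divided by [twist]. *)
Definition ratio : C := if c then - a ^- 2 else - a ^+ 2.

Lemma ratio_expi : ratio = expi (pi * (if c then - al else al)).
Proof.
have qE (x : R) : expi (pi * x) = qpow (x + x).
  by rewrite /expi /qpow -mulr2n -[x *+ 2]mulr_natr mulrA mulfK ?pnatr_eq0.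
rewrite qE /ratio; have := qpow_al1 al c; have := qpow_alN1 al c; case: (c) => q1 q2.
  have -> : - al + - al = - (al + 1 + (al + 1)) + 2 by ring.
  by rewrite [RHS]qpowD qpow2 qpowN [qpow (_ + (al + 1))]qpowD q2 mulrN1.
have -> : al + al = al - 1 + (al - 1) + 2 by ring.
by rewrite [RHS]qpowD qpow2 [qpow (_ + (al - 1))]qpowD q1 mulrN1.
Qed.

Lemma twist_unit : twist al c * ((twist al c)^*)%C = 1.
Proof.
have u x : qpow x * ((qpow x)^*)%C = 1 :> C by rewrite conj_qpow divff ?qpow_neq0.
by rewrite /twist; case: (c); rewrite -?qpowN -qpowD u.
Qed.

Lemma ratio_unit : ratio * (ratio^*)%C = 1.
Proof. by rewrite ratio_expi -sqr_normc cabsE cabs_expi expr1n. Qed.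

Lemma herm_row_eig p u : (p < m)%N -> herm_row (row_of (E p)) u = - kap%:C%C * phi c p (vec_of u).
Proof.
by move=> pm; rewrite /herm_row rowK (herm_eig irr n0 kc)// -nE ltnS.
Qed.

Lemma herm_row_eig_self p : (p < m)%N ->
  herm_row (row_of (E p)) (row_of (E p)) = kap%:C%C * (a + a^-1).
Proof. by move=> pm; rewrite herm_row_eig// rowK phi_eig// mulrNN. Qed.

Lemma herm_row_eig_neq0 p : (p < m)%N -> herm_row (row_of (E p)) (row_of (E p)) != 0.
Proof. by move=> pm; rewrite herm_row_eig_self// mulf_neq0 ?a_sum_neq0. Qed.

Lemma mat_sigma p : (p < m)%N ->
  mat_of (post k (sigma al n p.+1)) = twist al c *: refl_mx herm_row (row_of (E p)) ratio.
Proof.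
move=> pm; apply: (mx_row_ext (R := R)) => u.
rewrite mul_mat (post_sigma irr n0 kc); last by rewrite -nE ltnS.
rewrite row_linear vecK -scalemxAr mul_refl_mx; last exact: herm_row_linear.
rewrite scalerDr scalerA; congr (_ + _).
rewrite row_ofZ; congr (_ *: _); rewrite herm_row_eig_self// herm_row_eig//.
have E1 : twist al c * (ratio - 1) = - Q * (a + a^-1).
  by rewrite /twist /ratio; case: (c) a0 => a1; field.
rewrite mulrA E1; have := a_sum_neq0; move: (a + a^-1) (phi _ _ _) kapC => s ph k1 s1.
by field; rewrite k1 s1.
Qed.

(** Unit scalars are included because they are invisible in [PSU]; they also serve to cancel
    [twist]. *)
Definition phased_braids (M : 'M[C]_d) : Prop := exists w : braid_word n,
  exists2 z : C, z * (z^*)%C = 1 & M = z *: mat_of (post k (braid_act al w)).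

Lemma phased_braids1 : phased_braids 1%:M.
Proof.
exists [::]; exists 1; first by rewrite rmorph1 mulr1.
by rewrite scale1r [braid_act _ _]/= post_id mat1.
Qed.

Lemma phased_braidsM g h : phased_braids g -> phased_braids h -> phased_braids (g *m h).
Proof.
(* Matrices act on rows from the right, so composition reverses the order of the words. *)
move=> [w [z z1 ->]] [w' [z' z1' ->]]; exists (w' ++ w); exists (z * z').
  by rewrite rmorphM mulrACA z1 z1' mulr1.
rewrite braid_act_cat post_comp ?braid_act_hom// mat_comp.
by rewrite -scalemxAl -scalemxAr scalerA.
Qed.

Lemma phased_braidsV g : phased_braids g -> exists2 h, phased_braids h & g *m h = 1%:M.
Proof.
move=> [w [z z1 ->]]; have [w' ww'] := braid_act_inv al w.
exists ((z^*)%C *: mat_of (post k (braid_act al w'))).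
  by exists w', (z^*)%C => //; rewrite conjcK mulrC.
apply: mulmx1C; rewrite -scalemxAl -scalemxAr scalerA mulrC z1 scale1r.
by rewrite -mat_comp -post_comp ?braid_act_hom// ww' post_id mat1.
Qed.

Lemma phased_braids_refl p j : (p < m)%N ->
  phased_braids (refl_mx herm_row (row_of (E p)) (ratio ^+ j)).
Proof.
move=> pm; have nz := herm_row_eig_neq0 pm.
elim: j => [|j IH]; first by rewrite expr0 refl_mx1; exact: phased_braids1.
rewrite exprS -refl_mxM//; last exact: herm_row_linear.
apply: phased_braidsM => //; exists [:: (Ordinal pm, false)], ((twist al c)^*)%C.
  by rewrite conjcK mulrC twist_unit.
rewrite [braid_act _ _]/= comp_lfun1r mat_sigma// scalerA mulrC twist_unit.
by rewrite scale1r.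
Qed.

(** Some power of [ratio] is within [e * s] of [e^(is)], so powers of one reflection approximate
    every short rotation along [E p] to the accuracy of a tangent direction. *)
Lemma tangent_eig p : (p < m)%N ->
  tangent phased_braids ('i%C *: line_proj herm_row (row_of (E p))).
Proof.
move=> pm eps e0; set P := line_proj _ _.
have irr' : irrational (if c then - al else al).
  case: (c) => //; move=> [q _ qe]; apply: irr; exists (- q) => //.
  by rewrite rmorphN /= qe opprK.
pose e := eps / (2 * (mxnorm P + 1)).
have N0 : 0 < mxnorm P + 1 by rewrite ltr_wpDl ?mxnorm_ge0.
have e'0 : 0 < e by rewrite divr_gt0// mulr_gt0.
have [dl d0 Hd] := expi_taylor e'0.
exists dl => // s s0 sd.
have [j hj] := expi_dense s irr' (mulr_gt0 e'0 s0).
exists (refl_mx herm_row (row_of (E p)) (ratio ^+ j)); first exact: phased_braids_refl.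
have -> : refl_mx herm_row (row_of (E p)) (ratio ^+ j) - 1%:M - s%:C%C *: ('i%C *: P) =
   (ratio ^+ j - expi s + (expi s - 1 - s%:C%C * 'i%C)) *: P.
  rewrite /refl_mx -/P; clear; move: (ratio ^+ j) (expi s) => x y.
  by rewrite [1%:M + _]addrC addrK scalerA -scalerBl; congr (_ *: _); ring.
rewrite mxnormZ; apply: (@le_trans _ _ ((e * s + e * s) * (mxnorm P + 1))).
  apply: ler_pM; [exact: cabs_ge0|exact: mxnorm_ge0| |by rewrite lerDl].
  apply: le_trans (cabsD _ _) _; apply: lerD; last exact: Hd.
  by rewrite ratio_expi.
have -> : (e * s + e * s) * (mxnorm P + 1) = e * (2 * (mxnorm P + 1)) * s by ring.
by rewrite /e divfK// gt_eqF// mulr_gt0.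
Qed.

Definition ntree_nat (i : nat) : H := if insub i is Some j then nt j else 0.

Lemma ntree_natE (i : 'I_m) : ntree_nat i = nt i.
Proof. by rewrite /ntree_nat valK. Qed.

Lemma row_ntree_nat_span u : exists x : nat -> C, u = \sum_(i < m) x i *: row_of (ntree_nat i).
Proof.
pose x i := if insub i is Some j then nc j (vec_of u) else 0.
exists x; rewrite -[LHS]vecK [in LHS](ncoordK irr n0 kc (vec_of u)).
have S (F : 'I_m -> C) (f : 'I_m -> H) :
    row_of (\sum_i F i *: f i) = \sum_i F i *: row_of (f i).
  elim/big_rec2: _ => [|i y v _ <-]; first exact: row_of0.
  exact: row_linear.
by rewrite S; apply: eq_bigr => i _; rewrite ntree_natE /x valK.
Qed.

(** [E j] is the normalized tree [j] plus a multiple of the preceding one, so the change of basis is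
    unitriangular. *)
Lemma row_eig_span u : exists x : nat -> C, u = \sum_(i < m) x i *: row_of (E i).
Proof.
pose P v := exists x : nat -> C, v = \sum_(i < m) x i *: row_of (E i).
have P0 : P 0 by exists (fun=> 0); rewrite big1// => i _; rewrite scale0r.
have PZ x v : P v -> P (x *: v).
  move=> [y ->]; exists (fun i => x * y i); rewrite scaler_sumr.
  by apply: eq_bigr => i _; rewrite scalerA.
have PD v w : P v -> P w -> P (v + w).
  move=> [y ->] [z ->]; exists (fun i => y i + z i); rewrite -big_split /=.
  by apply: eq_bigr => i _; rewrite scalerDl.
have PE (i : 'I_m) : P (row_of (E i)).
  exists (fun l : nat => (l == i :> nat)%:R); rewrite (bigD1 i)//= eqxx scale1r big1 ?addr0//.
  by move=> l; rewrite -val_eqE /= => /negPf ->; rewrite scale0r.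
have S (F : 'I_m -> C) (f : 'I_m -> H) :
    row_of (\sum_i F i *: f i) = \sum_i F i *: row_of (f i).
  elim/big_rec2: _ => [|i y v _ <-]; first exact: row_of0.
  exact: row_linear.
have Pn j : (j < m)%N -> P (row_of (ntree_nat j)).
  elim/ltn_ind: j => j IH jm.
  have -> : row_of (ntree_nat j) = row_of (E j) + \sum_(i < m | i != Ordinal jm)
      (- (eigc al c i j)%:C%C) *: row_of (nt i).
    rewrite /eig S (bigD1 (Ordinal jm))//= /eigc eqxx scale1r -addrA -big_split /=.
    rewrite big1 ?addr0 => [|i _]; last by rewrite scaleNr subrr.
    by rewrite -(ntree_natE (Ordinal jm)).
  apply: (PD); first exact: (PE (Ordinal jm)).
  apply: (big_ind P P0 PD) => i ij; rewrite -(ntree_natE i).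
  have [ilt|ige] := ltnP i j; first by apply: PZ; apply: IH.
  rewrite /eigc -[i == j :> nat]/(val i == val (Ordinal jm)) val_eqE (negPf ij).
  by rewrite gtn_eqF ?oppr0 ?scale0r.
have [x ->] := row_ntree_nat_span u.
apply: (big_ind P P0 PD) => i _; apply: PZ; exact: Pn.
Qed.

Lemma herm_row_ntree_nat (i j : 'I_m) :
  herm_row (row_of (ntree_nat i)) (row_of (ntree_nat j)) =
  if i == j then (kap * ntree_weight al c i)%:C%C else 0.
Proof.
have nti l l' : nc l (nt l') = (l == l')%:R by exact: ncoord_ntree.
rewrite /herm_row !rowK !ntree_natE (herm_ncoord irr n0 kc).
have -> : \sum_(l < m) (ntree_weight al c l)%:C%C * (((nc l (nt i))^*)%C * nc l (nt j)) =
    (ntree_weight al c i)%:C%C * (i == j)%:R.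
  rewrite (bigD1 i)//= big1 ?addr0 => [|l li].
    by rewrite (nti i i) (nti i j) eqxx rmorph1 mul1r.
  by rewrite (nti l i) (negPf li) rmorph0 mul0r mulr0.
by case: eqP => _; rewrite ?mulr1 ?mulr0 ?rmorphM.
Qed.

Lemma preserves_approximable (g : 'M[C]_d) : preserves herm_row g -> approximable phased_braids g.
Proof.
have mu0 := ntree_weight_neq0 c irr.
have chain i : (i.+1 < m)%N -> herm_row (row_of (E i)) (row_of (E i.+1)) != 0.
  by move=> im; rewrite herm_row_eig ?(ltnW im)// rowK phi_eigS// mulr1 oppr_eq0.
have nz i : (i < m)%N -> herm_row (row_of (ntree_nat i)) (row_of (ntree_nat i)) != 0.
  move=> im; have := herm_row_ntree_nat (Ordinal im) (Ordinal im); rewrite eqxx /= => ->.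
  apply/negP => /eqP -[/eqP]; rewrite mulf_eq0 (negPf kappa_neq0) /=.
  exact/negP.
have orth i j : (i < m)%N -> (j < m)%N -> i != j ->
    herm_row (row_of (ntree_nat i)) (row_of (ntree_nat j)) = 0.
  move=> im jm ij; have := herm_row_ntree_nat (Ordinal im) (Ordinal jm).
  by rewrite -val_eqE /= (negPf ij).
exact: (@approximable_preserves R d herm_row herm_row_linear herm_row_sym
  phased_braids phased_braids1 phased_braidsM phased_braidsV m
  (fun i => row_of (E i)) row_eig_span herm_row_eig_neq0 chain tangent_eig m
  (fun i => row_of (ntree_nat i)) row_ntree_nat_span nz orth g).
Qed.

Lemma mat_inj : injective mat_of.
Proof. exact: (can_inj (passmx.mxofK ebP ebP)). Qed.

Lemma preserves_herm (g : 'End(H)) :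
  preserves herm_row (mat_of g) <-> (forall u v, herm (g u) (g v) = herm u v).
Proof.
split=> hg u v.
  by have := hg (row_of u) (row_of v); rewrite !mul_mat /herm_row !rowK.
by rewrite !mul_mat /herm_row !rowK.
Qed.

Lemma post_letter_herm (l : 'I_n.-1 * bool) (u v : H) :
  let g := post k (if l.2 then (sigma al n l.1.+1)^-1 else sigma al n l.1.+1)%VF in
  herm (g u) (g v) = herm u v.
Proof.
move=> g; case: l @g => p b g.
have pm := ltn_ord p.
have sh : forall u v, herm (post k (sigma al n p.+1) u) (post k (sigma al n p.+1) v)
    = herm u v.
  apply/preserves_herm; rewrite mat_sigma// => x y.
  rewrite -!scalemxAr (formZl herm_row_linear herm_row_sym) (formZr herm_row_linear).
  rewrite mulrA [(_^*)%C * _]mulrC twist_unit mul1r.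
  apply: preserves_refl_mx; [exact: herm_row_linear|exact: herm_row_sym|
    exact: herm_row_eig_neq0|exact: ratio_unit].
rewrite /g /=; case: b {g} => //.
have s0 : lker (sigma al n p.+1) == 0%VS.
  by apply: sigma_lker0; lia.
have sK x : post k (sigma al n p.+1) (post k (sigma al n p.+1)^-1%VF x) = x.
  rewrite -comp_lfunE -post_comp ?sigma_hom//.
    by rewrite lker0_compfV_endo// post_id id_lfunE.
  exact: (braid_letter_hom al (p, true)).
by rewrite -sh !sK.
Qed.

Lemma post_braid_isometry (w : braid_word n) : Defs.isometry (post k (braid_act al w)).
Proof.
split.
  have [w' ww'] := braid_act_inv al w.
  have GG : mat_of (post k (braid_act al w)) *m mat_of (post k (braid_act al w')) = 1%:M.
    apply: mulmx1C; rewrite -mat_comp -post_comp ?braid_act_hom//.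
    by rewrite ww' post_id mat1.
  have K : (post k (braid_act al w') \o post k (braid_act al w))%VF = \1%VF.
    by apply: mat_inj; rewrite mat_comp GG mat1.
  exists (post k (braid_act al w')) => x.
    by rewrite -comp_lfunE K id_lfunE.
  by rewrite -comp_lfunE -post_comp ?braid_act_hom// ww' post_id id_lfunE.
elim: w => [|l w IH] u v; first by rewrite [braid_act _ _]/= post_id !id_lfunE.
rewrite [braid_act _ _]/= post_comp ?braid_act_hom ?braid_letter_hom//.
by rewrite !comp_lfunE post_letter_herm IH.
Qed.

Lemma braid_image_dense : dense (@braid_image R n k al).
Proof.
move=> O [p Op] oO.
pose g0 : unitary_group n k al := repr p.
have pg0 : to_PSU g0 = p by exact: reprK.
(* Through the quotient and initial topologies, [O] pulls back to an open set [B] of matrices. *)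
have /= [B oB BE] : open ((@to_PSU R n k al) @^-1` O)%classic by exact: oO.
have Bg0 : B (unitary_mx g0).
  have : ((@unitary_mx R n k al) @^-1` B)%classic g0 by rewrite BE /= pg0.
  by [].
have [/= eps eps0 Heps] : nbhs_ball (unitary_mx g0) B.
  by apply/nbhs_ballP; exact: open_nbhs_nbhs.
(* The radius of the ball lives in [R[i]], where being positive entails being real. *)
have [e e0 eE] : exists2 e : R, 0 < e & eps = e%:C%C.
  exists (complex.Re eps); last by rewrite RRe_real// gtr0_real.
  by move: eps0; rewrite ltcE => /andP[].
have iso0 : Defs.isometry (sval g0) by apply/asboolP; exact: (svalP g0).
have pres : preserves herm_row (mat_of (sval g0)) by apply/preserves_herm; exact: iso0.2.
have e20 : 0 < e / 2 by rewrite divr_gt0.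
have [_ [w [z z1 ->]] hM] := preserves_approximable pres e20.
have isow := post_braid_isometry w.
(* [gw] belongs to the braid group and [gz] is its multiple by the phase [z]; [gz] is close to [g0],
   and both have the same class. *)
pose gw : unitary_group n k al := 
  exist (fun g : 'End(H) => `[< Defs.isometry g >]) _ (asboolT isow).
have isoz : Defs.isometry (z *: post k (braid_act al w)).
  have z0 : z != 0.
    by apply: contra_eqN z1 => /eqP ->; rewrite mul0r eq_sym oner_eq0.
  split.
    have [f fK Kf] := isow.1.
    exists (fun x => f (z^-1 *: x)) => x; rewrite scale_lfunE.
      by rewrite scalerA mulVf// scale1r fK.
    by rewrite Kf scalerA divff// scale1r.
  apply/preserves_herm => x y.
  rewrite mat_ofZ -!scalemxAr (formZl herm_row_linear herm_row_sym) (formZr herm_row_linear).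
  rewrite mulrA [(_^*)%C * _]mulrC z1 mul1r.
  exact: ((preserves_herm _).2 isow.2).
pose gz : unitary_group n k al := 
  exist (fun g : 'End(H) => `[< Defs.isometry g >]) _ (asboolT isoz).
have Bgz : B (unitary_mx gz).
  apply: Heps; split; first exact: eps0.
  move=> i j; rewrite /ball /= eE distrC cabsE ltcR.
  have -> : unitary_mx gz = z *: mat_of (post k (braid_act al w)) by exact: mat_ofZ.
  apply: le_lt_trans (_ : e / 2 < e); last by rewrite ltr_pdivrMr// ltr_pMr// ltr1n.
  apply: le_trans hM.
  have := cabs_le_mxnorm (z *: mat_of (post k (braid_act al w)) - mat_of (sval g0)) i j.
  by rewrite !mxE.
have Ogz : O (to_PSU gz).
  have : ((@unitary_mx R n k al) @^-1` B)%classic gz by [].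
  by rewrite BE.
exists (to_PSU gz); split => //.
exists gw; last first.
  apply/eqmodP/asboolP; exists (z^-1).
    have : `|z| ^+ 2 = 1 by rewrite sqr_normc.
    move/eqP; rewrite sqrp_eq1 ?normr_ge0// => /eqP z1'.
    by rewrite normfV z1' invr1.
  rewrite /uval /= scalerA mulVf ?scale1r//.
  by apply: contra_eqN z1 => /eqP ->; rewrite mul0r eq_sym oner_eq0.
by exists w => f; rewrite /uval /= val_post ?braid_act_hom.
Qed.

End Density.

Theorem theorem10 (R : realType) (n : nat) (alpha : R) (k : int)
  (hn : (1 <= n)%N)
  (halpha : irrational alpha)
  (hk : k = n%:Z - 3 \/ k = - (n%:Z - 3)) :
  dense (@braid_image R n k alpha).
Proof.
by case: hk => hk; [apply: (@braid_image_dense R n k alpha true)|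
  apply: (@braid_image_dense R n k alpha false)].
Qed.
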